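(* Let $\gamma$ be a unitary $2$-cocycle on a Hopf $*$-algebra $A$, let $B$ be a left $A$-comodule $*$-algebra equipped with an $A$-covariant complex structure $(\Omega^{(\bullet,\bullet)},\wedge,\partial,\overline\partial)$, and let $\mathscr H$ be an $A$-covariant Hermitian metric on an $A$-covariant holomorphic bimodule $(\mathcal E,\overline\partial_{\mathcal E})$ in ${}^A_B\mathsf{Mod}_B$ such that $\mathcal E$ is finitely generated and projective as a left $B$-module. Then the connection $$\nabla':=\varphi^{-1}_{\Omega^1,\mathcal E}\,\Gamma(\nabla_{\mathrm{Ch},\mathcal E})$$ is the Chern connection for the Hermitian metric $\mathscr H_\gamma$ on the holomorphic bimodule $(\Gamma(\mathcal E),\overline\partial_{\Gamma(\mathcal E)})$ in ${}^{A_\gamma}_{B_\gamma}\mathsf{Mod}_{B_\gamma}$. Thus $\nabla_{\mathrm{Ch},\Gamma(\mathcal E)}=\nabla'$.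
   Context: Hopf algebras and modules. Algebras are unital over $\mathbb C$, $\otimes=\otimes_{\mathbb C}$, Hopf algebras $(A,\Delta,\epsilon,S)$ have bijective antipode. A Hopf $*$-algebra is a Hopf algebra that is a $*$-algebra with $\Delta$ a $*$-homomorphism. Sweedler notation: $\Delta(a)=a_{(1)}\otimes a_{(2)}$; left coactions are $v\mapsto v_{(-1)}\otimes v_{(0)}$, iterated as $v_{(-2)}\otimes v_{(-1)}\otimes v_{(0)}$. A left $A$-comodule $*$-algebra is a left $A$-comodule algebra $B$ that is a $*$-algebra whose coaction is a $*$-homomorphism. ${}^A_B\mathsf{Mod}_B$ is the category of $B$-bimodules with a left $A$-coaction satisfying $\delta(aeb)=\delta(a)\delta(e)\delta(b)$; morphisms are $A$-colinear $B$-bilinear maps; it is monoidal under $\otimes_B$. ''$A$-covariant'' for a map means $A$-colinear. Cocycles. A $2$-cocycle on $A$ is a convolution-invertible linear $\gamma:A\otimes A\to\mathbb C$ (inverse $\bar\gamma$) with $\gamma(g_{(1)}\otimes h_{(1)})\gamma(g_{(2)}h_{(2)}\otimes k)=\gamma(h_{(1)}\otimes k_{(1)})\gamma(g\otimes h_{(2)}k_{(2)})$, always assumed unital: $\gamma(h\otimes1)=\epsilon(h)=\gamma(1\otimes h)$. It is unitary if $\overline{\gamma(a\otimes b)}=\bar\gamma(S(a)^*\otimes S(b)^* )$. Put $U(k)=\gamma(k_{(1)}\otimes S(k_{(2)}))$, $\bar U(k)=\bar\gamma(S(k_{(1)})\otimes k_{(2)})$, $V=U\circ S^{-1}$, $\bar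 V=\bar U\circ S^{-1}$, so $\bar V(k)=\bar\gamma(k_{(2)}\otimes S^{-1}(k_{(1)}))$. For unitary $\gamma$, $A_\gamma$ is the Hopf $*$-algebra with the coalgebra $A$, product $h\cdot_\gamma k=\gamma(h_{(1)}\otimes k_{(1)})h_{(2)}k_{(2)}\bar\gamma(h_{(3)}\otimes k_{(3)})$, antipode $S_\gamma(h)=U(h_{(1)})S(h_{(2)})\bar U(h_{(3)})$, involution $h^{*_\gamma}=\bar V(h_{(1)}^* )h_{(2)}^*V(h_{(3)}^* )$. $B_\gamma$ is the left $A_\gamma$-comodule $*$-algebra with underlying comodule $B$, $a\cdot_\gamma b=\gamma(a_{(-1)}\otimes b_{(-1)})a_{(0)}b_{(0)}$, $b^{*_\gamma}=\bar V(b_{(-1)}^* )b_{(0)}^*$. The functor $\Gamma:{}^A_B\mathsf{Mod}_B\to{}^{A_\gamma}_{B_\gamma}\mathsf{Mod}_{B_\gamma}$ is the identity on underlying comodules and maps, with actions $b\cdot_\gamma m=\gamma(b_{(-1)}\otimes m_{(-1)})b_{(0)}m_{(0)}$, $m\cdot_\gamma b=\gamma(m_{(-1)}\otimes b_{(-1)})m_{(0)}b_{(0)}$; it is monoidal via $\varphi_{V,W}:\Gamma(V)\otimes_{B_\gamma}\Gamma(W)\to\Gamma(V\otimes_BW)$, $v\otimes_{B_\gamma}w\mapsto\gamma(v_{(-1)}\otimes w_{(-1)})v_{(0)}\otimes_Bw_{(0)}$. $\Gamma$ is also applied (as the identity on underlying maps) to $A$-colinear linear maps. Calculi. An $A$-covariant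 differential calculus over $B$ is a differential graded algebra $(\Omega^\bullet=\bigoplus_{k\ge0}\Omega^k,\wedge,d)$ with $\Omega^0=B$, generated as an algebra by $B$ and $dB$, such that the coaction of $B$ extends to a comodule algebra structure on $\Omega^\bullet$ with each $\Omega^k$ in ${}^A_B\mathsf{Mod}_B$ and $d$ $A$-colinear. It is an $A$-covariant $*$-differential calculus if the involution of $B$ extends to a conjugate-linear involution of $\Omega^\bullet$ preserving each $\Omega^k$, with $(d\omega)^*=d(\omega^* )$, $(\omega\wedge\nu)^*=(-1)^{kl}\nu^*\wedge\omega^*$ for $\omega\in\Omega^k,\nu\in\Omega^l$, compatible with the coaction. Its deformation $\Omega^k_\gamma=\Gamma(\Omega^k)$, $d_\gamma=\Gamma(d)$, $\omega\wedge_\gamma\eta=\gamma(\omega_{(-1)}\otimes\eta_{(-1)})\omega_{(0)}\wedge\eta_{(0)}$, $\omega^{*_\gamma}=\bar V(\omega_{(-1)}^* )\omega_{(0)}^*$ is an $A_\gamma$-covariant $*$-differential calculus on $B_\gamma$. A left connection on $\mathcal E$ is a linear $\nabla:\mathcal E\to\Omega^1\otimes_B\mathcal E$ with $\nabla(be)=b\nabla(e)+db\otimes_Be$. Complex structures. A complex structure on a $*$-calculus is an $\mathbb N_0^2$-algebra grading $\Omega^\bullet=\bigoplus\Omega^{(p,q)}$ with $\Omega^k=\bigoplus_{p+q=k}\Omega^{(p,q)}$, $(\Omega^{(p,q)})^*=\Omega^{(q,p)}$, $d\Omega^{(p,q)}\subseteq\Omega^{(p+1,q)}\oplus\Omega^{(p,q+1)}$;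 $\pi^{p,q}$ are the projections, $\partial=\pi^{p+1,q}\circ d$, $\overline\partial=\pi^{p,q+1}\circ d$ on $\Omega^{(p,q)}$. It is $A$-covariant if the calculus is an $A$-covariant $*$-calculus and each $\Omega^{(p,q)}$ is a left $A$-(sub)comodule. Deformed: $\Omega^{(p,q)}_\gamma=\Gamma(\Omega^{(p,q)})$, $\partial_\gamma=\Gamma(\partial)$, $(\overline\partial)_\gamma=\Gamma(\overline\partial)$. Holomorphic bimodules. A covariant holomorphic bimodule is $(\mathcal E,\overline\partial_{\mathcal E})$, $\mathcal E$ in ${}^A_B\mathsf{Mod}_B$, $\overline\partial_{\mathcal E}:\mathcal E\to\Omega^{(0,1)}\otimes_B\mathcal E$ $A$-colinear with $\overline\partial_{\mathcal E}(be)=b\overline\partial_{\mathcal E}(e)+\overline\partial(b)\otimes_Be$ and $(\overline\partial\otimes_B\mathrm{id}-\mathrm{id}\wedge\overline\partial_{\mathcal E})\overline\partial_{\mathcal E}=0$. Its deformation is $\overline\partial_{\Gamma(\mathcal E)}=\varphi^{-1}_{\Omega^{(0,1)},\mathcal E}\Gamma(\overline\partial_{\mathcal E})$, which makes $\Gamma(\mathcal E)$ an $A_\gamma$-covariant holomorphic bimodule for the deformed complex structure. Hermitian metrics. For $M$ in ${}^A_B\mathsf{Mod}_B$, $\overline M=\{\overline m:m\in M\}$ is the conjugate vector space with $b\overline m=\overline{mb^*}$, $\overline mb=\overline{b^*m}$, coaction $\overline m\mapsto m_{(-1)}^*\otimes\overline{m_{(0)}}$. ${}_B\mathrm{Hom}(\mathcal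 E,B)$ is the space of left $B$-linear maps, with $(bf)(e)=f(eb)$, $(fb)(e)=f(e)b$, coaction $f_{(-1)}\otimes f_{(0)}(e)=S(e_{(-1)})[f(e_{(0)})]_{(-1)}\otimes[f(e_{(0)})]_{(0)}$. An $A$-covariant Hermitian metric on $\mathcal E$ is an isomorphism $\mathscr H:\overline{\mathcal E}\to{}_B\mathrm{Hom}(\mathcal E,B)$ in ${}^A_B\mathsf{Mod}_B$ such that $\langle x,\overline y\rangle:=\mathscr H(\overline y)(x)$ satisfies $\langle y,\overline x\rangle^*=\langle x,\overline y\rangle$. Its deformation $\mathscr H_\gamma=\mathfrak S\circ\Gamma(\mathscr H)\circ\mathfrak N_{\mathcal E}$ is an $A_\gamma$-covariant Hermitian metric on $\Gamma(\mathcal E)$, where $\mathfrak S(f)(v)=\gamma\big(v_{(-2)}\otimes S(v_{(-1)})[f(v_{(0)})]_{(-1)}\big)[f(v_{(0)})]_{(0)}$ and $\mathfrak N_{\mathcal E}:\overline{\Gamma(\mathcal E)}\to\Gamma(\overline{\mathcal E})$, $\mathfrak N_{\mathcal E}(\overline e)=\bar V(e_{(-1)}^* )\,\overline{e_{(0)}}$. Chern connections. The Chern connection $\nabla_{\mathrm{Ch},\mathcal E}$ of $(\mathcal E,\overline\partial_{\mathcal E},\mathscr H)$ is the unique (known to exist) $A$-covariant left connection $\nabla$ on $\mathcal E$ such that (1) $d\langle\,,\,\rangle=(\mathrm{id}\otimes_B\langle\,,\,\rangle)(\nabla\otimes_B\mathrm{id})+(\langle\,,\,\rangle\otimes_B\mathrm{id})(\mathrm{id}\otimes_B\widetilde\nabla)$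 as maps $\mathcal E\otimes_B\overline{\mathcal E}\to\Omega^1$, where $\widetilde\nabla(\overline e)=\sum_i\overline{e_i}\otimes_B\omega_i^*$ if $\nabla(e)=\sum_i\omega_i\otimes_Be_i$; and (2) $(\pi^{0,1}\otimes_B\mathrm{id})\nabla=\overline\partial_{\mathcal E}$. $\nabla_{\mathrm{Ch},\Gamma(\mathcal E)}$ is the Chern connection of $(\Gamma(\mathcal E),\overline\partial_{\Gamma(\mathcal E)},\mathscr H_\gamma)$. *)

(* Defs.v *)
From HB Require Import structures.
From mathcomp Require Import all_boot all_order all_algebra generic_quotient.
From mathcomp Require Import complex.
From mathcomp Require Import boolp classical_sets functions reals.

Set Implicit Arguments.
Unset Strict Implicit.
Unset Printing Implicit Defensive.

Import GRing.Theory.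
Local Open Scope classical_set_scope.
Local Open Scope quotient_scope.
Local Open Scope ring_scope.

(** Conventions.  A deformation by a cocycle changes the products, the actions
    and the involutions while the underlying vector spaces stay the same.
    Therefore every algebraic structure is given by a record of bare operations
    on a fixed [lmodType C] (suffix [_ops]) together with a predicate stating
    its axioms (prefix [is_]); a deformation is then a map between records of
    operations.  The ground field [C] is [R[i]] in the main statement. *)

(** [tens r l] is [M (x)_K N] for a right action [r] of [K] on [M] and a left
    action [l] of [K] on [N]: formal sums of pairs, two of them being identified
    when no [C]-bilinear [K]-balanced map separates them.  This makes it the
    universal target of such maps (see [tliftP] and [tlift_tpure]).  Nothing is
    required of [r] and [l]. *)
Section Tensor.
Variables (C : numClosedFieldType) (K : Type) (M N : lmodType C).
Variables (r : M -> K -> M) (l : K -> N -> N).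

Definition balanced (G : lmodType C) (f : M -> N -> G) : Prop :=
  [/\ forall n, linear (f^~ n), forall m, linear (f m)
    & forall m k n, f (r m k) n = f m (l k n)].

Definition tens_eqv (s t : seq (M * N)) : bool :=
  `[< forall (G : lmodType C) (f : M -> N -> G), balanced f ->
        \sum_(p <- s) f p.1 p.2 = \sum_(p <- t) f p.1 p.2 >].

Lemma tens_eqv_refl : reflexive tens_eqv.
Proof. by move=> s; apply/asboolP. Qed.

Lemma tens_eqv_sym : symmetric tens_eqv.
Proof.
by move=> s t; apply/asboolP/asboolP => h G f bf; rewrite h.
Qed.

Lemma tens_eqv_trans : transitive tens_eqv.
Proof.
move=> t s u /asboolP h1 /asboolP h2; apply/asboolP => G f bf.
by rewrite h1 // h2.
Qed.

Definition tens_equiv : equiv_rel (seq (M * N)) :=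
  EquivRel tens_eqv tens_eqv_refl tens_eqv_sym tens_eqv_trans.

Definition tens : Type := {eq_quot tens_equiv}.

HB.instance Definition _ := Choice.on tens.
HB.instance Definition _ := EqQuotient.on tens.

(** [tlift f t] evaluates [f] on some decomposition of [t] into elementary
    tensors.  It is meant for [f] bilinear and balanced (or conjugate-bilinear,
    such as [fun a b => a^* (x) b^*]), where the result does not depend on the
    decomposition; then it is the additive extension of [f]. *)
Definition tlift (G : nmodType) (f : M -> N -> G) (t : tens) : G :=
  \sum_(p <- repr t) f p.1 p.2.

Definition tpure (m : M) (n : N) : tens := \pi_tens [:: (m, n)].

Lemma tlift_pi (G : lmodType C) (f : M -> N -> G) (s : seq (M * N)) :
  balanced f -> tlift f (\pi_tens s) = \sum_(p <- s) f p.1 p.2.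
Proof.
move=> bf; rewrite /tlift; have /eqquotP/asboolP := reprK (\pi_tens s).
exact.
Qed.

Lemma tlift_tpure (G : lmodType C) (f : M -> N -> G) m n :
  balanced f -> tlift f (tpure m n) = f m n.
Proof. by move=> bf; rewrite tlift_pi // big_seq1. Qed.

Lemma tens_ext (t u : tens) :
  (forall (G : lmodType C) (f : M -> N -> G), balanced f ->
     tlift f t = tlift f u) -> t = u.
Proof.
move=> h; rewrite -[t]reprK -[u]reprK; apply/eqquotP/asboolP => G f bf.
exact: h.
Qed.

Definition tens_zero : tens := \pi_tens [::].
Definition tens_add (t u : tens) : tens := \pi_tens (repr t ++ repr u).
Definition tens_scale (c : C) (t : tens) : tens :=
  \pi_tens [seq (c *: p.1, p.2) | p <- repr t].
Definition tens_opp : tens -> tens := tens_scale (- 1).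

Let balZ (G : lmodType C) (f : M -> N -> G) :
  balanced f -> forall c m n, f (c *: m) n = c *: f m n.
Proof.
case=> fl _ _ c m n; have f0 : f 0 n = 0.
  by have := fl n (- 1) 0 0; rewrite /= scaler0 addr0 scaleN1r addNr.
by have := fl n c m 0; rewrite /= f0 !addr0.
Qed.

Let tlift0 (G : lmodType C) (f : M -> N -> G) :
  balanced f -> tlift f tens_zero = 0.
Proof. by move=> bf; rewrite tlift_pi // big_nil. Qed.

Let tliftD (G : lmodType C) (f : M -> N -> G) : balanced f ->
  forall t u, tlift f (tens_add t u) = tlift f t + tlift f u.
Proof. by move=> bf t u; rewrite tlift_pi // big_cat. Qed.

Let tliftZ (G : lmodType C) (f : M -> N -> G) : balanced f ->
  forall c t, tlift f (tens_scale c t) = c *: tlift f t.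
Proof.
move=> bf c t; rewrite tlift_pi // big_map /= scaler_sumr.
by apply: eq_bigr => p _; rewrite balZ.
Qed.

Lemma tens_addA : associative tens_add.
Proof. by move=> t u v; apply: tens_ext => G f bf; rewrite !tliftD // addrA. Qed.

Lemma tens_addC : commutative tens_add.
Proof. by move=> t u; apply: tens_ext => G f bf; rewrite !tliftD // addrC. Qed.

Lemma tens_add0 : left_id tens_zero tens_add.
Proof. by move=> t; apply: tens_ext => G f bf; rewrite tliftD // tlift0 // add0r. Qed.

Lemma tens_addN : left_inverse tens_zero tens_opp tens_add.
Proof.
move=> t; apply: tens_ext => G f bf.
by rewrite tliftD // tliftZ // tlift0 // scaleN1r addNr.
Qed.

HB.instance Definition _ :=
  GRing.isZmodule.Build tens tens_addA tens_addC tens_add0 tens_addN.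

Lemma tens_scaleA c e t : tens_scale c (tens_scale e t) = tens_scale (c * e) t.
Proof. by apply: tens_ext => G f bf; rewrite !tliftZ // scalerA. Qed.

Lemma tens_scale1 : left_id 1 tens_scale.
Proof. by move=> t; apply: tens_ext => G f bf; rewrite tliftZ // scale1r. Qed.

Lemma tens_scaleDr : right_distributive tens_scale +%R.
Proof.
move=> c t u; apply: tens_ext => G f bf.
by rewrite tliftZ // !tliftD // scalerDr !tliftZ.
Qed.

Lemma tens_scaleDl t : {morph tens_scale^~ t : c e / c + e}.
Proof.
move=> c e; apply: tens_ext => G f bf.
by rewrite tliftZ // tliftD // !tliftZ // scalerDl.
Qed.

HB.instance Definition _ := GRing.Zmodule_isLmodule.Build C tens
  tens_scaleA tens_scale1 tens_scaleDr tens_scaleDl.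

Lemma tliftP (G : lmodType C) (f : M -> N -> G) : balanced f -> linear (tlift f).
Proof. by move=> bf c t u; rewrite tliftD // tliftZ. Qed.

Lemma tpure_balanced : balanced tpure.
Proof.
have E (G : lmodType C) (f : M -> N -> G) : balanced f ->
    forall c (t u : tens),
    tlift f (c *: t + u) = c *: tlift f t + tlift f u.
  by move=> bf c t u; rewrite tliftP.
split=> [n c x y|m c x y|m k n]; apply: tens_ext => G f bf;
  have [fl fr fb] := bf; rewrite ?E ?tlift_tpure //.
- exact: fl.
- exact: fr.
Qed.

Lemma tlift_id t : tlift tpure t = t.
Proof.
apply: tens_ext => G f bf; rewrite [X in tlift f X]/tlift [RHS]/tlift.
elim: (repr t) => [|p s IH]; first by rewrite !big_nil tlift0.
by rewrite !big_cons tliftD // IH tlift_tpure.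
Qed.

End Tensor.

Arguments tpure {C K M N r l}.

Reserved Notation "M ⊗ N" (at level 40, left associativity).
Notation "M ⊗ N" :=
  (@tens _ _ M N (fun m c => c *: m) (fun c n => c *: n)) : type_scope.
Notation "m ⊗ n" := (tpure m n) : ring_scope.
(** Sweedler-style sums: the value of [E] summed over [t = sum_i x_i (x) y_i]. *)
Notation "\tsum_ ( x , y <- t ) E" := (tlift (fun x y => E) t)
  (at level 41, x name, y name, t at level 60, E at level 41,
   format "\tsum_ ( x ,  y  <-  t )  E") : ring_scope.

Definition antilinear (C : numClosedFieldType) (V W : lmodType C) (f : V -> W) :=
  forall c x y, f (c *: x + y) = c^* *: f x + f y.

(** A right inverse of [f] on its range ([0] off the range); the inverse of [f]
    if [f] is bijective. *)
Definition inverse (C : numClosedFieldType) (V : lmodType C) (W : Type)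
  (f : V -> W) (y : W) : V := xget 0 [set x | f x = y].

(** The conjugate vector space; [cbar v] is the element written [v] with a bar. *)
Definition conj_space (C : numClosedFieldType) (V : lmodType C) : Type := V.

Section ConjSpace.
Variables (C : numClosedFieldType) (V : lmodType C).

HB.instance Definition _ := GRing.Zmodule.copy (conj_space V) V.

Definition cbar (v : V) : conj_space V := v.
Definition uncbar (v : conj_space V) : V := v.

Definition conj_scale (c : C) (v : conj_space V) : conj_space V :=
  cbar (c^* *: uncbar v).

Lemma conj_scaleA c e v : conj_scale c (conj_scale e v) = conj_scale (c * e) v.
Proof. by rewrite /conj_scale /cbar /uncbar scalerA rmorphM. Qed.

Lemma conj_scale1 : left_id 1 conj_scale.
Proof. by move=> v; rewrite /conj_scale /cbar /uncbar rmorph1 scale1r. Qed.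

Lemma conj_scaleDr : right_distributive conj_scale +%R.
Proof. by move=> c v w; rewrite /conj_scale /cbar /uncbar scalerDr. Qed.

Lemma conj_scaleDl v : {morph conj_scale^~ v : c e / c + e}.
Proof. by move=> c e; rewrite /conj_scale /cbar /uncbar rmorphD scalerDl. Qed.

HB.instance Definition _ := GRing.Zmodule_isLmodule.Build C (conj_space V)
  conj_scaleA conj_scale1 conj_scaleDr conj_scaleDl.

End ConjSpace.

Record is_algebra (C : numClosedFieldType) (V : lmodType C)
    (mul : V -> V -> V) (one : V) : Prop := {
  alg_linl : forall b, linear (mul^~ b);
  alg_linr : forall a, linear (mul a);
  alg_assoc : associative mul;
  alg_1l : left_id one mul;
  alg_1r : right_id one mul }.

Record is_star (C : numClosedFieldType) (V : lmodType C)
    (mul : V -> V -> V) (star : V -> V) : Prop := {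
  star_antilinear : antilinear star;
  star_involutive : involutive star;
  star_mul : forall a b, star (mul a b) = mul (star b) (star a) }.

Record hopf_ops (C : numClosedFieldType) (A : lmodType C) := HopfOps {
  hmul : A -> A -> A;
  hone : A;
  hcop : A -> (A ⊗ A)%type;
  hcou : A -> C;
  hant : A -> A;
  hstar : A -> A }.

Record is_hopf_star_algebra (C : numClosedFieldType) (A : lmodType C)
    (hA : hopf_ops A) : Prop := {
  hopf_alg : is_algebra (hmul hA) (hone hA);
  hopf_cop_linear : linear (hcop hA);
  hopf_coassoc : forall a,
    \tsum_(x, a3 <- hcop hA a) \tsum_(a1, a2 <- hcop hA x) (a1 ⊗ (a2 ⊗ a3))
    = \tsum_(a1, x <- hcop hA a) \tsum_(a2, a3 <- hcop hA x) (a1 ⊗ (a2 ⊗ a3))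
    :> (A ⊗ (A ⊗ A))%type;
  hopf_cou_linear : scalar (hcou hA);
  hopf_coul : forall a, \tsum_(a1, a2 <- hcop hA a) (hcou hA a1 *: a2) = a;
  hopf_cour : forall a, \tsum_(a1, a2 <- hcop hA a) (hcou hA a2 *: a1) = a;
  hopf_cop1 : hcop hA (hone hA) = hone hA ⊗ hone hA;
  hopf_copM : forall a b, hcop hA (hmul hA a b) =
    \tsum_(a1, a2 <- hcop hA a) \tsum_(b1, b2 <- hcop hA b)
      (hmul hA a1 b1 ⊗ hmul hA a2 b2);
  hopf_cou1 : hcou hA (hone hA) = 1;
  hopf_couM : forall a b, hcou hA (hmul hA a b) = hcou hA a * hcou hA b;
  hopf_ant_linear : linear (hant hA);
  hopf_antl : forall a,
    \tsum_(a1, a2 <- hcop hA a) hmul hA (hant hA a1) a2 = hcou hA a *: hone hA;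
  hopf_antr : forall a,
    \tsum_(a1, a2 <- hcop hA a) hmul hA a1 (hant hA a2) = hcou hA a *: hone hA;
  hopf_ant_bij : bijective (hant hA);
  hopf_star : is_star (hmul hA) (hstar hA);
  hopf_cop_star : forall a, hcop hA (hstar hA a) =
    \tsum_(a1, a2 <- hcop hA a) (hstar hA a1 ⊗ hstar hA a2) }.

Record is_comodule (C : numClosedFieldType) (A : lmodType C) (hA : hopf_ops A)
    (V : lmodType C) (coact : V -> (A ⊗ V)%type) : Prop := {
  comod_linear : linear coact;
  comod_coassoc : forall v,
    \tsum_(x, v0 <- coact v) \tsum_(a1, a2 <- hcop hA x) (a1 ⊗ (a2 ⊗ v0))
    = \tsum_(a1, x <- coact v) \tsum_(a2, v0 <- coact x) (a1 ⊗ (a2 ⊗ v0))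
    :> (A ⊗ (A ⊗ V))%type;
  comod_counit : forall v, \tsum_(a, v0 <- coact v) (hcou hA a *: v0) = v }.

Definition colinear (C : numClosedFieldType) (A V W : lmodType C)
    (coV : V -> (A ⊗ V)%type) (coW : W -> (A ⊗ W)%type) (f : V -> W) : Prop :=
  forall v, coW (f v) = \tsum_(a, v0 <- coV v) (a ⊗ f v0).

Record comodalg_ops (C : numClosedFieldType) (A B : lmodType C) := ComodalgOps {
  bmul : B -> B -> B;
  bone : B;
  bcoact : B -> (A ⊗ B)%type;
  bstar : B -> B }.

Record is_comodule_algebra (C : numClosedFieldType) (A : lmodType C)
    (hA : hopf_ops A) (B : lmodType C) (hB : comodalg_ops A B) : Prop := {
  ca_alg : is_algebra (bmul hB) (bone hB);
  ca_comod : is_comodule hA (bcoact hB);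
  ca_coact1 : bcoact hB (bone hB) = hone hA ⊗ bone hB;
  ca_coactM : forall a b, bcoact hB (bmul hB a b) =
    \tsum_(x, a0 <- bcoact hB a) \tsum_(y, b0 <- bcoact hB b)
      (hmul hA x y ⊗ bmul hB a0 b0) }.

Definition coact_star_compat (C : numClosedFieldType) (A : lmodType C)
    (hA : hopf_ops A) (B : lmodType C) (hB : comodalg_ops A B) : Prop :=
  forall b, bcoact hB (bstar hB b) =
    \tsum_(x, b0 <- bcoact hB b) (hstar hA x ⊗ bstar hB b0).

Record is_comodule_star_algebra (C : numClosedFieldType) (A : lmodType C)
    (hA : hopf_ops A) (B : lmodType C) (hB : comodalg_ops A B) : Prop := {
  csa_ca : is_comodule_algebra hA hB;
  csa_star : is_star (bmul hB) (bstar hB);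
  csa_coact_star : coact_star_compat hA hB }.

Record bimod_ops (C : numClosedFieldType) (A B M : lmodType C) := BimodOps {
  lact : B -> M -> M;
  ract : M -> B -> M;
  coact : M -> (A ⊗ M)%type }.

Notation tensB mM mN := (tens (ract mM) (lact mN)).

Section Modules.
Variables (C : numClosedFieldType) (A B : lmodType C).
Variables (hA : hopf_ops A) (hB : comodalg_ops A B).

Record is_left_module (M : lmodType C) (act : B -> M -> M) : Prop := {
  lmod_linl : forall m, linear (act^~ m);
  lmod_linr : forall b, linear (act b);
  lmod_1 : forall m, act (bone hB) m = m;
  lmod_M : forall a b m, act (bmul hB a b) m = act a (act b m) }.

Record is_right_module (M : lmodType C) (act : M -> B -> M) : Prop := {
  rmod_linl : forall b, linear (act^~ b);
  rmod_linr : forall m, linear (act m);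
  rmod_1 : forall m, act m (bone hB) = m;
  rmod_M : forall m a b, act m (bmul hB a b) = act (act m a) b }.

Record is_bimod (M : lmodType C) (mM : bimod_ops A B M) : Prop := {
  bimod_left : is_left_module (lact mM);
  bimod_right : is_right_module (ract mM);
  bimod_assoc : forall a m b,
    ract mM (lact mM a m) b = lact mM a (ract mM m b);
  bimod_comod : is_comodule hA (coact mM);
  bimod_coact : forall a m b, coact mM (ract mM (lact mM a m) b) =
    \tsum_(x, a0 <- bcoact hB a) \tsum_(y, m0 <- coact mM m)
    \tsum_(z, b0 <- bcoact hB b)
      (hmul hA (hmul hA x y) z ⊗ ract mM (lact mM a0 m0) b0) }.

Definition left_linear (M N : lmodType C) (actM : B -> M -> M)
    (actN : B -> N -> N) (f : M -> N) : Prop :=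
  linear f /\ forall b m, f (actM b m) = actN b (f m).

Definition left_fin_gen (M : lmodType C) (act : B -> M -> M) : Prop :=
  exists (n : nat) (g : 'I_n -> M),
    forall m, exists b : 'I_n -> B, m = \sum_(i < n) act (b i) (g i).

Definition left_projective (P : lmodType C) (act : B -> P -> P) : Prop :=
  forall (M N : lmodType C) (actM : B -> M -> M) (actN : B -> N -> N)
    (p : M -> N) (f : P -> N),
  is_left_module actM -> is_left_module actN ->
  left_linear actM actN p -> (forall n, exists m, p m = n) ->
  left_linear act actN f ->
  exists2 h : P -> M, left_linear act actM h & forall x, p (h x) = f x.

Definition tensB_ops (M N : lmodType C) (mM : bimod_ops A B M)
    (mN : bimod_ops A B N) : bimod_ops A B (tensB mM mN) :=
  {| lact := fun b t => \tsum_(m, n <- t) (lact mM b m ⊗ n);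
     ract := fun t b => \tsum_(m, n <- t) (m ⊗ ract mN n b);
     coact := fun t => \tsum_(m, n <- t)
       \tsum_(x, m0 <- coact mM m) \tsum_(y, n0 <- coact mN n)
         (hmul hA x y ⊗ (m0 ⊗ n0)) |}.

Definition conj_ops (M : lmodType C) (mM : bimod_ops A B M) :
    bimod_ops A B (conj_space M) :=
  {| lact := fun b m => cbar (ract mM (uncbar m) (bstar hB b));
     ract := fun m b => cbar (lact mM (bstar hB b) (uncbar m));
     coact := fun m =>
       \tsum_(x, m0 <- coact mM (uncbar m)) (hstar hA x ⊗ cbar m0) |}.

(** The bimodule structure of [_B Hom(E, B)].  It is carried by the maps
    [f : E -> B] satisfying [left_linear (lact mE) (bmul hB) f]; the actions are
    written for arbitrary maps.  The coaction is characterised through its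
    values [f_(-1) (x) f_(0)(e)], as in its definition. *)
Definition hom_lact (E : lmodType C) (mE : bimod_ops A B E) (b : B)
  (f : E -> B) : E -> B := fun e => f (ract mE e b).
Definition hom_ract (E : lmodType C) (f : E -> B) (b : B) : E -> B :=
  fun e => bmul hB (f e) b.
Definition is_hom_coact (E : lmodType C) (mE : bimod_ops A B E)
    (f : E -> B) (t : (A ⊗ (E -> B))%type) : Prop :=
  forall e, \tsum_(a, g <- t) (a ⊗ g e) =
    \tsum_(x, e0 <- coact mE e) \tsum_(y, b0 <- bcoact hB (f e0))
      (hmul hA (hant hA x) y ⊗ b0) :> (A ⊗ B)%type.

(** [H ybar x] is the pairing [<x, ybar>]. *)
Record is_hermitian_metric (E : lmodType C) (mE : bimod_ops A B E)
    (H : conj_space E -> E -> B) : Prop := {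
  metric_linear : linear H;
  metric_bij : set_bij setT [set f | left_linear (lact mE) (bmul hB) f] H;
  metric_lact : forall b y, H (lact (conj_ops mE) b y) = hom_lact mE b (H y);
  metric_ract : forall y b, H (ract (conj_ops mE) y b) = hom_ract (H y) b;
  metric_colinear : forall y,
    is_hom_coact mE (H y) (\tsum_(a, y0 <- coact (conj_ops mE) y) (a ⊗ H y0));
  metric_hermitian : forall x y, bstar hB (H (cbar x) y) = H (cbar y) x }.

End Modules.

(** The components [F i] are modules of their own, viewed as subspaces of [Om]
    through [ginj]; this gives the tensor products [F i (x)_B E] a type. *)
Record grading (C : numClosedFieldType) (A B Om : lmodType C) (I : eqType)
    (F : I -> lmodType C) := Grading {
  gops : forall i, bimod_ops A B (F i);
  ginj : forall i, F i -> Om }.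

(** [calg] carries the wedge product, the coaction and the involution of the
    total space [Om]; [cbase] is the inclusion of [B] as the forms of degree 0;
    [cgrad] is the grading by the form degree. *)
Record calculus_ops (C : numClosedFieldType) (A B Om : lmodType C)
    (F : nat -> lmodType C) := CalculusOps {
  calg : comodalg_ops A Om;
  cd : Om -> Om;
  cbase : B -> Om;
  cgrad : grading A B Om F }.

Section Calculus.
Variables (C : numClosedFieldType) (A B : lmodType C).
Variables (hA : hopf_ops A) (hB : comodalg_ops A B).
Variables (Om : lmodType C).

Section Grading.
Variables (I : eqType) (F : I -> lmodType C) (G : grading A B Om F).

Definition decomposes (w : Om) (f : forall i, F i) : Prop :=
  exists s : seq I, [/\ uniq s, forall i, i \notin s -> f i = 0
                      & w = \sum_(i <- s) ginj G (f i)].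

(** The component of [w] in [F i] when [Om] is the direct sum of the [F i]. *)
Definition proj (i : I) (w : Om) : F i :=
  xget 0 [set x | exists2 f, decomposes w f & x = f i].

(** [Om] is the direct sum of the [F i], which are objects of the category of
    relative Hopf bimodules with the structure inherited from [Om]. *)
Record is_grading (alg : comodalg_ops A Om) (base : B -> Om) : Prop := {
  grad_bimod : forall i, is_bimod hA hB (gops G i);
  grad_linear : forall i, linear (@ginj _ _ _ _ _ _ G i);
  grad_lact : forall i b (x : F i),
    ginj G (lact (gops G i) b x) = bmul alg (base b) (ginj G x);
  grad_ract : forall i b (x : F i),
    ginj G (ract (gops G i) x b) = bmul alg (ginj G x) (base b);
  grad_colinear : forall i,
    colinear (coact (gops G i)) (bcoact alg) (@ginj _ _ _ _ _ _ G i);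
  grad_direct : forall w, exists! f, decomposes w f }.

End Grading.

Record is_star_calculus (F : nat -> lmodType C)
    (O : calculus_ops A B Om F) : Prop := {
  calc_alg : is_comodule_algebra hA (calg O);
  calc_grading : is_grading (cgrad O) (calg O) (cbase O);
  calc_mul_deg : forall k l (x : F k) (y : F l), exists z : F (k + l)%N,
    bmul (calg O) (ginj (cgrad O) x) (ginj (cgrad O) y) = ginj (cgrad O) z;
  calc_base_linear : linear (cbase O);
  calc_base_inj : injective (cbase O);
  calc_base_range : range (cbase O) = range (@ginj _ _ _ _ _ _ (cgrad O) 0%N);
  calc_base1 : cbase O (bone hB) = bone (calg O);
  calc_baseM : forall a b,
    cbase O (bmul hB a b) = bmul (calg O) (cbase O a) (cbase O b);
  calc_base_colinear : colinear (bcoact hB) (bcoact (calg O)) (cbase O);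
  calc_d_linear : linear (cd O);
  calc_d_deg : forall k (x : F k), exists y : F k.+1,
    cd O (ginj (cgrad O) x) = ginj (cgrad O) y;
  calc_d2 : forall w, cd O (cd O w) = 0;
  calc_leibniz : forall k (x : F k) w,
    cd O (bmul (calg O) (ginj (cgrad O) x) w) =
    bmul (calg O) (cd O (ginj (cgrad O) x)) w
    + (- 1) ^+ k *: bmul (calg O) (ginj (cgrad O) x) (cd O w);
  calc_d_colinear : colinear (bcoact (calg O)) (bcoact (calg O)) (cd O);
  calc_generated : forall P : set Om,
    (forall c x y, P x -> P y -> P (c *: x + y)) ->
    (forall x y, P x -> P y -> P (bmul (calg O) x y)) ->
    (forall b, P (cbase O b)) -> (forall b, P (cd O (cbase O b))) ->
    forall w, P w;
  calc_star_antilinear : antilinear (bstar (calg O));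
  calc_star_involutive : involutive (bstar (calg O));
  calc_star_base : forall b, bstar (calg O) (cbase O b) = cbase O (bstar hB b);
  calc_star_deg : forall k (x : F k), exists y : F k,
    bstar (calg O) (ginj (cgrad O) x) = ginj (cgrad O) y;
  calc_star_d : forall w, cd O (bstar (calg O) w) = bstar (calg O) (cd O w);
  calc_star_mul : forall k l (x : F k) (y : F l),
    bstar (calg O) (bmul (calg O) (ginj (cgrad O) x) (ginj (cgrad O) y)) =
    (- 1) ^+ (k * l) *: bmul (calg O) (bstar (calg O) (ginj (cgrad O) y))
                                     (bstar (calg O) (ginj (cgrad O) x));
  calc_coact_star : coact_star_compat hA (calg O) }.

(** [T (p, q)] is the space of forms of bidegree [(p, q)]. *)
Record is_complex_structure (F : nat -> lmodType C)
    (O : calculus_ops A B Om F) (T : nat * nat -> lmodType C)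
    (J : grading A B Om T) : Prop := {
  cplx_grading : is_grading J (calg O) (cbase O);
  cplx_mul_deg : forall p q p' q' (x : T (p, q)) (y : T (p', q')),
    exists z : T (p + p', q + q')%N,
    bmul (calg O) (ginj J x) (ginj J y) = ginj J z;
  cplx_total : forall k, range (@ginj _ _ _ _ _ _ (cgrad O) k) =
    [set w | exists f : forall p, T (p, k - p)%N,
       w = \sum_(p < k.+1) ginj J (f p)];
  cplx_star : forall p q,
    bstar (calg O) @` range (@ginj _ _ _ _ _ _ J (p, q))
    = range (@ginj _ _ _ _ _ _ J (q, p));
  cplx_d : forall p q (x : T (p, q)),
    exists (y : T (p.+1, q)) (z : T (p, q.+1)),
    cd O (ginj J x) = ginj J y + ginj J z }.

Section Forms.
Variables (F : nat -> lmodType C) (O : calculus_ops A B Om F).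
Variables (T : nat * nat -> lmodType C) (J : grading A B Om T).

Definition d_fun (b : B) : F 1%N := proj (cgrad O) 1%N (cd O (cbase O b)).

Definition star_form (w : F 1%N) : F 1%N :=
  proj (cgrad O) 1%N (bstar (calg O) (ginj (cgrad O) w)).

Definition delbar p q (x : T (p, q)) : T (p, q.+1) :=
  proj J (p, q.+1) (cd O (ginj J x)).

Definition delbar_fun (b : B) : T (0, 1)%N :=
  proj J (0, 1)%N (cd O (cbase O b)).

Definition wedge01 (x y : T (0, 1)%N) : T (0, 2)%N :=
  proj J (0, 2)%N (bmul (calg O) (ginj J x) (ginj J y)).

Definition pi01 (w : F 1%N) : T (0, 1)%N := proj J (0, 1)%N (ginj (cgrad O) w).

Variables (E : lmodType C) (mE : bimod_ops A B E).

(** In [hol_flat] neither of the two maps under the sum descends to the tensor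
    product on its own; their difference does. *)
Record is_holomorphic_bimodule
    (dE : E -> tensB (gops J (0, 1)%N) mE) : Prop := {
  hol_bimod : is_bimod hA hB mE;
  hol_linear : linear dE;
  hol_colinear : colinear (coact mE)
    (coact (tensB_ops hA (gops J (0, 1)%N) mE)) dE;
  hol_leibniz : forall b e, dE (lact mE b e) =
    lact (tensB_ops hA (gops J (0, 1)%N) mE) b (dE e) + delbar_fun b ⊗ e;
  hol_flat : forall e,
    \tsum_(w, x <- dE e)
      (delbar w ⊗ x - \tsum_(v, y <- dE x) (wedge01 w v ⊗ y))
    = 0 :> tensB (gops J (0, 2)%N) mE }.

Record is_covariant_left_connection
    (nabla : E -> tensB (gops (cgrad O) 1%N) mE) : Prop := {
  conn_linear : linear nabla;
  conn_leibniz : forall b e, nabla (lact mE b e) =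
    lact (tensB_ops hA (gops (cgrad O) 1%N) mE) b (nabla e) + d_fun b ⊗ e;
  conn_colinear : colinear (coact mE)
    (coact (tensB_ops hA (gops (cgrad O) 1%N) mE)) nabla }.

Definition conj_connection (nabla : E -> tensB (gops (cgrad O) 1%N) mE)
    (y : conj_space E) : tensB (conj_ops hA hB mE) (gops (cgrad O) 1%N) :=
  \tsum_(w, x <- nabla (uncbar y)) (cbar x ⊗ star_form w).

(** The compatibility with the metric is stated on the elementary tensors
    [e (x) fbar], after the identifications of [Omega^1 (x)_B B] and
    [B (x)_B Omega^1] with [Omega^1]. *)
Record is_chern_connection (dE : E -> tensB (gops J (0, 1)%N) mE)
    (H : conj_space E -> E -> B)
    (nabla : E -> tensB (gops (cgrad O) 1%N) mE) : Prop := {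
  chern_connection : is_covariant_left_connection nabla;
  chern_metric : forall (e : E) (f : conj_space E),
    d_fun (H f e) =
    \tsum_(w, x <- nabla e) ract (gops (cgrad O) 1%N) w (H f x)
    + \tsum_(y, w <- conj_connection nabla f)
        lact (gops (cgrad O) 1%N) (H y e) w;
  chern_delbar : forall e, \tsum_(w, x <- nabla e) (pi01 w ⊗ x) = dE e }.

End Forms.
End Calculus.

Section Cocycle.
Variables (C : numClosedFieldType) (A : lmodType C) (hA : hopf_ops A).
Variables (gam gamb : {scalar (A ⊗ A)%type}).

(** [gam] is a unital 2-cocycle with convolution inverse [gamb]. *)
Record is_cocycle : Prop := {
  coc_invr : forall g h,
    \tsum_(g1, g2 <- hcop hA g) \tsum_(h1, h2 <- hcop hA h)
      (gam (g1 ⊗ h1) * gamb (g2 ⊗ h2)) = hcou hA g * hcou hA h;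
  coc_invl : forall g h,
    \tsum_(g1, g2 <- hcop hA g) \tsum_(h1, h2 <- hcop hA h)
      (gamb (g1 ⊗ h1) * gam (g2 ⊗ h2)) = hcou hA g * hcou hA h;
  coc_cocycle : forall g h k,
    \tsum_(g1, g2 <- hcop hA g) \tsum_(h1, h2 <- hcop hA h)
      (gam (g1 ⊗ h1) * gam (hmul hA g2 h2 ⊗ k)) =
    \tsum_(h1, h2 <- hcop hA h) \tsum_(k1, k2 <- hcop hA k)
      (gam (h1 ⊗ k1) * gam (g ⊗ hmul hA h2 k2));
  coc_unitr : forall h, gam (h ⊗ hone hA) = hcou hA h;
  coc_unitl : forall h, gam (hone hA ⊗ h) = hcou hA h }.

Definition is_unitary_cocycle : Prop := forall a b,
  (gam (a ⊗ b))^* =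
  gamb (hstar hA (hant hA a) ⊗ hstar hA (hant hA b)).

Definition coc_U (k : A) : C :=
  \tsum_(k1, k2 <- hcop hA k) gam (k1 ⊗ hant hA k2).
Definition coc_Ub (k : A) : C :=
  \tsum_(k1, k2 <- hcop hA k) gamb (hant hA k1 ⊗ k2).
Definition coc_V (k : A) : C := coc_U (inverse (hant hA) k).
Definition coc_Vb (k : A) : C := coc_Ub (inverse (hant hA) k).

Definition deform_hopf : hopf_ops A :=
  {| hmul := fun h k =>
       \tsum_(x, h3 <- hcop hA h) \tsum_(h1, h2 <- hcop hA x)
       \tsum_(y, k3 <- hcop hA k) \tsum_(k1, k2 <- hcop hA y)
         ((gam (h1 ⊗ k1) * gamb (h3 ⊗ k3)) *: hmul hA h2 k2);
     hone := hone hA;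
     hcop := hcop hA;
     hcou := hcou hA;
     hant := fun h =>
       \tsum_(x, h3 <- hcop hA h) \tsum_(h1, h2 <- hcop hA x)
         ((coc_U h1 * coc_Ub h3) *: hant hA h2);
     hstar := fun h =>
       \tsum_(x, h3 <- hcop hA h) \tsum_(h1, h2 <- hcop hA x)
         ((coc_Vb (hstar hA h1) * coc_V (hstar hA h3)) *: hstar hA h2) |}.

(** Serves both for [B] and for the total space of a calculus over [B]. *)
Definition deform_comodalg (B : lmodType C) (hB : comodalg_ops A B) :
    comodalg_ops A B :=
  {| bmul := fun a b =>
       \tsum_(x, a0 <- bcoact hB a) \tsum_(y, b0 <- bcoact hB b)
         (gam (x ⊗ y) *: bmul hB a0 b0);
     bone := bone hB;
     bcoact := bcoact hB;
     bstar := fun b =>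
       \tsum_(x, b0 <- bcoact hB b) (coc_Vb (hstar hA x) *: bstar hB b0) |}.

Variables (B : lmodType C) (hB : comodalg_ops A B).

(** The functor [Gamma] on objects; on morphisms it is the identity. *)
Definition deform_bimod (M : lmodType C) (mM : bimod_ops A B M) :
    bimod_ops A B M :=
  {| lact := fun b m =>
       \tsum_(x, b0 <- bcoact hB b) \tsum_(y, m0 <- coact mM m)
         (gam (x ⊗ y) *: lact mM b0 m0);
     ract := fun m b =>
       \tsum_(x, m0 <- coact mM m) \tsum_(y, b0 <- bcoact hB b)
         (gam (x ⊗ y) *: ract mM m0 b0);
     coact := coact mM |}.

Definition deform_grading (Om : lmodType C) (I : eqType) (F : I -> lmodType C)
    (G : grading A B Om F) : grading A B Om F :=
  {| gops := fun i => deform_bimod (gops G i); ginj := @ginj _ _ _ _ _ _ G |}.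

Definition deform_calculus (Om : lmodType C) (F : nat -> lmodType C)
    (O : calculus_ops A B Om F) : calculus_ops A B Om F :=
  {| calg := deform_comodalg (calg O); cd := cd O; cbase := cbase O;
     cgrad := deform_grading (cgrad O) |}.

(** [phi_(M,N) : Gamma(M) (x)_(B_gamma) Gamma(N) -> Gamma(M (x)_B N)] *)
Definition phi (M N : lmodType C) (mM : bimod_ops A B M)
    (mN : bimod_ops A B N) (t : tensB (deform_bimod mM) (deform_bimod mN)) :
    tensB mM mN :=
  \tsum_(m, n <- t) \tsum_(x, m0 <- coact mM m) \tsum_(y, n0 <- coact mN n)
    (gam (x ⊗ y) *: (m0 ⊗ n0)).

Definition phi_inv (M N : lmodType C) (mM : bimod_ops A B M)
    (mN : bimod_ops A B N) :
    tensB mM mN -> tensB (deform_bimod mM) (deform_bimod mN) :=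
  inverse (@phi M N mM mN).

Variables (E : lmodType C) (mE : bimod_ops A B E).

(** [frakS : Gamma(_B Hom(E, B)) -> _(B_gamma) Hom(Gamma(E), B_gamma)] *)
Definition frakS (f : E -> B) : E -> B := fun v =>
  \tsum_(x, v' <- coact mE v) \tsum_(y, v0 <- coact mE v')
  \tsum_(z, b0 <- bcoact hB (f v0))
    (gam (x ⊗ hmul hA (hant hA y) z) *: b0).

(** [frakN : conj (Gamma(E)) -> Gamma (conj E)] *)
Definition frakN (e : conj_space E) : conj_space E :=
  \tsum_(x, e0 <- coact mE (uncbar e)) (coc_Vb (hstar hA x) *: cbar e0).

Definition deform_metric (H : conj_space E -> E -> B) : conj_space E -> E -> B :=
  frakS \o H \o frakN.

End Cocycle.

Arguments phi {C A} gam {B} hB {M N} mM mN t.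
Arguments phi_inv {C A} gam {B} hB {M N} mM mN t.

(* Main.v *)
Require Import Defs.
From mathcomp Require Import all_boot all_order all_algebra.
From mathcomp Require Import complex ring.
From mathcomp Require Import boolp classical_sets functions reals.

Set Implicit Arguments.
Unset Strict Implicit.
Unset Printing Implicit Defensive.
Import GRing.Theory Num.Theory.
Local Open Scope ring_scope.

(** Why the theorem holds.  For comodules [M], [N] and a bilinear map [f] on
    [M] and [N], let [twist gam f m n] be the Sweedler sum of
    [gam (m_(-1) (x) n_(-1)) f m_0 n_0].  Every deformed product, every deformed
    action and the natural isomorphism [phi] is a twist of the undeformed map,
    the cocycle identity says exactly that twisting preserves associativity
    identities between colinear maps ([twist_assoc]), and the convolution inverse
    of [gam] undoes the twist, so that a bilinear map vanishes as soon as its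
    twist does ([twist_eq0]).

    The involutions need one more ingredient.  By unitarity, the scalar
    [Vb(x^* )] of the deformed involution is the conjugate of
    [v x = gam (S^-1 x_(2) (x) x_(1))], so the deformed involution of [b] is
    [(v(b_(-1)) b_0)^*], and [frakN] is the same shift by [v] followed by the bar.
    The identity [star_twist_mul] says that the shift turns the twist by [gam]
    into the twist by the flipped conjugate of [gam] ([star_shift_twist]); since
    conjugate-linear maps reverse products, it makes the deformed involutions
    compatible with the deformed products.  It is derived from the cocycle
    identity by moving some of its four factors to the other side
    ([cocycle_move_left], [cocycle_move_right]) and cancelling antipodes.

    Now let [n] be a map from [E] to the deformed [Omega^1 (x) E], and
    [nab := phi \o n].  The Leibniz rule for [n] is the vanishing of
    [twist gam] of the Leibniz defect of [nab]; the metric condition for [n] at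
    [(e, f)] is the vanishing of the twist of the metric defect of [nab] at
    [(e, frakN f)]; and colinearity and the (0,1)-part correspond under the
    colinear bijection [phi].  As twisting is injective and [frakN] is onto, [n]
    is a Chern connection for the deformed data if and only if [nab] is one for
    the original data ([chern_deform]).  This gives the first half of the
    theorem, and reduces uniqueness to the undeformed setting.

    There, let [D] be the difference of two Chern connections.  It has no
    (0,1)-part, and the metric condition says that the contraction of [D e] with
    [f] is minus the adjoint of that of [D f] with [e]: the former is of type
    (1,0), the latter of type (0,1), so both vanish.  As [E] is finitely generated
    projective and the metric is an isomorphism, the contractions with all [f]
    detect the elements of [Omega^1 (x) E] ([contract_metric_eq0]), hence [D]
    vanishes ([chern_unique]). *)

(** * Linearity of Sweedler sums *)

Section LinearRules.
Variable C : numClosedFieldType.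
Implicit Types U V W G M N : lmodType C.

Lemma lin_id V : linear (fun x : V => x).
Proof. by []. Qed.

Lemma lin_ext U V (f g : U -> V) :
  (forall x, g x = f x) -> linear f -> linear g.
Proof. by move=> fg fl a x y; rewrite !fg fl. Qed.

Lemma lin_comp U V W (h : V -> W) (g : U -> V) :
  linear h -> linear g -> linear (fun x => h (g x)).
Proof. by move=> hl gl c x y; rewrite gl hl. Qed.

Lemma lin_comp_scalar U V (h : V -> C) (g : U -> V) :
  linear (h : V -> C^o) -> linear g -> linear (fun x => h (g x) : C^o).
Proof. by move=> hl gl c x y; rewrite gl hl. Qed.

Lemma lin_comp2 U V W (Y : Type) (h : V -> Y -> W) (g : U -> V) y :
  (forall y, linear (h^~ y)) -> linear g -> linear (fun x => h (g x) y).
Proof. by move=> hl gl c a b; rewrite gl hl. Qed.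

Lemma lin_comp2_scalar U V (Y : Type) (h : V -> Y -> C) (g : U -> V) y :
  (forall y, linear (h^~ y : V -> C^o)) -> linear g -> linear (fun x => h (g x) y : C^o).
Proof. by move=> hl gl c a b; rewrite gl hl. Qed.

Lemma lin_comp3 U V W (Y Z : Type) (h : V -> Y -> Z -> W) (g : U -> V) y z :
  (forall y z, linear (fun x => h x y z)) -> linear g ->
  linear (fun x => h (g x) y z).
Proof. by move=> hl gl c a b; rewrite gl hl. Qed.

Lemma lin_comp3_scalar U V (Y Z : Type) (h : V -> Y -> Z -> C) (g : U -> V) y z :
  (forall y z, linear (fun x => h x y z : C^o)) -> linear g ->
  linear (fun x => h (g x) y z : C^o).
Proof. by move=> hl gl c a b; rewrite gl hl. Qed.

Lemma lin_scaler U V (c : C) (g : U -> V) :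
  linear g -> linear (fun x => c *: g x).
Proof. by move=> gl a x y; rewrite gl scalerDr !scalerA mulrC. Qed.

Lemma lin_scalel U V (s : U -> C) (v : V) :
  linear (s : U -> C^o) -> linear (fun x => s x *: v).
Proof. by move=> sl a x y; rewrite sl scalerDl scalerA. Qed.

Lemma lin_mull U (s : U -> C) (c : C) :
  linear (s : U -> C^o) -> linear ((fun x => s x * c) : U -> C^o).
Proof. by move=> sl a x y; rewrite sl mulrDl -[a *: _]/(a * _) -mulrA. Qed.

Lemma lin_mulr U (s : U -> C) (c : C) :
  linear (s : U -> C^o) -> linear ((fun x => c * s x) : U -> C^o).
Proof. by move=> sl a x y; rewrite sl mulrDr -[a *: _]/(a * _) mulrCA. Qed.

Lemma lin_add U V (f g : U -> V) :
  linear f -> linear g -> linear (fun x => f x + g x).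
Proof. by move=> fl gl a x y; rewrite fl gl scalerDr addrACA. Qed.

Lemma lin_opp U V (f : U -> V) : linear f -> linear (fun x => - f x).
Proof. by move=> fl a x y; rewrite fl opprD scalerN. Qed.

Lemma lin_zero U V : linear (fun _ : U => 0 : V).
Proof. by move=> a x y; rewrite scaler0 addr0. Qed.

Lemma lin_sum U V (I : Type) (s : seq I) (f : I -> U -> V) :
  (forall i, linear (f i)) -> linear (fun x => \sum_(i <- s) f i x).
Proof.
move=> fl a x y; rewrite scaler_sumr -big_split /=.
by apply: eq_bigr => i _; rewrite fl.
Qed.

Lemma lin_tlift_body U V M N (K : Type) (r : M -> K -> M) (l : K -> N -> N)
    (f : U -> M -> N -> V) (t : tens r l) :
  (forall m n, linear (fun x => f x m n)) -> linear (fun x => tlift (f x) t).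
Proof. by move=> fl; apply: lin_sum => p; apply: fl. Qed.

Lemma lin_tlift_body_scalar U M N (K : Type) (r : M -> K -> M) (l : K -> N -> N)
    (f : U -> M -> N -> C) (t : tens r l) :
  (forall m n, linear (fun x => f x m n : C^o)) ->
  linear ((fun x => tlift (f x) t) : U -> C^o).
Proof. exact: lin_tlift_body. Qed.

Lemma lin_tlift_arg U V M N (K : Type) (r : M -> K -> M) (l : K -> N -> N)
    (f : M -> N -> V) (g : U -> tens r l) :
  balanced r l f -> linear g -> linear (fun x => tlift f (g x)).
Proof. by move=> bf gl c x y; rewrite gl tliftP. Qed.

Definition bilin U V W (f : U -> V -> W) : Prop :=
  (forall y, linear (f^~ y)) /\ (forall x, linear (f x)).

Definition trilin U V W G (f : U -> V -> W -> G) : Prop :=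
  [/\ forall y z, linear (fun x => f x y z),
      forall x z, linear (fun y => f x y z) & forall x y, linear (f x y)].

Lemma lin_of_scale U V (f : U -> V) : linear f -> forall c x, f (c *: x) = c *: f x.
Proof.
move=> fl c x; have f0 : f 0 = 0.
  by have := fl (- 1) 0 0; rewrite /= scaler0 addr0 scaleN1r addNr.
by have := fl c x 0; rewrite f0 !addr0.
Qed.

Lemma lin_of_0 U V (f : U -> V) : linear f -> f 0 = 0.
Proof. by move=> fl; rewrite -(scale0r 0) lin_of_scale // scale0r. Qed.

Lemma lin_of_add U V (f : U -> V) : linear f -> {morph f : x y / x + y}.
Proof. by move=> fl x y; have := fl 1 x y; rewrite !scale1r. Qed.

Lemma lin_of_opp U V (f : U -> V) : linear f -> {morph f : x / - x}.
Proof. by move=> fl x; rewrite -scaleN1r lin_of_scale // scaleN1r. Qed.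

Lemma lin_of_sub U V (f : U -> V) : linear f -> {morph f : x y / x - y}.
Proof. by move=> fl x y; rewrite lin_of_add // lin_of_opp. Qed.

Lemma lin_of_sum U V (f : U -> V) (I : Type) (s : seq I) (F : I -> U) :
  linear f -> f (\sum_(i <- s) F i) = \sum_(i <- s) f (F i).
Proof. by move=> fl; apply: (big_morph f (lin_of_add fl) (lin_of_0 fl)). Qed.

Lemma lin_of_tlift U V M N (K : Type) (r : M -> K -> M) (l : K -> N -> N)
    (f : U -> V) (g : M -> N -> U) (t : tens r l) :
  linear f -> f (tlift g t) = tlift (fun m n => f (g m n)) t.
Proof. by move=> fl; rewrite /tlift lin_of_sum. Qed.

Lemma scale_tlift U M N (K : Type) (r : M -> K -> M) (l : K -> N -> N)
    (c : C) (g : M -> N -> U) (t : tens r l) :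
  c *: tlift g t = tlift (fun m n => c *: g m n) t.
Proof. exact: scaler_sumr. Qed.

Lemma bilin_balanced (M N G : lmodType C) (f : M -> N -> G) :
  bilin f -> balanced (fun m c => c *: m) (fun c n => c *: n) f.
Proof.
move=> [fl fr]; split=> // m c n.
by rewrite (lin_of_scale (fl n)) (lin_of_scale (fr m)).
Qed.

Lemma tlift_pure M N G (f : M -> N -> G) m n :
  bilin f -> tlift f (m ⊗ n : (M ⊗ N)%type) = f m n.
Proof. by move=> bf; rewrite tlift_tpure //; apply: bilin_balanced. Qed.

Lemma lin_tlift_arg_plain U V M N (f : M -> N -> V) (g : U -> (M ⊗ N)%type) :
  bilin f -> linear g -> linear (fun x => tlift f (g x)).
Proof. by move=> bf; apply/lin_tlift_arg/bilin_balanced. Qed.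

Lemma lin_tlift_arg_scalar U M N (f : M -> N -> C) (g : U -> (M ⊗ N)%type) :
  bilin (f : M -> N -> C^o) -> linear g -> linear ((fun x => tlift f (g x)) : U -> C^o).
Proof. exact: lin_tlift_arg_plain. Qed.

Lemma tlift_tlift G U V M N (K : Type) (r : M -> K -> M) (l : K -> N -> N)
    (f : U -> V -> G) (g : M -> N -> (U ⊗ V)%type) (t : tens r l) :
  bilin f -> tlift f (tlift g t) = tlift (fun m n => tlift f (g m n)) t.
Proof.
move=> bf; apply: lin_of_tlift => c x y.
by rewrite tliftP //; apply: bilin_balanced.
Qed.

Lemma lin_tlift G M N (f : M -> N -> G) :
  bilin f -> linear (tlift f : (M ⊗ N)%type -> G).
Proof. by move=> bf; apply/tliftP/bilin_balanced. Qed.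

(** A conjugate-linear map is a linear map into the conjugate space, so the rules
    for linear maps also serve conjugate-linear ones. *)
Lemma antilinear_linear V W (f : V -> W) :
  antilinear f -> linear (f : V -> conj_space W).
Proof. by []. Qed.

Lemma antilinear_tlift U V M N (K : Type) (r : M -> K -> M) (l : K -> N -> N)
    (f : U -> V) (g : M -> N -> U) (t : tens r l) :
  antilinear f -> f (tlift g t) = tlift (fun m n => f (g m n)) t.
Proof.
by move=> /antilinear_linear fl; apply: (lin_of_tlift (f := f : U -> conj_space V)).
Qed.

Lemma antilinear_scale U V (f : U -> V) : antilinear f ->
  forall c x, f (c *: x) = c^* *: f x.
Proof.
by move=> /antilinear_linear fl; apply: (lin_of_scale (f := f : U -> conj_space V)).
Qed.

Lemma eq_tlift (G : nmodType) M N (K : Type) (r : M -> K -> M) (l : K -> N -> N)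
    (f g : M -> N -> G) (t : tens r l) :
  (forall m n, f m n = g m n) -> tlift f t = tlift g t.
Proof. by move=> fg; apply: eq_bigr => p _. Qed.

Lemma tlift_exchange (G : nmodType) M N (K : Type) (r : M -> K -> M)
    (l : K -> N -> N) (M' N' : lmodType C) (K' : Type) (r' : M' -> K' -> M')
    (l' : K' -> N' -> N') (f : M -> N -> M' -> N' -> G)
    (t : tens r l) (t' : tens r' l') :
  tlift (fun m n => tlift (f m n) t') t =
  tlift (fun m' n' => tlift (fun m n => f m n m' n') t) t'.
Proof. exact: exchange_big. Qed.

Lemma tpure_linl M N (K : Type) (r : M -> K -> M) (l : K -> N -> N) (n : N) :
  linear (fun m : M => m ⊗ n : tens r l).
Proof. by have [] := tpure_balanced r l. Qed.

Lemma tpure_linr M N (K : Type) (r : M -> K -> M) (l : K -> N -> N) (m : M) :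
  linear (tpure m : N -> tens r l).
Proof. by have [] := tpure_balanced r l. Qed.

Lemma tpure_bal M N (K : Type) (r : M -> K -> M) (l : K -> N -> N) m k n :
  r m k ⊗ n = m ⊗ l k n :> tens r l.
Proof. by have [_ _ /(_ m k n)] := tpure_balanced r l. Qed.

Lemma tens_linear_ext M N (K : Type) (r : M -> K -> M) (l : K -> N -> N)
    G (f g : tens r l -> G) :
  linear f -> linear g -> (forall m n, f (m ⊗ n) = g (m ⊗ n)) ->
  forall t, f t = g t.
Proof.
move=> fl gl fg t; rewrite -[t]tlift_id !lin_of_tlift //.
exact: eq_tlift.
Qed.

End LinearRules.

Create HintDb lin.

Lemma scalar_linear (C : numClosedFieldType) (V : lmodType C) (f : {scalar V}) :
  linear (f : V -> C^o).
Proof. by move=> a x y; rewrite linearP. Qed.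

#[global] Hint Extern 0 (GRing.linear_for _ _) =>
  solve [apply: tpure_linl | apply: tpure_linr | apply: scalar_linear
        | apply: lin_zero] : lin.

Ltac lin_eta :=
  match goal with
  | |- GRing.linear_for ?s (fun x => ?h x) => change (GRing.linear_for s h)
  | |- _ => idtac
  end.

Ltac lin_ctx :=
  match goal with
  | H : trilin _ |- _ =>
      let H1 := fresh in let H2 := fresh in let H3 := fresh in
      case: (H) => H1 H2 H3; solve [apply: H1 | apply: H2 | apply: H3]
  | H : bilin _ |- _ => solve [apply: (proj2 H) | apply: (proj1 H)]
  | H : GRing.linear_for _ _ |- _ => solve [apply: H]
  | H : forall _, _ |- _ => solve [apply: H]
  end.

Ltac lin_hint :=
  repeat lazymatch goal with |- forall _, _ => intro end; lin_eta;
  solve [lin_ctx | auto 2 with lin nocore].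

(** Syntax-directed proofs of (bi)linearity: the variable is followed through
    sums, scalings and applications down to operations whose linearity is an
    assumption or a hint. *)
Ltac lin :=
  lazymatch goal with
  | |- forall _, _ => intro; lin
  | |- _ /\ _ => split; lin
  | |- bilin _ => split; lin
  | |- trilin _ => split; lin
  | |- balanced _ _ _ => apply: bilin_balanced; lin
  | |- _ => cbv beta; lin_step
  end
with lin_step :=
  lazymatch goal with
  | |- GRing.linear_for _ (fun x => x) => exact: lin_id
  | |- GRing.linear_for _ (fun x => @tlift _ _ _ _ _ _ _ _ _) => lin_sweedler
  | |- GRing.linear_for _ (@tlift _ _ _ _ _ _ _ _) =>
      first [apply: lin_tlift; lin | apply: tliftP; lin_hint]
  | |- GRing.linear_for _ (fun x => @?s x *: @?g x) =>
      match g with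
      | fun _ => ?v => refine (@lin_scalel _ _ _ s v _); lin
      | _ => refine (@lin_scaler _ _ _ _ g _); lin
      end
  | |- GRing.linear_for _ (fun x => @?s x * @?g x) =>
      match g with
      | fun _ => ?c => refine (@lin_mull _ _ s c _); lin
      | _ => refine (@lin_mulr _ _ g _ _); lin
      end
  | |- GRing.linear_for _ (fun x => @?f x + @?g x) =>
      refine (@lin_add _ _ _ f g _ _); lin
  | |- GRing.linear_for _ (fun x => - @?f x) =>
      refine (@lin_opp _ _ _ f _); lin
  | |- GRing.linear_for _ (fun x => \sum_(i <- _) @?f x i) =>
      refine (@lin_sum _ _ _ _ _ (fun i x => f x i) _); lin
  | |- GRing.linear_for _ (fun x => _) => first [ lin_hint | lin_app ]
  | |- _ => lin_hint
  end
with lin_sweedler :=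
  match goal with
  | |- GRing.linear_for _ (fun x => @tlift _ _ _ _ _ _ _ (fun m n => @?f x m n) ?t) =>
      first [refine (@lin_tlift_body _ _ _ _ _ _ _ _ f t _)
            | refine (@lin_tlift_body_scalar _ _ _ _ _ _ _ f t _)]; lin
  | |- GRing.linear_for _ (fun x => @tlift _ _ _ _ _ _ _ ?f (@?g x)) =>
      first [refine (@lin_tlift_arg_plain _ _ _ _ _ f g _ _)
            | refine (@lin_tlift_arg_scalar _ _ _ _ f g _ _)]; lin
  | |- GRing.linear_for _ (fun x => @tlift _ _ _ _ _ _ _ ?f (@?g x)) =>
      refine (@lin_tlift_arg _ _ _ _ _ _ _ _ f g _ _); [lin_hint | lin]
  end
with lin_app :=
  match goal with
  | |- GRing.linear_for _ (fun x => ?h (@?g x)) =>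
      first [refine (@lin_comp _ _ _ _ h g _ _) | refine (@lin_comp_scalar _ _ _ h g _ _)]; [lin_hint | lin]
  | |- GRing.linear_for _ (fun x => ?h (@?g x) ?y) =>
      first [refine (@lin_comp2 _ _ _ _ _ h g y _ _)
        | refine (@lin_comp2_scalar _ _ _ _ h g y _ _)]; [lin_hint | lin]
  | |- GRing.linear_for _ (fun x => ?h (@?g x) ?y ?z) =>
      first [refine (@lin_comp3 _ _ _ _ _ _ h g y z _ _)
        | refine (@lin_comp3_scalar _ _ _ _ _ h g y z _ _)]; [lin_hint | lin]
  end.


(** * Comodules and the antipode *)

Section HopfLinear.
Variables (C : numClosedFieldType) (A : lmodType C) (hA : hopf_ops A).
Hypothesis H : is_hopf_star_algebra hA.

Lemma hmul_linl b : linear (hmul hA ^~ b).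
Proof. exact: (alg_linl (hopf_alg H)). Qed.

Lemma hmul_linr a : linear (hmul hA a).
Proof. exact: (alg_linr (hopf_alg H)). Qed.

Lemma hcou_lin : linear (hcou hA : A -> C^o).
Proof. exact: (hopf_cou_linear H). Qed.

Lemma hopf_comodule : is_comodule hA (hcop hA).
Proof.
by split; [apply: hopf_cop_linear | apply: hopf_coassoc | apply: hopf_coul].
Qed.

End HopfLinear.

Ltac lin_hopf :=
  first [ apply: hmul_linl | apply: hmul_linr | apply: hopf_cop_linear
        | apply: hcou_lin | apply: hopf_ant_linear ]; eassumption.
#[global] Hint Extern 1 (GRing.linear_for _ _) => lin_hopf : lin.
#[global] Hint Extern 1 (GRing.linear_for _ _) =>
  solve [apply: comod_linear; eassumption] : lin.

Section Comodule.
Variables (C : numClosedFieldType) (A : lmodType C) (hA : hopf_ops A).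
Hypothesis H : is_hopf_star_algebra hA.
Local Notation "x ** y" := (hmul hA x y) (at level 40, left associativity).

Lemma coassoc (V G : lmodType C) (co : V -> (A ⊗ V)%type) (f : A -> A -> V -> G) v :
  is_comodule hA co -> trilin f ->
  \tsum_(x, v0 <- co v) \tsum_(a1, a2 <- hcop hA x) f a1 a2 v0 =
  \tsum_(a1, x <- co v) \tsum_(a2, v0 <- co x) f a1 a2 v0.
Proof.
move=> cV tf; pose F (t : (A ⊗ (A ⊗ V))%type) :=
  \tsum_(a1, x <- t) \tsum_(a2, v0 <- x) f a1 a2 v0.
have Fl : linear F by rewrite /F; lin.
have := congr1 F (comod_coassoc cV v).
rewrite /= !(lin_of_tlift _ _ Fl).
under eq_tlift => x v0.
  rewrite (lin_of_tlift _ _ Fl).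
  under eq_tlift => a1 a2.
    rewrite /F tlift_pure; last by lin.
    rewrite tlift_pure; last by lin.
    over.
  over.
move=> ->; apply: eq_tlift => a1 x.
rewrite (lin_of_tlift _ _ Fl); apply: eq_tlift => a2 v0.
rewrite /F tlift_pure; last by lin.
by rewrite tlift_pure; last by lin.
Qed.

Lemma counit (V G : lmodType C) (co : V -> (A ⊗ V)%type) (f : V -> G) v :
  is_comodule hA co -> linear f -> \tsum_(a, v0 <- co v) (hcou hA a *: f v0) = f v.
Proof.
move=> cV fl; rewrite -{2}(comod_counit cV v) lin_of_tlift //.
by apply: eq_tlift => a v0; rewrite lin_of_scale.
Qed.

Lemma counitr (G : lmodType C) (f : A -> G) a :
  linear f -> \tsum_(a1, a2 <- hcop hA a) (hcou hA a2 *: f a1) = f a.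
Proof.
move=> fl; rewrite -{2}(hopf_cour H a) lin_of_tlift //.
by apply: eq_tlift => a1 a2; rewrite lin_of_scale.
Qed.

(** The cancellation of two adjacent Sweedler factors, such as [S x_(1) x_(2)],
    inside a longer string: coassociativity allows to group these two first. *)
Lemma contract_mid (K : A -> A -> A) (V G : lmodType C) (co : V -> (A ⊗ V)%type)
    (F : A -> A -> V -> G) w :
  is_comodule hA co -> bilin K -> trilin F ->
  (forall x, \tsum_(x1, x2 <- hcop hA x) K x1 x2 = hcou hA x *: hone hA) ->
  \tsum_(p, q <- co w) \tsum_(p1, p2 <- hcop hA p) \tsum_(q1, q2 <- co q)
     F p1 (K p2 q1) q2 = \tsum_(p, q <- co w) F p (hone hA) q.
Proof.
move=> cV bK tF hK.
rewrite (coassoc (f := fun p1 p2 q => \tsum_(q1, q2 <- co q) F p1 (K p2 q1) q2)) //; last by lin.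
apply: eq_tlift => p1 r.
rewrite -(coassoc (f := fun p2 q1 q2 => F p1 (K p2 q1) q2)) //; last by lin.
rewrite -[RHS](counit (f := F p1 (hone hA)) _ cV); last by lin.
apply: eq_tlift => s q2.
have <- := lin_of_scale (f := fun y => F p1 y q2); last by lin.
by rewrite -hK (lin_of_tlift (f := fun y => F p1 y q2)) //; lin.
Qed.

End Comodule.

Section Antipode.
Variables (C : numClosedFieldType) (A : lmodType C) (hA : hopf_ops A).
Hypothesis H : is_hopf_star_algebra hA.
Local Notation "x ** y" := (hmul hA x y) (at level 40, left associativity).
Local Notation S := (hant hA).
Let cA := hopf_comodule H.

Let mulA x y z : x ** (y ** z) = x ** y ** z.
Proof. exact: (alg_assoc (hopf_alg H)). Qed.

Let mulr_tlift (M N : lmodType C) (g : M -> N -> A) (t : (M ⊗ N)%type) a :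
  a ** tlift g t = tlift (fun m n => a ** g m n) t.
Proof. by rewrite (lin_of_tlift (f := hmul hA a)) //; lin. Qed.

Let mull_tlift (M N : lmodType C) (g : M -> N -> A) (t : (M ⊗ N)%type) a :
  tlift g t ** a = tlift (fun m n => g m n ** a) t.
Proof. by rewrite (lin_of_tlift (f := hmul hA ^~ a)) //; lin. Qed.

(** [P = P * (m * Q) = (P * m) * Q = Q] in the convolution algebra of bilinear
    maps on [A], where [m] is the product. *)
Lemma conv_unique2 (P Q : A -> A -> A) : bilin P -> bilin Q ->
  (forall a b, \tsum_(a1, a2 <- hcop hA a) \tsum_(b1, b2 <- hcop hA b)
     P a1 b1 ** (a2 ** b2) = (hcou hA a * hcou hA b) *: hone hA) ->
  (forall a b, \tsum_(a1, a2 <- hcop hA a) \tsum_(b1, b2 <- hcop hA b)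
     (a1 ** b1) ** Q a2 b2 = (hcou hA a * hcou hA b) *: hone hA) ->
  forall a b, P a b = Q a b.
Proof.
move=> bP bQ hP hQ a b.
transitivity (\tsum_(a1, r <- hcop hA a) \tsum_(r1, r2 <- hcop hA r)
   \tsum_(b1, s <- hcop hA b) \tsum_(s1, s2 <- hcop hA s)
     P a1 b1 ** ((r1 ** s1) ** Q r2 s2)).
  rewrite -[LHS](counitr H (f := fun a1 => P a1 b)); last by lin.
  apply: eq_tlift => a1 r; rewrite tlift_exchange.
  rewrite -[P a1 b](counitr H (f := P a1)); last by lin.
  rewrite scale_tlift.
  apply: eq_tlift => b1 s.
  have := congr1 (hmul hA (P a1 b1)) (hQ r s).
  rewrite lin_of_scale; last by lin.
  rewrite (alg_1r (hopf_alg H)) scalerA => <-.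
  rewrite mulr_tlift; apply: eq_tlift => r1 r2.
  by rewrite mulr_tlift.
rewrite -(coassoc (f := fun a1 r1 r2 => \tsum_(b1, s <- hcop hA b) \tsum_(s1, s2 <- hcop hA s)
     P a1 b1 ** ((r1 ** s1) ** Q r2 s2)) _ cA); last by lin.
rewrite -[RHS](counit (f := fun a2 => Q a2 b) _ cA); last by lin.
apply: eq_tlift => p a2.
under eq_tlift => a1 r1 do
  [rewrite -(coassoc (f := fun b1 s1 s2 =>
     P a1 b1 ** ((r1 ** s1) ** Q a2 s2)) _ cA); last by lin].
rewrite tlift_exchange.
rewrite -[Q a2 b](counit (f := Q a2) _ cA); last by lin.
rewrite scale_tlift.
apply: eq_tlift => q b2.
have := congr1 (hmul hA ^~ (Q a2 b2)) (hP p q).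
rewrite (lin_of_scale (f := hmul hA ^~ _)); last by lin.
rewrite (alg_1l (hopf_alg H)) scalerA => <-.
rewrite mull_tlift; apply: eq_tlift => a1 r1.
by rewrite mull_tlift; apply: eq_tlift => b1 s1; rewrite !mulA.
Qed.

Lemma copM_sum (G : lmodType C) (f : A -> A -> G) a b : bilin f ->
  \tsum_(x, y <- hcop hA (a ** b)) f x y =
  \tsum_(a1, a2 <- hcop hA a) \tsum_(b1, b2 <- hcop hA b) f (a1 ** b1) (a2 ** b2).
Proof.
move=> bf; rewrite (hopf_copM H) tlift_tlift //; apply: eq_tlift => a1 a2.
rewrite tlift_tlift //; apply: eq_tlift => b1 b2.
by rewrite tlift_pure.
Qed.

Lemma antipode1 : S (hone hA) = hone hA.
Proof.
have := hopf_antl H (hone hA); rewrite (hopf_cop1 H) tlift_pure; last by lin.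
by rewrite (alg_1r (hopf_alg H)) (hopf_cou1 H) scale1r.
Qed.

(** Both sides are convolution inverse to the product. *)
Lemma antipodeM a b : S (a ** b) = S b ** S a.
Proof.
apply: (conv_unique2 (P := fun a b => S (a ** b)) (Q := fun a b => S b ** S a));
  [by lin | by lin | | ] => {}a {}b.
- have := hopf_antl H (a ** b); rewrite (hopf_couM H) => <-.
  by rewrite (copM_sum (f := fun x y => S x ** y)) //; lin.
- under eq_tlift => a1 a2.
    have -> : \tsum_(b1, b2 <- hcop hA b) (a1 ** b1 ** (S b2 ** S a2)) =
      hcou hA b *: (a1 ** S a2).
      transitivity ((a1 ** \tsum_(b1, b2 <- hcop hA b) (b1 ** S b2)) ** S a2).
        rewrite mulr_tlift mull_tlift.
        by apply: eq_tlift => b1 b2; rewrite !mulA.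
      rewrite (hopf_antr H) (lin_of_scale (f := hmul hA a1)); last by lin.
      rewrite (lin_of_scale (f := hmul hA ^~ _)); last by lin.
      by rewrite (alg_1r (hopf_alg H)).
    over.
  rewrite -scale_tlift.
  by rewrite (hopf_antr H) scalerA mulrC.
Qed.

(** Both sides are evaluations of
    [Delta(S a_(1)) (a_(2) (x) a_(3)) (S a_(5) (x) S a_(4))], where one cancels
    either the last four factors or the first three. *)
Lemma antipode_cop (G : lmodType C) (f : A -> A -> G) a : bilin f ->
  \tsum_(x, y <- hcop hA (S a)) f x y = \tsum_(a1, a2 <- hcop hA a) f (S a2) (S a1).
Proof.
(* [h u v r] multiplies [u (x) v] by [S r_(2) (x) S r_(1)] from the right. *)
move=> bf; pose h u v r := \tsum_(r1, r2 <- hcop hA r) f (u ** S r2) (v ** S r1).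
have lh : trilin h by rewrite /h; lin.
transitivity (\tsum_(s, q <- hcop hA a) \tsum_(a1, p <- hcop hA s)
   \tsum_(x, y <- hcop hA (S a1)) \tsum_(p1, p2 <- hcop hA p) h (x ** p1) (y ** p2) q).
  rewrite (coassoc (f := fun a1 p q => \tsum_(x, y <- hcop hA (S a1))
    \tsum_(p1, p2 <- hcop hA p) h (x ** p1) (y ** p2) q) _ cA); last by lin.
  rewrite -[LHS](counitr H (f := fun a => \tsum_(x, y <- hcop hA (S a)) f x y)); last by lin.
  apply: eq_tlift => a1 r; rewrite scale_tlift.
  rewrite [RHS]tlift_exchange; apply: eq_tlift => x y; rewrite /h.
  under [RHS]eq_tlift => p q do under eq_tlift => p1 p2 do
    under eq_tlift => q1 q2 do rewrite -[y ** p2 ** _]mulA -[x ** p1 ** _]mulA.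
  rewrite (contract_mid (K := fun u v => u ** S v)
    (F := fun p1 z q2 => f (x ** (p1 ** S q2)) (y ** z)) _ cA);
    [ | lin | lin | by move=> z; rewrite (hopf_antr H)].
  rewrite (alg_1r (hopf_alg H)) -[x in LHS](alg_1r (hopf_alg H)).
  rewrite -(lin_of_scale (f := fun z => f (x ** z) y)); last by lin.
  by rewrite -(hopf_antr H) (lin_of_tlift (f := fun z => f (x ** z) y)); last by lin.
transitivity (\tsum_(s, q <- hcop hA a) (hcou hA s *: h (hone hA) (hone hA) q)).
  apply: eq_tlift => s q.
  transitivity (\tsum_(a1, p <- hcop hA s) \tsum_(x, y <- hcop hA (S a1 ** p)) h x y q).
    by apply: eq_tlift => a1 p; rewrite copM_sum //; lin.
  rewrite -(tlift_tlift (f := fun x y => h x y q)); last by lin.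
  rewrite -(lin_of_tlift (f := hcop hA)); last by lin.
  rewrite (hopf_antl H) (lin_of_scale (f := hcop hA)); last by lin.
  rewrite (lin_of_scale (f := tlift (fun x y => h x y q))); last by lin.
  by rewrite (hopf_cop1 H) tlift_pure //; lin.
rewrite (counit (f := h (hone hA) (hone hA)) _ cA); last by lin.
by rewrite /h; apply: eq_tlift => r1 r2; rewrite !(alg_1l (hopf_alg H)).
Qed.

Lemma antipode_cou a : hcou hA (S a) = hcou hA a.
Proof.
have := congr1 (hcou hA) (hopf_antl H a).
rewrite (lin_of_scale (hcou_lin H)) (hopf_cou1 H) [_ *: _]mulr1 => <-.
rewrite (lin_of_tlift (f := hcou hA : A -> C^o)); last by lin.
have := @counitr _ _ _ H _ (fun a => hcou hA (S a) : C^o) a.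
move=> <-; last by lin.
by apply: eq_tlift => a1 a2; rewrite (hopf_couM H) mulrC.
Qed.

(** ** The inverse of the antipode *)

Definition inv_antipode (a : A) : A := inverse S a.
Local Notation T := inv_antipode.

Lemma inv_antipodeK : cancel T S.
Proof.
move=> a; rewrite /T /inverse; case: xgetP => [x _ //|/(_ _)].
by have [T' _ TK] := hopf_ant_bij H => /(_ (T' a)) /=; rewrite TK.
Qed.

Lemma antipodeK : cancel S T.
Proof.
move=> a; apply: (bij_inj (hopf_ant_bij H)); exact: inv_antipodeK.
Qed.

Let S_inj : injective S := can_inj antipodeK.

Lemma inv_antipode_lin : linear T.
Proof.
move=> c x y; apply: S_inj; rewrite (hopf_ant_linear H).
by rewrite !inv_antipodeK.
Qed.

Lemma inv_antipodeM a b : T (a ** b) = T b ** T a.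
Proof. by apply: S_inj; rewrite antipodeM !inv_antipodeK. Qed.

Lemma inv_antipode_cou a : hcou hA (T a) = hcou hA a.
Proof. by rewrite -antipode_cou inv_antipodeK. Qed.

Lemma inv_antipode_cop (G : lmodType C) (f : A -> A -> G) a : bilin f ->
  \tsum_(x, y <- hcop hA (T a)) f x y = \tsum_(a1, a2 <- hcop hA a) f (T a2) (T a1).
Proof.
move=> bf; have lT := inv_antipode_lin.
rewrite -{2}[a]inv_antipodeK antipode_cop; last by lin.
by apply: eq_tlift => x y; rewrite !antipodeK.
Qed.

Lemma inv_antipodel a :
  \tsum_(a1, a2 <- hcop hA a) T a2 ** a1 = hcou hA a *: hone hA.
Proof.
apply: S_inj; rewrite (lin_of_scale (hopf_ant_linear H)) antipode1.
rewrite (lin_of_tlift (f := S)); last by lin.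
by rewrite -(hopf_antl H); apply: eq_tlift => x y; rewrite antipodeM inv_antipodeK.
Qed.

Lemma inv_antipoder a :
  \tsum_(a1, a2 <- hcop hA a) a2 ** T a1 = hcou hA a *: hone hA.
Proof.
apply: S_inj; rewrite (lin_of_scale (hopf_ant_linear H)) antipode1.
rewrite (lin_of_tlift (f := S)); last by lin.
by rewrite -(hopf_antr H); apply: eq_tlift => x y; rewrite antipodeM inv_antipodeK.
Qed.

(** ** The involution *)

Local Notation "x ^*h" := (hstar hA x) (at level 2, format "x ^*h").

Lemma hstar_linear : linear (hstar hA : A -> conj_space A).
Proof. exact: (star_antilinear (hopf_star H)). Qed.

Lemma hstarK : involutive (hstar hA).
Proof. exact: (star_involutive (hopf_star H)). Qed.

Lemma star_sum (M N : lmodType C) (g : M -> N -> A) (t : (M ⊗ N)%type) :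
  (tlift g t)^*h = tlift (fun m n => (g m n)^*h) t.
Proof. exact: (lin_of_tlift (f := hstar hA : A -> conj_space A) _ _ hstar_linear). Qed.

Lemma star_scale c x : (c *: x)^*h = c^* *: x^*h.
Proof. exact: (lin_of_scale (f := hstar hA : A -> conj_space A) hstar_linear). Qed.

Lemma star_cop (G : lmodType C) (f : A -> A -> G) a : bilin f ->
  \tsum_(x, y <- hcop hA a^*h) f x y = \tsum_(a1, a2 <- hcop hA a) f a1^*h a2^*h.
Proof.
move=> bf; rewrite (hopf_cop_star H) tlift_tlift //.
by apply: eq_tlift => x y; rewrite tlift_pure.
Qed.

Lemma star1 : (hone hA)^*h = hone hA.
Proof.
by have := star_mul (hopf_star H) (hone hA)^*h (hone hA);
  rewrite hstarK !(alg_1r (hopf_alg H)) hstarK => {1}<-.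
Qed.

(** The conjugate of [hcou (x^* )] is a left counit, and a counit is unique. *)
Lemma star_cou a : hcou hA a^*h = (hcou hA a)^*.
Proof.
have e (x : A) : \tsum_(x1, x2 <- hcop hA x) ((hcou hA x1^*h)^* *: x2) = x.
  rewrite -[RHS]hstarK -[x^*h](hopf_coul H) star_cop; last by lin.
  by rewrite star_sum; apply: eq_tlift => x1 x2; rewrite star_scale hstarK.
apply: (can_inj conjCK); rewrite conjCK -{2}(e a).
rewrite (lin_of_tlift (f := hcou hA : A -> C^o)); last by lin.
have <- := counitr H (f := fun m => (hcou hA m^*h)^* : C^o) a.
  apply: eq_tlift => m n; rewrite (lin_of_scale (hcou_lin H)).
  by rewrite [LHS]mulrC.
move=> c x y; rewrite (star_antilinear (hopf_star H)) (hcou_lin H).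
by rewrite rmorphD [X in X + _]rmorphM /= conjCK.
Qed.

(** Conjugating the antipode by the involution inverts it: both [x |-> S(x^* )^*]
    and the inverse of [S] are antipodes for the opposite product. *)
Lemma star_antipode_star a : (S a^*h)^*h = T a.
Proof.
pose R a := (S a^*h)^*h.
have lR : linear R.
  move=> c x y; rewrite /R (star_antilinear (hopf_star H)) (hopf_ant_linear H).
  by rewrite (star_antilinear (hopf_star H)) conjCK.
have lT := inv_antipode_lin.
have hR x : \tsum_(x1, x2 <- hcop hA x) R x2 ** x1 = hcou hA x *: hone hA.
  transitivity ((\tsum_(x1, x2 <- hcop hA x^*h) x1 ** S x2)^*h).
    rewrite star_cop; last by lin.
    rewrite star_sum; apply: eq_tlift => x1 x2.
    by rewrite (star_mul (hopf_star H)) hstarK.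
  by rewrite (hopf_antr H) star_scale star1 star_cou conjCK.
rewrite -/(R a) -[LHS](counit (f := R) a cA) //.
rewrite -[RHS](counitr H (f := T) a) //.
transitivity (\tsum_(p, q <- hcop hA a) \tsum_(p1, p2 <- hcop hA p) R q ** (p2 ** T p1)).
  apply: eq_tlift => p q.
  rewrite -mulr_tlift inv_antipoder (lin_of_scale (f := hmul hA (R q))); last by lin.
  by rewrite (alg_1r (hopf_alg H)).
rewrite (coassoc (f := fun p1 p2 q => R q ** (p2 ** T p1)) a cA); last by lin.
apply: eq_tlift => p1 r.
under eq_tlift => p2 q do rewrite mulA.
rewrite -mull_tlift hR (lin_of_scale (f := hmul hA ^~ _)); last by lin.
by rewrite (alg_1l (hopf_alg H)).
Qed.

Lemma star_antipode a : (S a)^*h = T a^*h.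
Proof. by rewrite -star_antipode_star hstarK. Qed.

Lemma star_inv_antipode a : (T a^*h)^*h = S a.
Proof. by rewrite -star_antipode hstarK. Qed.

End Antipode.
#[global] Hint Extern 1 (GRing.linear_for _ _) =>
  solve [apply: inv_antipode_lin; eassumption] : lin.

(** * Identities for 2-cocycles *)

Lemma scale_regular (C : numClosedFieldType) (c : C) (x : C^o) : c *: x = c * x.
Proof. by []. Qed.

Section Convolution3.
Variables (C : numClosedFieldType) (A : lmodType C) (hA : hopf_ops A).
Hypothesis H : is_hopf_star_algebra hA.
Let cA := hopf_comodule H.

Definition conv3 (s t : A -> A -> A -> C^o) : A -> A -> A -> C^o := fun g h k =>
  \tsum_(g1, g2 <- hcop hA g) \tsum_(h1, h2 <- hcop hA h)
  \tsum_(k1, k2 <- hcop hA k) (s g1 h1 k1 * t g2 h2 k2).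

Definition unit3 : A -> A -> A -> C^o :=
  fun g h k => hcou hA g * hcou hA h * hcou hA k.

Lemma trilin_conv3 s t : trilin s -> trilin t -> trilin (conv3 s t).
Proof. by move=> ts tt; rewrite /conv3; lin. Qed.

Lemma conv3A s t u : trilin s -> trilin t -> trilin u ->
  conv3 s (conv3 t u) = conv3 (conv3 s t) u.
Proof.
move=> ts tt tu; apply/funext => g; apply/funext => h; apply/funext => k.
have scl (c : C) (M N : lmodType C) (f : M -> N -> C^o) (x : (M ⊗ N)%type) :
  c * tlift f x = tlift (fun m n => c * f m n) x :> C^o.
  exact: (scale_tlift (U := C^o) c f x).
have scr (c : C) (M N : lmodType C) (f : M -> N -> C^o) (x : (M ⊗ N)%type) :
  tlift f x * c = tlift (fun m n => f m n * c) x :> C^o.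
  by rewrite mulrC scl; apply: eq_tlift => m n; rewrite mulrC.
transitivity (\tsum_(g1, r <- hcop hA g) \tsum_(g2, g3 <- hcop hA r)
  \tsum_(h1, s' <- hcop hA h) \tsum_(h2, h3 <- hcop hA s')
  \tsum_(k1, q <- hcop hA k) \tsum_(k2, k3 <- hcop hA q)
    ((s g1 h1 k1 * t g2 h2 k2 * u g3 h3 k3) : C^o)).
  apply: eq_tlift => g1 r; rewrite [RHS]tlift_exchange.
  apply: eq_tlift => h1 s'.
  under [RHS]eq_tlift => g2 g3 do rewrite tlift_exchange.
  rewrite [RHS]tlift_exchange; apply: eq_tlift => k1 q.
  rewrite /conv3 scl; apply: eq_tlift => g2 g3; rewrite scl.
  apply: eq_tlift => h2 h3; rewrite scl; apply: eq_tlift => k2 k3.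
  by rewrite mulrA.
rewrite -(coassoc (f := fun g1 g2 g3 => \tsum_(h1, s' <- hcop hA h)
  \tsum_(h2, h3 <- hcop hA s') \tsum_(k1, q <- hcop hA k)
  \tsum_(k2, k3 <- hcop hA q) ((s g1 h1 k1 * t g2 h2 k2 * u g3 h3 k3) : C^o)) _ cA);
  last by lin.
apply: eq_tlift => p g3.
under eq_tlift => g1 g2 do
  [rewrite -(coassoc (f := fun h1 h2 h3 => \tsum_(k1, q <- hcop hA k)
  \tsum_(k2, k3 <- hcop hA q) ((s g1 h1 k1 * t g2 h2 k2 * u g3 h3 k3) : C^o)) _ cA);
  last by lin].
rewrite tlift_exchange; apply: eq_tlift => p' h3.
under eq_tlift => g1 g2 do under eq_tlift => h1 h2 do
  [rewrite -(coassoc (f := fun k1 k2 k3 =>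
    ((s g1 h1 k1 * t g2 h2 k2 * u g3 h3 k3) : C^o)) _ cA); last by lin].
under eq_tlift => g1 g2 do rewrite tlift_exchange.
rewrite tlift_exchange; apply: eq_tlift => p'' k3.
rewrite /conv3 scr; apply: eq_tlift => g1 g2; rewrite scr.
by apply: eq_tlift => h1 h2; rewrite scr.
Qed.

Definition first_two (r : A -> A -> C^o) : A -> A -> A -> C^o :=
  fun g h k => r g h * hcou hA k.
Definition last_two (r : A -> A -> C^o) : A -> A -> A -> C^o :=
  fun g h k => hcou hA g * r h k.

Section Units.
Variables (s : A -> A -> A -> C^o) (r : A -> A -> C^o).
Hypotheses (ts : trilin s) (br : bilin r).

Lemma conv3_first_two_l g h k : conv3 (first_two r) s g h k =
  \tsum_(g1, g2 <- hcop hA g) \tsum_(h1, h2 <- hcop hA h) (r g1 h1 * s g2 h2 k).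
Proof.
apply: eq_tlift => g1 g2; apply: eq_tlift => h1 h2.
rewrite -[RHS](counit (f := fun k => r g1 h1 * s g2 h2 k : C^o) _ cA); last by lin.
by apply: eq_tlift => k1 k2; rewrite /first_two scale_regular; ring.
Qed.

Lemma conv3_first_two_r g h k : conv3 s (first_two r) g h k =
  \tsum_(g1, g2 <- hcop hA g) \tsum_(h1, h2 <- hcop hA h) (s g1 h1 k * r g2 h2).
Proof.
apply: eq_tlift => g1 g2; apply: eq_tlift => h1 h2.
rewrite -[RHS](counitr H (f := fun k => s g1 h1 k * r g2 h2 : C^o)); last by lin.
by apply: eq_tlift => k1 k2; rewrite /first_two scale_regular; ring.
Qed.

Lemma conv3_last_two_l g h k : conv3 (last_two r) s g h k =
  \tsum_(h1, h2 <- hcop hA h) \tsum_(k1, k2 <- hcop hA k) (r h1 k1 * s g h2 k2).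
Proof.
rewrite -[RHS](counit (f := fun g => \tsum_(h1, h2 <- hcop hA h)
  \tsum_(k1, k2 <- hcop hA k) (r h1 k1 * s g h2 k2 : C^o)) _ cA); last by lin.
apply: eq_tlift => g1 g2; rewrite scale_tlift; apply: eq_tlift => h1 h2.
rewrite scale_tlift; apply: eq_tlift => k1 k2.
by rewrite /last_two scale_regular; ring.
Qed.

Lemma conv3_last_two_r g h k : conv3 s (last_two r) g h k =
  \tsum_(h1, h2 <- hcop hA h) \tsum_(k1, k2 <- hcop hA k) (s g h1 k1 * r h2 k2).
Proof.
rewrite -[RHS](counitr H (f := fun g => \tsum_(h1, h2 <- hcop hA h)
  \tsum_(k1, k2 <- hcop hA k) (s g h1 k1 * r h2 k2 : C^o))); last by lin.
apply: eq_tlift => g1 g2; rewrite scale_tlift; apply: eq_tlift => h1 h2.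
rewrite scale_tlift; apply: eq_tlift => k1 k2.
by rewrite /last_two scale_regular; ring.
Qed.

Lemma conv3_unitl : conv3 unit3 s = s.
Proof.
apply/funext => g; apply/funext => h; apply/funext => k.
have -> : unit3 = first_two (fun g h => hcou hA g * hcou hA h) by [].
transitivity (\tsum_(g1, g2 <- hcop hA g) (hcou hA g1 *: s g2 h k)); last first.
  by rewrite (counit (f := fun g => s g h k) _ cA); last by lin.
apply: eq_tlift => g1 g2.
transitivity (\tsum_(h1, h2 <- hcop hA h) (hcou hA h1 *: (hcou hA g1 *: s g2 h2 k))).
  apply: eq_tlift => h1 h2.
  rewrite -[RHS](counit (f := fun k => hcou hA h1 *: (hcou hA g1 *: s g2 h2 k)) _ cA); last by lin.
  by apply: eq_tlift => k1 k2; rewrite /first_two !scale_regular; ring.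
by rewrite (counit (f := fun h => hcou hA g1 *: s g2 h k) _ cA) //; lin.
Qed.

Lemma conv3_unitr : conv3 s unit3 = s.
Proof.
apply/funext => g; apply/funext => h; apply/funext => k.
have -> : unit3 = first_two (fun g h => hcou hA g * hcou hA h) by [].
transitivity (\tsum_(g1, g2 <- hcop hA g) (hcou hA g2 *: s g1 h k)); last first.
  by rewrite (counitr H (f := fun g => s g h k)); last by lin.
apply: eq_tlift => g1 g2.
transitivity (\tsum_(h1, h2 <- hcop hA h) (hcou hA h2 *: (hcou hA g2 *: s g1 h1 k))).
  apply: eq_tlift => h1 h2.
  rewrite -[RHS](counitr H (f := fun k => hcou hA h2 *: (hcou hA g2 *: s g1 h1 k))); last by lin.
  by apply: eq_tlift => k1 k2; rewrite /first_two !scale_regular; ring.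
by rewrite (counitr H (f := fun h => hcou hA g2 *: s g1 h k)) //; lin.
Qed.
End Units.

End Convolution3.

Section Cocycle.
Variables (C : numClosedFieldType) (A : lmodType C) (hA : hopf_ops A).
Variables (gam gamb : {scalar (A ⊗ A)%type}).
Hypothesis H : is_hopf_star_algebra hA.
Hypothesis HG : is_cocycle hA gam gamb.
Let cA := hopf_comodule H.
Local Notation "x ** y" := (hmul hA x y) (at level 40, left associativity).
Local Notation T := (inv_antipode hA).
Local Notation g_ := (fun x y : A => gam (x ⊗ y) : C^o).
Local Notation b_ := (fun x y : A => gamb (x ⊗ y) : C^o).

(** The four sides of the cocycle identity and their convolution inverses; the
    three derived identities below are the cocycle identity
    [first_two g * left_mul g = last_two g * right_mul g] with some factors moved
    to the other side. *)
Let left_mul (r : A -> A -> C^o) : A -> A -> A -> C^o := fun g h k => r (g ** h) k.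
Let right_mul (r : A -> A -> C^o) : A -> A -> A -> C^o := fun g h k => r g (h ** k).

Let tf r : bilin r -> trilin (first_two hA r). Proof. by rewrite /first_two; lin. Qed.
Let tl r : bilin r -> trilin (last_two hA r). Proof. by rewrite /last_two; lin. Qed.
Let tlm r : bilin r -> trilin (left_mul r). Proof. by rewrite /left_mul; lin. Qed.
Let trm r : bilin r -> trilin (right_mul r). Proof. by rewrite /right_mul; lin. Qed.
Let bg : bilin g_. Proof. by lin. Qed.
Let bb : bilin b_. Proof. by lin. Qed.

#[local] Hint Resolve tf tl tlm trm bg bb : core.

Section Inverses.
Variables r s : A -> A -> C^o.
Hypotheses (br : bilin r) (bs : bilin s).
Hypothesis rs : forall g h, \tsum_(g1, g2 <- hcop hA g)
  \tsum_(h1, h2 <- hcop hA h) (r g1 h1 * s g2 h2 : C^o) = hcou hA g * hcou hA h.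

Let first_two_inv : conv3 hA (first_two hA r) (first_two hA s) = unit3 hA.
Proof.
apply/funext => g; apply/funext => h; apply/funext => k.
rewrite (conv3_first_two_l H) //; last exact: tf.
rewrite /unit3 -rs mulrC -[_ * _]/(hcou hA k *: (_ : C^o)) scale_tlift; apply: eq_tlift => g1 g2.
by rewrite scale_tlift; apply: eq_tlift => h1 h2; rewrite /first_two mulrA mulrC.
Qed.

Let last_two_inv : conv3 hA (last_two hA r) (last_two hA s) = unit3 hA.
Proof.
apply/funext => g; apply/funext => h; apply/funext => k.
rewrite (conv3_last_two_l H) //; last exact: tl.
rewrite /unit3 -mulrA -rs -[_ * _]/(hcou hA g *: (_ : C^o)) scale_tlift; apply: eq_tlift => g1 g2.
by rewrite scale_tlift; apply: eq_tlift => h1 h2; rewrite /last_two mulrCA.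
Qed.

Let left_mul_inv : conv3 hA (left_mul r) (left_mul s) = unit3 hA.
Proof.
apply/funext => g; apply/funext => h; apply/funext => k.
rewrite /unit3 -(hopf_couM H) -rs copM_sum //; lin.
Qed.

Let right_mul_inv : conv3 hA (right_mul r) (right_mul s) = unit3 hA.
Proof.
apply/funext => g; apply/funext => h; apply/funext => k.
rewrite /unit3 -mulrA -(hopf_couM H) -rs; apply: eq_tlift => g1 g2.
rewrite copM_sum //; lin.
Qed.

Definition sides_inverse := (first_two_inv, last_two_inv, left_mul_inv, right_mul_inv).
End Inverses.


Let gb := sides_inverse bg bb (coc_invr HG).
Let bg_ := sides_inverse bb bg (coc_invl HG).
Local Notation "s * t" := (conv3 hA s t) : conv_scope.
Delimit Scope conv_scope with conv.

Let cocycle3 : (first_two hA g_ * left_mul g_ = last_two hA g_ * right_mul g_)%conv.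
Proof.
apply/funext => g; apply/funext => h; apply/funext => k.
apply: (etrans (conv3_first_two_l H _ (tlm bg) g h k)).
refine (etrans _ (esym (conv3_last_two_l H _ (trm bg) g h k))).
exact: (coc_cocycle HG).
Qed.

Let cA3 := @conv3A _ _ _ H.
Let conv3_cancel s t u : trilin s -> trilin t -> trilin u ->
  (s * t = unit3 hA)%conv -> (s * (t * u) = u)%conv.
Proof. by move=> *; rewrite cA3 // (_ : (s * t)%conv = unit3 hA) // (conv3_unitl H). Qed.

Let conv3_cancelr s t u : trilin s -> trilin t -> trilin u ->
  (t * u = unit3 hA)%conv -> (s * t * u = s)%conv.
Proof. by move=> *; rewrite -cA3 // (_ : (t * u)%conv = unit3 hA) // (conv3_unitr H). Qed.

(** Multiply [a * b = c * d] by inverses on either side, or invert both sides. *)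
Let move_factors a b c d a' b' c' d' :
  trilin a -> trilin b -> trilin c -> trilin d ->
  trilin a' -> trilin b' -> trilin c' -> trilin d' ->
  (a * b = c * d)%conv ->
  (a * a' = unit3 hA)%conv -> (b * b' = unit3 hA)%conv ->
  (a' * a = unit3 hA)%conv -> (c' * c = unit3 hA)%conv ->
  (d' * d = unit3 hA)%conv -> (d * d' = unit3 hA)%conv ->
  [/\ (c' * a = d * b')%conv, (a' * c = b * d')%conv & (b' * a' = d' * c')%conv].
Proof.
move=> ta tb tc td ta' tb' tc' td' e aa bb' a'a c'c d'd dd'.
have tab := trilin_conv3 H ta tb; have tcd := trilin_conv3 H tc td.
have e1 : (c' * a = d * b')%conv.
  rewrite -[LHS](conv3_cancelr (t := b) (u := b')) //; last exact: trilin_conv3.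
  by rewrite -(cA3 tc' ta tb) e (conv3_cancel tc' tc td).
have e2 : (a' * c = b * d')%conv.
  rewrite -[LHS](conv3_cancelr (t := d) (u := d')) //; last exact: trilin_conv3.
  by rewrite -(cA3 ta' tc td) -e (conv3_cancel ta' ta tb).
split=> //.
rewrite -[LHS](conv3_cancel (s := d') (t := d)) //; last exact: trilin_conv3.
rewrite (cA3 td tb' ta') -e1; congr conv3.
by rewrite -(cA3 tc' ta ta') aa (conv3_unitr H).
Qed.

Let moved := move_factors (tf bg) (tlm bg) (tl bg) (trm bg)
  (tf bb) (tlm bb) (tl bb) (trm bb) cocycle3 gb.1.1.1 gb.1.2 bg_.1.1.1
  bg_.1.1.2 bg_.2 gb.2.

Lemma cocycle_move_left g h k :
  \tsum_(h1, h2 <- hcop hA h) (gamb (h1 ⊗ k) * gam (g ⊗ h2) : C^o) =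
  \tsum_(g1, g2 <- hcop hA g) \tsum_(h1, h2 <- hcop hA h)
  \tsum_(k1, k2 <- hcop hA k) (gam (g1 ⊗ (h1 ** k1)) * gamb ((g2 ** h2) ⊗ k2)).
Proof.
case: moved => e _ _; have {}e := congr1 (fun f => f g h k) e.
refine (etrans _ e).
refine (etrans _ (esym (conv3_last_two_l H _ (tf bg) g h k))).
apply: eq_tlift => h1 h2; rewrite /first_two.
rewrite -[LHS](counitr H (f := fun k => gamb (h1 ⊗ k) * gam (g ⊗ h2) : C^o)); last by lin.
by apply: eq_tlift => k1 k2; rewrite scale_regular; ring.
Qed.

Lemma cocycle_move_right g h k :
  \tsum_(h1, h2 <- hcop hA h) (gamb (g ⊗ h1) * gam (h2 ⊗ k) : C^o) =
  \tsum_(g1, g2 <- hcop hA g) \tsum_(h1, h2 <- hcop hA h)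
  \tsum_(k1, k2 <- hcop hA k) (gam ((g1 ** h1) ⊗ k1) * gamb (g2 ⊗ (h2 ** k2))).
Proof.
case: moved => _ e _; have {}e := congr1 (fun f => f g h k) e.
refine (etrans _ e).
refine (etrans _ (esym (conv3_last_two_r H g_ (tf bb) g h k))).
apply: eq_tlift => h1 h2; rewrite /first_two.
rewrite -[LHS](counit (f := fun k => gamb (g ⊗ h1) * gam (h2 ⊗ k) : C^o) k cA); last by lin.
by apply: eq_tlift => k1 k2; rewrite scale_regular; ring.
Qed.

Lemma cocycle_inverse g h k :
  \tsum_(g1, g2 <- hcop hA g) \tsum_(h1, h2 <- hcop hA h)
     (gamb ((g1 ** h1) ⊗ k) * gamb (g2 ⊗ h2) : C^o) =
  \tsum_(h1, h2 <- hcop hA h) \tsum_(k1, k2 <- hcop hA k)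
     (gamb (g ⊗ (h1 ** k1)) * gamb (h2 ⊗ k2)).
Proof.
case: moved => _ _ e; have {}e := congr1 (fun f => f g h k) e.
apply: (etrans (esym (conv3_first_two_r H b_ (tlm bb) g h k))).
exact: (etrans e (conv3_last_two_r H b_ (trm bb) g h k)).
Qed.

Let cocycle_invr g h : \tsum_(g1, g2 <- hcop hA g) \tsum_(h1, h2 <- hcop hA h)
  (gam (g1 ⊗ h1) * gamb (g2 ⊗ h2) : C^o) = hcou hA g * hcou hA h.
Proof. exact: (coc_invr HG). Qed.

Lemma cocycle_inv_unitl x : gamb (hone hA ⊗ x) = hcou hA x.
Proof.
rewrite -[LHS](counit (f := fun x => gamb (hone hA ⊗ x) : C^o) x cA); last by lin.
have := cocycle_invr (hone hA) x; rewrite (hopf_cop1 H) tlift_pure; last by lin.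
rewrite (hopf_cou1 H) mul1r => <-; apply: eq_tlift => x1 x2.
by rewrite (coc_unitl HG).
Qed.

Lemma cocycle_inv_unitr x : gamb (x ⊗ hone hA) = hcou hA x.
Proof.
rewrite -[LHS](counit (f := fun x => gamb (x ⊗ hone hA) : C^o) x cA); last by lin.
have := cocycle_invr x (hone hA); rewrite (hopf_cou1 H) mulr1 => <-.
apply: eq_tlift => x1 x2; rewrite (hopf_cop1 H) tlift_pure; last by lin.
by rewrite (coc_unitr HG).
Qed.


Let TK := inv_antipodeK H.
Let ST := antipodeK H.
Let lT := inv_antipode_lin H.

Lemma coc_VbE x : coc_Vb hA gamb x =
  \tsum_(x1, x2 <- hcop hA x) (gamb (x2 ⊗ T x1) : C^o).
Proof.
rewrite /coc_Vb /coc_Ub.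
apply: (etrans (@inv_antipode_cop _ _ _ H _ (fun a b => gamb (hant hA a ⊗ b) : C^o) x _)).
  by lin.
by apply: eq_tlift => x1 x2; rewrite TK.
Qed.

Lemma coc_Vb_lin : linear (coc_Vb hA gamb : A -> C^o).
Proof. by refine (@lin_ext C A (C^o) _ _ coc_VbE _); lin. Qed.

(** *** The functional twisting involutions *)

Hypothesis HU : is_unitary_cocycle hA gam gamb.
Local Notation "x ^*h" := (hstar hA x) (at level 2, format "x ^*h").

Lemma conj_cocycle_star x y : (gam (x^*h ⊗ y^*h))^* = gamb (T x ⊗ T y).
Proof. by rewrite HU !(star_antipode_star H). Qed.

Lemma conj_cocycle_inv x y : (gamb (x ⊗ y))^* = gam (T x^*h ⊗ T y^*h).
Proof.
rewrite -[RHS]conjCK HU !TK; congr ((gamb (_ ⊗ _))^*); by rewrite (hstarK H).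
Qed.

(** By unitarity this is [coc_V]; the conjugate appears when the scalar
    [coc_Vb (x^* )] of the deformed involution is moved inside the involution. *)
Definition star_twist (x : A) : C := (coc_Vb hA gamb x^*h)^*.

Lemma star_twistE x : star_twist x =
  \tsum_(x1, x2 <- hcop hA x) (gam (T x2 ⊗ x1) : C^o).
Proof.
rewrite /star_twist coc_VbE.
rewrite (@star_cop _ _ _ H _ (fun x y => gamb (y ⊗ T x) : C^o)); last by lin.
rewrite /tlift rmorph_sum; apply: eq_bigr => p _ /=.
rewrite conj_cocycle_inv (hstarK H) (star_inv_antipode H) (ST _).
by [].
Qed.

Lemma star_twist_lin : linear (star_twist : A -> C^o).
Proof. by refine (@lin_ext C A (C^o) _ _ star_twistE _); lin. Qed.

(** The two sums meet in [gamb (_ (x) T x_(1)) gam (T x_(4) (x) _)] with [x_(2)]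
    and [x_(3)] in the gaps; [cocycle_move_left] makes these adjacent to [T x_(1)]
    and [T x_(4)] inside products, where they cancel. *)
Lemma coc_Vb_star_twist x :
  \tsum_(x1, x2 <- hcop hA x) (coc_Vb hA gamb x1 * star_twist x2 : C^o) = hcou hA x.
Proof.
transitivity (\tsum_(p, q <- hcop hA x) \tsum_(p1, p2 <- hcop hA p)
  \tsum_(q1, q2 <- hcop hA q) (gamb (p2 ⊗ T p1) * gam (T q2 ⊗ q1) : C^o)).
  apply: eq_tlift => p q; rewrite coc_VbE star_twistE.
  rewrite mulrC -scale_regular scale_tlift; apply: eq_tlift => p1 p2.
  rewrite scale_regular mulrC -scale_regular scale_tlift.
  by apply: eq_tlift => q1 q2.
rewrite (coassoc (f := fun p1 p2 q => \tsum_(q1, q2 <- hcop hA q)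
   (gamb (p2 ⊗ T p1) * gam (T q2 ⊗ q1) : C^o)) _ cA); last by lin.
under eq_tlift => p1 r.
  rewrite -(coassoc (f := fun a2 q1 q2 => gamb (a2 ⊗ T p1) * gam (T q2 ⊗ q1) : C^o) _ cA); last by lin.
  under eq_tlift => h q.
    rewrite cocycle_move_left.
    rewrite (@inv_antipode_cop _ _ _ H (C^o) (fun g1 g2 => \tsum_(h1, h2 <- hcop hA h)
      \tsum_(k1, k2 <- hcop hA (T p1)) gam (g1 ⊗ (h1 ** k1)) * gamb ((g2 ** h2) ⊗ k2))); last by lin.
    rewrite tlift_exchange.
    under eq_tlift => h1 h2 do under eq_tlift => q1 q2 do
      [rewrite (@inv_antipode_cop _ _ _ H (C^o) (fun k1 k2 =>
        gam (T q2 ⊗ (h1 ** k1)) * gamb ((T q1 ** h2) ⊗ k2))); last by lin].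
    over.
  rewrite (contract_mid (K := fun y z => T z ** y)
    (F := fun h1 z q2 => \tsum_(k1, k2 <- hcop hA p1)
      (gam (T q2 ⊗ (h1 ** T k2)) * gamb (z ⊗ T k1) : C^o)) _ cA);
    [ | lin | lin | exact: inv_antipodel].
  rewrite tlift_exchange.
  over.
rewrite (contract_mid (K := fun y z => z ** T y)
    (F := fun k1 z q => (gam (T q ⊗ z) * gamb (hone hA ⊗ T k1) : C^o)) _ cA);
    [ | lin | lin | exact: inv_antipoder].
rewrite -[RHS](counit (f := hcou hA : A -> C^o) _ cA); last by lin.
apply: eq_tlift => k1 q.
by rewrite (coc_unitr HG) cocycle_inv_unitl !(inv_antipode_cou H) mulrC.
Qed.

Lemma star_twist_coc_Vb x :
  \tsum_(x1, x2 <- hcop hA x) (star_twist x1 * coc_Vb hA gamb x2 : C^o) = hcou hA x.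
Proof.
transitivity (\tsum_(p, q <- hcop hA x) \tsum_(p1, p2 <- hcop hA p)
  \tsum_(q1, q2 <- hcop hA q) (gamb (q2 ⊗ T q1) * gam (T p2 ⊗ p1) : C^o)).
  apply: eq_tlift => p q; rewrite coc_VbE star_twistE.
  rewrite mulrC -scale_regular scale_tlift; apply: eq_tlift => p1 p2.
  rewrite scale_regular mulrC -scale_regular scale_tlift.
  by apply: eq_tlift => q1 q2; rewrite scale_regular mulrC.
rewrite (coassoc (f := fun p1 p2 q => \tsum_(q1, q2 <- hcop hA q)
   (gamb (q2 ⊗ T q1) * gam (T p2 ⊗ p1) : C^o)) _ cA); last by lin.
under eq_tlift => p1 r.
  rewrite -(coassoc (f := fun a2 q1 q2 => gamb (q2 ⊗ T q1) * gam (T a2 ⊗ p1) : C^o) _ cA); last by lin.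
  under eq_tlift => h q.
    rewrite -(@inv_antipode_cop _ _ _ H (C^o) (fun h1 h2 => gamb (q ⊗ h1) * gam (h2 ⊗ p1))); last by lin.
    rewrite cocycle_move_right.
    under eq_tlift => g1 g2 do
      [rewrite (@inv_antipode_cop _ _ _ H (C^o) (fun h1 h2 =>
         \tsum_(k1, k2 <- hcop hA p1) gam ((g1 ** h1) ⊗ k1) * gamb (g2 ⊗ (h2 ** k2))));
       last by lin].
    rewrite tlift_exchange.
    over.
  rewrite (contract_mid (K := fun y z => z ** T y)
    (F := fun h1 z g2 => \tsum_(k1, k2 <- hcop hA p1)
      (gam (z ⊗ k1) * gamb (g2 ⊗ (T h1 ** k2)) : C^o)) _ cA);
    [ | lin | lin | exact: inv_antipoder].
  rewrite tlift_exchange.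
  over.
rewrite (contract_mid (K := fun y z => T z ** y)
    (F := fun k1 z q => (gam (hone hA ⊗ k1) * gamb (q ⊗ z) : C^o)) _ cA);
    [ | lin | lin | exact: inv_antipodel].
rewrite -[RHS](counit (f := hcou hA : A -> C^o) _ cA); last by lin.
apply: eq_tlift => k1 q.
by rewrite (coc_unitl HG) cocycle_inv_unitr.
Qed.

(** [T w_(3) (x) T w_(2)] is the coproduct of [T] of a single factor, so
    [cocycle_move_right] applies to the right-hand side. *)
Let star_twist_inv_antipode g w :
  \tsum_(h, q <- hcop hA w) (gam ((g ** T q) ⊗ h) : C^o) =
  \tsum_(w1, w2 <- hcop hA w) (star_twist w1 * gamb (g ⊗ T w2)).
Proof.
symmetry.
transitivity (\tsum_(p, q <- hcop hA w) \tsum_(p1, p2 <- hcop hA p)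
  (gamb (g ⊗ T q) * gam (T p2 ⊗ p1) : C^o)).
  apply: eq_tlift => p q; rewrite star_twistE.
  rewrite mulrC -scale_regular scale_tlift; apply: eq_tlift => p1 p2.
  by [].
rewrite (coassoc (f := fun p1 p2 q =>
   (gamb (g ⊗ T q) * gam (T p2 ⊗ p1) : C^o)) _ cA); last by lin.
under eq_tlift => p1 r.
  rewrite -(@inv_antipode_cop _ _ _ H (C^o) (fun h1 h2 => gamb (g ⊗ h1) * gam (h2 ⊗ p1))); last by lin.
  rewrite cocycle_move_right.
  under eq_tlift => g1 g2.
    rewrite (@inv_antipode_cop _ _ _ H (C^o) (fun h1 h2 =>
         \tsum_(k1, k2 <- hcop hA p1) gam ((g1 ** h1) ⊗ k1) * gamb (g2 ⊗ (h2 ** k2))));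
       last by lin.
    rewrite tlift_exchange.
    over.
  over.
rewrite tlift_exchange.
under eq_tlift => g1 g2.
  rewrite (contract_mid (K := fun y z => T z ** y)
    (F := fun k1 z q => (gam ((g1 ** T q) ⊗ k1) * gamb (g2 ⊗ z) : C^o)) _ cA);
    [ | lin | lin | exact: inv_antipodel].
  over.
rewrite tlift_exchange; apply: eq_tlift => k1 q.
rewrite -[RHS](counitr H (f := fun g => gam ((g ** T q) ⊗ k1) : C^o)); last by lin.
by apply: eq_tlift => g1 g2; rewrite cocycle_inv_unitr mulrC.
Qed.

(** After [star_twist] is expanded, the left-hand side contains one side of the
    cocycle identity with [T (w_(3) x_(3))] as first argument; on its other side
    the factors [T w_(3) w_(2)] cancel, and what remains is
    [star_twist_inv_antipode]. *)
Lemma star_twist_mul w x :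
  \tsum_(w1, w2 <- hcop hA w) \tsum_(x1, x2 <- hcop hA x)
    (gam (w1 ⊗ x1) * star_twist (w2 ** x2) : C^o) =
  \tsum_(x1, x2 <- hcop hA x) \tsum_(w1, w2 <- hcop hA w)
    (star_twist x1 * (star_twist w1 * gamb (T x2 ⊗ T w2))).
Proof.
transitivity (\tsum_(h, w3 <- hcop hA w) \tsum_(h1, h2 <- hcop hA h)
  \tsum_(k, x3 <- hcop hA x) \tsum_(k1, k2 <- hcop hA k)
  (gam (h1 ⊗ k1) * gam (T (w3 ** x3) ⊗ (h2 ** k2)) : C^o)).
  rewrite (coassoc (f := fun h1 h2 w3 => \tsum_(k, x3 <- hcop hA x)
    \tsum_(k1, k2 <- hcop hA k)
    (gam (h1 ⊗ k1) * gam (T (w3 ** x3) ⊗ (h2 ** k2)) : C^o)) _ cA); last by lin.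
  apply: eq_tlift => h1 r; rewrite [RHS]tlift_exchange.
  transitivity (\tsum_(k, x3 <- hcop hA x) \tsum_(k1, k2 <- hcop hA k)
    \tsum_(h2, w3 <- hcop hA r)
    (gam (h1 ⊗ k1) * gam (T (w3 ** x3) ⊗ (h2 ** k2)) : C^o)); last first.
    by apply: eq_tlift => k x3; rewrite tlift_exchange.
  rewrite (coassoc (f := fun k1 k2 x3 => \tsum_(h2, w3 <- hcop hA r)
    (gam (h1 ⊗ k1) * gam (T (w3 ** x3) ⊗ (h2 ** k2)) : C^o)) _ cA); last by lin.
  apply: eq_tlift => k1 s; rewrite star_twistE.
  rewrite (copM_sum H (f := fun a b => gam (T b ⊗ a) : C^o)); last by lin.
  rewrite -scale_regular scale_tlift tlift_exchange; apply: eq_tlift => k2 x3.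
  by rewrite scale_tlift.
transitivity (\tsum_(k, x3 <- hcop hA x) \tsum_(x4, x5 <- hcop hA x3)
  \tsum_(h, w3 <- hcop hA w) (gam ((T x5 ** T w3) ⊗ h) * gam (T x4 ⊗ k) : C^o)).
  under eq_tlift => h w3 do rewrite tlift_exchange.
  rewrite tlift_exchange; apply: eq_tlift => k x3.
  transitivity (\tsum_(h, w3 <- hcop hA w) \tsum_(x4, x5 <- hcop hA x3)
      \tsum_(h1, h2 <- hcop hA h) \tsum_(w4, w5 <- hcop hA w3)
      (gam ((T x5 ** T w5) ⊗ h1) * gam ((T x4 ** (T w4 ** h2)) ⊗ k) : C^o)).
    apply: eq_tlift => h w3.
    refine (etrans (esym (coc_cocycle HG (T (w3 ** x3)) h k)) _).
    refine (etrans (@inv_antipode_cop _ _ _ H (C^o) (fun a b =>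
      \tsum_(h1, h2 <- hcop hA h) gam (a ⊗ h1) * gam ((b ** h2) ⊗ k)) _ _) _).
      by lin.
    rewrite (copM_sum H (f := fun a b => \tsum_(h1, h2 <- hcop hA h)
      (gam (T b ⊗ h1) * gam ((T a ** h2) ⊗ k) : C^o))); last by lin.
    rewrite tlift_exchange; apply: eq_tlift => x4 x5.
    rewrite tlift_exchange; apply: eq_tlift => h1 h2.
    apply: eq_tlift => w4 w5.
    by rewrite !(inv_antipodeM H) (alg_assoc (hopf_alg H)).
  rewrite tlift_exchange; apply: eq_tlift => x4 x5.
  rewrite (contract_mid (K := fun y z => T z ** y)
    (F := fun h1 z w5 => (gam ((T x5 ** T w5) ⊗ h1) * gam ((T x4 ** z) ⊗ k) : C^o)) _ cA);
    [ | lin | lin | exact: inv_antipodel].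
  by apply: eq_tlift => h w3; rewrite (alg_1r (hopf_alg H)).
rewrite -(coassoc (f := fun k x4 x5 => \tsum_(h, w3 <- hcop hA w)
  (gam ((T x5 ** T w3) ⊗ h) * gam (T x4 ⊗ k) : C^o)) _ cA); last by lin.
apply: eq_tlift => x1 x2.
transitivity ((\tsum_(h, w3 <- hcop hA w) (gam ((T x2 ** T w3) ⊗ h) : C^o)) *: 
   (star_twist x1 : C^o)).
  rewrite star_twistE scale_tlift; apply: eq_tlift => k x4.
  rewrite scale_regular mulrC -scale_regular scale_tlift.
  by apply: eq_tlift => h w3; rewrite scale_regular mulrC.
rewrite star_twist_inv_antipode !scale_regular mulrC -scale_regular scale_tlift.
by apply: eq_tlift => w1 w2; rewrite scale_regular.
Qed.

End Cocycle.
#[global] Hint Extern 1 (GRing.linear_for _ _) =>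
  solve [apply: star_twist_lin; eassumption] : lin.

(** * Twisting bilinear maps between comodules *)

Section Twist.
Variables (C : numClosedFieldType) (A : lmodType C).
Implicit Types (M N P Q G : lmodType C) (g : {scalar (A ⊗ A)%type}).

(** All deformed products and actions, as well as [phi] on elementary tensors,
    have this form. *)
Definition twist g M N G (coM : M -> (A ⊗ M)%type) (coN : N -> (A ⊗ N)%type)
    (f : M -> N -> G) (m : M) (n : N) : G :=
  \tsum_(x, m0 <- coM m) \tsum_(y, n0 <- coN n) (g (x ⊗ y) *: f m0 n0).

Lemma bilin_twist g M N G coM coN (f : M -> N -> G) :
  linear coM -> linear coN -> bilin f -> bilin (twist g coM coN f).
Proof. by move=> lM lN bf; rewrite /twist; lin. Qed.

Lemma linear_twist g M N G G' coM coN (f : M -> N -> G) (h : G -> G') m n :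
  linear h -> h (twist g coM coN f m n) = twist g coM coN (fun m n => h (f m n)) m n.
Proof.
move=> lh; rewrite /twist lin_of_tlift //; apply: eq_tlift => x m0.
by rewrite lin_of_tlift //; apply: eq_tlift => y n0; rewrite lin_of_scale.
Qed.

Lemma eq_twist g M N G coM coN (f f' : M -> N -> G) m n :
  (forall m n, f m n = f' m n) -> twist g coM coN f m n = twist g coM coN f' m n.
Proof. by move=> ff; apply: eq_tlift => x m0; apply: eq_tlift => y n0; rewrite ff. Qed.

Lemma twistD g M N G coM coN (f f' : M -> N -> G) m n :
  twist g coM coN (fun m n => f m n + f' m n) m n =
  twist g coM coN f m n + twist g coM coN f' m n.
Proof.
rewrite /twist /tlift -big_split; apply: eq_bigr => p _.
by rewrite -big_split; apply: eq_bigr => q _; rewrite scalerDr.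
Qed.

Lemma twistN g M N G coM coN (f : M -> N -> G) m n :
  twist g coM coN (fun m n => - f m n) m n = - twist g coM coN f m n.
Proof.
rewrite /twist /tlift -sumrN; apply: eq_bigr => p _.
by rewrite -sumrN; apply: eq_bigr => q _; rewrite scalerN.
Qed.

Lemma twist0 g M N G coM coN m n : twist g coM coN (fun (_ : M) (_ : N) => 0 : G) m n = 0.
Proof.
by rewrite /twist /tlift big1 // => p _; rewrite big1 // => q _; rewrite scaler0.
Qed.

Lemma twist_colinearl g M M' N G coM coM' coN (h : M -> M') (f : M' -> N -> G) m n :
  linear coN -> bilin f -> colinear coM coM' h ->
  twist g coM' coN f (h m) n = twist g coM coN (fun m n => f (h m) n) m n.
Proof.
move=> lN bf ch; rewrite /twist ch tlift_tlift; last by lin.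
by apply: eq_tlift => x m0; rewrite tlift_pure //; lin.
Qed.

Lemma twist_colinearr g M N N' G coM coN coN' (h : N -> N') (f : M -> N' -> G) m n :
  bilin f -> colinear coN coN' h ->
  twist g coM coN' f m (h n) = twist g coM coN (fun m n => f m (h n)) m n.
Proof.
move=> bf ch; rewrite /twist ch; apply: eq_tlift => x m0.
rewrite tlift_tlift; last by lin.
by apply: eq_tlift => y n0; rewrite tlift_pure //; lin.
Qed.

Variable hA : hopf_ops A.
Local Notation "x ** y" := (hmul hA x y) (at level 40, left associativity).

Definition colinear2 M N Q (coM : M -> (A ⊗ M)%type) (coN : N -> (A ⊗ N)%type)
    (coQ : Q -> (A ⊗ Q)%type) (f : M -> N -> Q) : Prop :=
  forall m n, coQ (f m n) =
    \tsum_(x, m0 <- coM m) \tsum_(y, n0 <- coN n) ((x ** y) ⊗ f m0 n0).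

Hypothesis H : is_hopf_star_algebra hA.

Lemma colinear2_sum M N Q G coM coN coQ (f : M -> N -> Q) (h : A -> Q -> G) m n :
  colinear2 coM coN coQ f -> bilin h ->
  \tsum_(u, q <- coQ (f m n)) h u q =
  \tsum_(x, m0 <- coM m) \tsum_(y, n0 <- coN n) h (x ** y) (f m0 n0).
Proof.
move=> cf bh; rewrite cf tlift_tlift //; apply: eq_tlift => x m0.
rewrite tlift_tlift //; apply: eq_tlift => y n0.
by rewrite tlift_pure.
Qed.

Lemma coassoc2 M N G coM coN (F : A -> A -> A -> A -> M -> N -> G) m n :
  is_comodule hA coM -> is_comodule hA coN ->
  (forall y1 y2 n, trilin (fun x1 x2 m => F x1 x2 y1 y2 m n)) ->
  (forall x1 x2 m, trilin (fun y1 y2 n => F x1 x2 y1 y2 m n)) ->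
  \tsum_(x1, m' <- coM m) \tsum_(y1, n' <- coN n) \tsum_(x2, m0 <- coM m')
    \tsum_(y2, n0 <- coN n') F x1 x2 y1 y2 m0 n0 =
  \tsum_(x, m0 <- coM m) \tsum_(y, n0 <- coN n) \tsum_(x1, x2 <- hcop hA x)
    \tsum_(y1, y2 <- hcop hA y) F x1 x2 y1 y2 m0 n0.
Proof.
move=> cM cN tm tn.
have hm1 y1 y2 n0 x2 m0 : linear (fun x1 => F x1 x2 y1 y2 m0 n0) by have [] := tm y1 y2 n0.
have hm2 y1 y2 n0 x1 m0 : linear (fun x2 => F x1 x2 y1 y2 m0 n0) by have [] := tm y1 y2 n0.
have hm3 y1 y2 n0 x1 x2 : linear (fun m0 => F x1 x2 y1 y2 m0 n0) by have [] := tm y1 y2 n0.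
transitivity (\tsum_(x1, m' <- coM m) \tsum_(x2, m0 <- coM m')
    \tsum_(y, n0 <- coN n) \tsum_(y1, y2 <- hcop hA y) F x1 x2 y1 y2 m0 n0).
  apply: eq_tlift => x1 m'; rewrite tlift_exchange; apply: eq_tlift => x2 m0.
  by rewrite (coassoc (f := fun y1 y2 n0 => F x1 x2 y1 y2 m0 n0) _ cN).
rewrite -(coassoc (f := fun x1 x2 m0 => \tsum_(y, n0 <- coN n)
  \tsum_(y1, y2 <- hcop hA y) F x1 x2 y1 y2 m0 n0) _ cM).
  by apply: eq_tlift => x m0; rewrite tlift_exchange.
split=> *; apply: lin_tlift_body => *; apply: lin_tlift_body => *;
  [exact: hm1 | exact: hm2 | exact: hm3].
Qed.

Section Inverse.
Variables r s : {scalar (A ⊗ A)%type}.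
Hypothesis rs : forall a b : A, \tsum_(a1, a2 <- hcop hA a)
  \tsum_(b1, b2 <- hcop hA b) (r (a1 ⊗ b1) * s (a2 ⊗ b2) : C^o) = hcou hA a * hcou hA b.

Lemma twist_inverse M N G coM coN (f : M -> N -> G) m n :
  is_comodule hA coM -> is_comodule hA coN -> bilin f ->
  twist r coM coN (twist s coM coN f) m n = f m n.
Proof.
move=> cM cN bf.
transitivity (\tsum_(x, m0 <- coM m) \tsum_(y, n0 <- coN n) \tsum_(x1, x2 <- hcop hA x)
    \tsum_(y1, y2 <- hcop hA y) ((r (x1 ⊗ y1) * s (x2 ⊗ y2)) *: f m0 n0)).
  rewrite -(coassoc2 (F := fun x1 x2 y1 y2 m0 n0 => (r (x1 ⊗ y1) * s (x2 ⊗ y2)) *: f m0 n0)) //;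
    [ | by lin | by lin ].
  apply: eq_tlift => x1 m'; apply: eq_tlift => y1 n'.
  rewrite scale_tlift; apply: eq_tlift => x2 m0.
  by rewrite scale_tlift; apply: eq_tlift => y2 n0; rewrite scalerA.
rewrite -[RHS](counit (f := fun m => f m n) _ cM); last by lin.
apply: eq_tlift => x m0.
rewrite -[f m0 n](counit (f := f m0) _ cN); last by lin.
rewrite scale_tlift; apply: eq_tlift => y n0; rewrite scalerA -rs.
rewrite (lin_of_tlift (f := fun c : C^o => c *: f m0 n0)); last by lin.
apply: eq_tlift => x1 x2.
by rewrite (lin_of_tlift (f := fun c : C^o => c *: f m0 n0)); last by lin.
Qed.
End Inverse.

Variables gam gamb : {scalar (A ⊗ A)%type}.
Hypothesis HG : is_cocycle hA gam gamb.

Lemma twistK M N G coM coN (f : M -> N -> G) m n :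
  is_comodule hA coM -> is_comodule hA coN -> bilin f ->
  twist gamb coM coN (twist gam coM coN f) m n = f m n.
Proof. by apply: twist_inverse => a b; apply: (coc_invl HG). Qed.

Lemma twistKV M N G coM coN (f : M -> N -> G) m n :
  is_comodule hA coM -> is_comodule hA coN -> bilin f ->
  twist gam coM coN (twist gamb coM coN f) m n = f m n.
Proof. by apply: twist_inverse => a b; apply: (coc_invr HG). Qed.

Lemma twist_eq0 M N G coM coN (f : M -> N -> G) :
  is_comodule hA coM -> is_comodule hA coN -> bilin f ->
  (forall m n, twist gam coM coN f m n = 0) -> forall m n, f m n = 0.
Proof.
move=> cM cN bf f0 m n; rewrite -(twistK m n cM cN bf).
by rewrite -(twist0 gamb G coM coN m n); apply: eq_twist.
Qed.

Section Associativity.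
Variables (M N P Q Q' G : lmodType C).
Variables (coM : M -> (A ⊗ M)%type) (coN : N -> (A ⊗ N)%type).
Variables (coP : P -> (A ⊗ P)%type) (coQ : Q -> (A ⊗ Q)%type).
Variable coQ' : Q' -> (A ⊗ Q')%type.
Hypotheses (cM : is_comodule hA coM) (cN : is_comodule hA coN).
Hypotheses (cP : is_comodule hA coP) (lQ : linear coQ) (lQ' : linear coQ').
Variables (f : M -> N -> Q) (g : Q -> P -> G) (k : N -> P -> Q') (g' : M -> Q' -> G).
Hypotheses (bf : bilin f) (bg : bilin g) (bk : bilin k) (bg' : bilin g').
Hypotheses (cf : colinear2 coM coN coQ f) (ck : colinear2 coN coP coQ' k).

Let twist_left (r : {scalar (A ⊗ A)%type}) m n p : twist r coQ coP g (f m n) p =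
  \tsum_(x, m0 <- coM m) \tsum_(y, n0 <- coN n) \tsum_(z, p0 <- coP p)
    (r ((x ** y) ⊗ z) *: g (f m0 n0) p0).
Proof.
by rewrite /twist (colinear2_sum (h := fun u q => \tsum_(z, p0 <- coP p)
    (r (u ⊗ z) *: g q p0)) _ _ cf) //; lin.
Qed.

Let twist_right (r : {scalar (A ⊗ A)%type}) m n p : twist r coM coQ' g' m (k n p) =
  \tsum_(x, m0 <- coM m) \tsum_(y, n0 <- coN n) \tsum_(z, p0 <- coP p)
    (r (x ⊗ (y ** z)) *: g' m0 (k n0 p0)).
Proof.
apply: eq_tlift => x m0.
by rewrite (colinear2_sum (h := fun u q => r (x ⊗ u) *: g' m0 q) _ _ ck) //; lin.
Qed.

Let twist_twist_left r s m n p :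
  twist r coM coN (fun m n => twist s coQ coP g (f m n) p) m n =
  \tsum_(x, m0 <- coM m) \tsum_(y, n0 <- coN n) \tsum_(z, p0 <- coP p)
    ((\tsum_(x1, x2 <- hcop hA x) \tsum_(y1, y2 <- hcop hA y)
      (r (x1 ⊗ y1) * s ((x2 ** y2) ⊗ z) : C^o)) *: g (f m0 n0) p0).
Proof.
transitivity (\tsum_(x, m0 <- coM m) \tsum_(y, n0 <- coN n) \tsum_(x1, x2 <- hcop hA x)
    \tsum_(y1, y2 <- hcop hA y) \tsum_(z, p0 <- coP p)
     ((r (x1 ⊗ y1) * s ((x2 ** y2) ⊗ z)) *: g (f m0 n0) p0)).
  rewrite -(coassoc2 (F := fun x1 x2 y1 y2 m0 n0 => \tsum_(z, p0 <- coP p)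
     ((r (x1 ⊗ y1) * s ((x2 ** y2) ⊗ z)) *: g (f m0 n0) p0))) //; [ | by lin | by lin ].
  apply: eq_tlift => x1 m'; apply: eq_tlift => y1 n'; rewrite twist_left scale_tlift.
  apply: eq_tlift => x2 m0; rewrite scale_tlift; apply: eq_tlift => y2 n0.
  by rewrite scale_tlift; apply: eq_tlift => z p0; rewrite scalerA.
apply: eq_tlift => x m0; apply: eq_tlift => y n0.
transitivity (\tsum_(z, p0 <- coP p) \tsum_(x1, x2 <- hcop hA x)
    \tsum_(y1, y2 <- hcop hA y)
     ((r (x1 ⊗ y1) * s ((x2 ** y2) ⊗ z)) *: g (f m0 n0) p0)).
  rewrite [RHS]tlift_exchange; apply: eq_tlift => x1 x2; exact: tlift_exchange.
apply: eq_tlift => z p0.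
rewrite (lin_of_tlift (f := fun c : C^o => c *: g (f m0 n0) p0)); last by lin.
apply: eq_tlift => x1 x2.
by rewrite (lin_of_tlift (f := fun c : C^o => c *: g (f m0 n0) p0)); last by lin.
Qed.

Let twist_twist_right r s m n p :
  twist r coN coP (fun n p => twist s coM coQ' g' m (k n p)) n p =
  \tsum_(x, m0 <- coM m) \tsum_(y, n0 <- coN n) \tsum_(z, p0 <- coP p)
    ((\tsum_(y1, y2 <- hcop hA y) \tsum_(z1, z2 <- hcop hA z)
      (r (y1 ⊗ z1) * s (x ⊗ (y2 ** z2)) : C^o)) *: g' m0 (k n0 p0)).
Proof.
transitivity (\tsum_(y, n0 <- coN n) \tsum_(z, p0 <- coP p) \tsum_(y1, y2 <- hcop hA y)
    \tsum_(z1, z2 <- hcop hA z) \tsum_(x, m0 <- coM m)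
     ((r (y1 ⊗ z1) * s (x ⊗ (y2 ** z2))) *: g' m0 (k n0 p0))).
  rewrite -(coassoc2 (F := fun y1 y2 z1 z2 n0 p0 => \tsum_(x, m0 <- coM m)
     ((r (y1 ⊗ z1) * s (x ⊗ (y2 ** z2))) *: g' m0 (k n0 p0)))) //; [ | by lin | by lin ].
  apply: eq_tlift => y1 n'; apply: eq_tlift => z1 p'; rewrite twist_right scale_tlift.
  under eq_tlift => x m0 do rewrite scale_tlift.
  rewrite tlift_exchange; apply: eq_tlift => y2 n0.
  under eq_tlift => x m0 do rewrite scale_tlift.
  rewrite tlift_exchange; apply: eq_tlift => z2 p0.
  by apply: eq_tlift => x m0; rewrite scalerA.
transitivity (\tsum_(y, n0 <- coN n) \tsum_(z, p0 <- coP p) \tsum_(x, m0 <- coM m)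
   ((\tsum_(y1, y2 <- hcop hA y) \tsum_(z1, z2 <- hcop hA z)
      (r (y1 ⊗ z1) * s (x ⊗ (y2 ** z2)) : C^o)) *: g' m0 (k n0 p0))); last first.
  under eq_tlift => y n0 do rewrite tlift_exchange.
  by rewrite tlift_exchange.
apply: eq_tlift => y n0; apply: eq_tlift => z p0.
transitivity (\tsum_(x, m0 <- coM m) \tsum_(y1, y2 <- hcop hA y)
    \tsum_(z1, z2 <- hcop hA z)
     ((r (y1 ⊗ z1) * s (x ⊗ (y2 ** z2))) *: g' m0 (k n0 p0))).
  rewrite [RHS]tlift_exchange; apply: eq_tlift => y1 y2; exact: tlift_exchange.
apply: eq_tlift => x m0.
rewrite (lin_of_tlift (f := fun c : C^o => c *: g' m0 (k n0 p0))); last by lin.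
apply: eq_tlift => y1 y2.
by rewrite (lin_of_tlift (f := fun c : C^o => c *: g' m0 (k n0 p0))); last by lin.
Qed.

(** Both sides are sums of the same terms [g (f m_0 n_0) p_0], weighted by the two
    sides of the cocycle identity. *)
Lemma twist_assoc m n p : (forall m n p, g (f m n) p = g' m (k n p)) ->
  twist gam coQ coP g (twist gam coM coN f m n) p =
  twist gam coM coQ' g' m (twist gam coN coP k n p).
Proof.
move=> e; have bt := bilin_twist gam lQ (comod_linear cP) bg.
have bt' := bilin_twist gam (comod_linear cM) lQ' bg'.
rewrite (linear_twist gam coM coN f (h := fun q => twist gam coQ coP g q p)); last by lin.
rewrite (linear_twist gam coN coP k (h := twist gam coM coQ' g' m)); last by lin.
rewrite twist_twist_left twist_twist_right.
apply: eq_tlift => x m0; apply: eq_tlift => y n0; apply: eq_tlift => z p0.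
by rewrite e; congr (_ *: _); apply: (coc_cocycle HG).
Qed.

(** The same for the inverse cocycle, starting from the deformed identity; it makes
    the inverse of [phi] well defined. *)
Lemma twist_assoc_inverse m n p :
  (forall m n p, g (twist gam coM coN f m n) p = g' m (twist gam coN coP k n p)) ->
  twist gamb coQ coP g (f m n) p = twist gamb coM coQ' g' m (k n p).
Proof.
move=> e; have lM := comod_linear cM; have lN := comod_linear cN.
have lP := comod_linear cP.
have btf := bilin_twist gam lM lN bf; have btk := bilin_twist gam lN lP bk.
rewrite twist_left twist_right.
transitivity (\tsum_(x, m0 <- coM m) \tsum_(y, n0 <- coN n) \tsum_(z, p0 <- coP p)
  ((\tsum_(x1, x2 <- hcop hA x) \tsum_(y1, y2 <- hcop hA y)
    (gamb ((x1 ** y1) ⊗ z) * gamb (x2 ⊗ y2) : C^o)) *: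
   g (twist gam coM coN f m0 n0) p0)).
  under eq_tlift => x1 m' do rewrite tlift_exchange.
  under [RHS]eq_tlift => x1 m' do rewrite tlift_exchange.
  rewrite tlift_exchange [RHS]tlift_exchange; apply: eq_tlift => z p0.
  transitivity (\tsum_(x, m0 <- coM m) \tsum_(y, n0 <- coN n)
    \tsum_(x1, x2 <- hcop hA x) \tsum_(y1, y2 <- hcop hA y)
    ((gamb ((x1 ** y1) ⊗ z) * gamb (x2 ⊗ y2)) *:
     g (twist gam coM coN f m0 n0) p0)).
    rewrite -(coassoc2 (F := fun x1 x2 y1 y2 m0 n0 => (gamb ((x1 ** y1) ⊗ z) * gamb (x2 ⊗ y2)) *:
     g (twist gam coM coN f m0 n0) p0)) //; [ | by lin | by lin ].
    apply: eq_tlift => x1 m'; apply: eq_tlift => y1 n'.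
    rewrite -[f m' n'](twistK m' n' cM cN bf).
    rewrite (linear_twist gamb coM coN _ (h := fun q => g q p0)); last by lin.
    rewrite scale_tlift; apply: eq_tlift => x2 m0.
    by rewrite scale_tlift; apply: eq_tlift => y2 n0; rewrite scalerA.
  apply: eq_tlift => x m0; apply: eq_tlift => y n0.
  rewrite (lin_of_tlift (f := fun c : C^o => c *: g _ p0)); last by lin.
  apply: eq_tlift => x1 x2.
  by rewrite (lin_of_tlift (f := fun c : C^o => c *: g _ p0)); last by lin.
transitivity (\tsum_(x, m0 <- coM m) \tsum_(y, n0 <- coN n) \tsum_(z, p0 <- coP p)
  ((\tsum_(y1, y2 <- hcop hA y) \tsum_(z1, z2 <- hcop hA z)
    (gamb (x ⊗ (y1 ** z1)) * gamb (y2 ⊗ z2) : C^o)) *: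
   g' m0 (twist gam coN coP k n0 p0))).
  apply: eq_tlift => x m0; apply: eq_tlift => y n0; apply: eq_tlift => z p0.
  by rewrite e; congr (_ *: _); apply: (cocycle_inverse H HG).
apply: eq_tlift => x m0.
transitivity (\tsum_(y, n0 <- coN n) \tsum_(z, p0 <- coP p)
  \tsum_(y1, y2 <- hcop hA y) \tsum_(z1, z2 <- hcop hA z)
  ((gamb (x ⊗ (y1 ** z1)) * gamb (y2 ⊗ z2)) *:
   g' m0 (twist gam coN coP k n0 p0))).
  apply: eq_tlift => y n0; apply: eq_tlift => z p0.
  rewrite (lin_of_tlift (f := fun c : C^o => c *: g' m0 _)); last by lin.
  apply: eq_tlift => y1 y2.
  by rewrite (lin_of_tlift (f := fun c : C^o => c *: g' m0 _)); last by lin.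
rewrite -(coassoc2 (F := fun y1 y2 z1 z2 n0 p0 => (gamb (x ⊗ (y1 ** z1)) * gamb (y2 ⊗ z2)) *:
     g' m0 (twist gam coN coP k n0 p0))) //; [ | by lin | by lin ].
apply: eq_tlift => y1 n'; apply: eq_tlift => z1 p'.
rewrite -[k n' p'](twistK n' p' cN cP bk).
rewrite (linear_twist gamb coN coP _ (h := g' m0)); last by lin.
rewrite scale_tlift; apply: eq_tlift => y2 n0.
by rewrite scale_tlift; apply: eq_tlift => z2 p0; rewrite scalerA.
Qed.
End Associativity.

(** ** The twist of involutions *)

Hypothesis HU : is_unitary_cocycle hA gam gamb.
Local Notation v := (star_twist hA gamb).
Local Notation T := (inv_antipode hA).
Local Notation "x ^*h" := (hstar hA x) (at level 2, format "x ^*h").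
Let lT := inv_antipode_lin H.

(** A deformed involution is the original one after this shift. *)
Definition star_shift M (coM : M -> (A ⊗ M)%type) (m : M) : M :=
  \tsum_(x, m0 <- coM m) (v x *: m0).

Lemma star_shift_lin M (coM : M -> (A ⊗ M)%type) :
  linear coM -> linear (star_shift coM).
Proof. by move=> lM; rewrite /star_shift; lin. Qed.

Lemma star_shift_colinear M N (coM : M -> (A ⊗ M)%type) (coN : N -> (A ⊗ N)%type)
    (h : M -> N) m :
  linear h -> colinear coM coN h -> star_shift coN (h m) = h (star_shift coM m).
Proof.
move=> lh ch; rewrite /star_shift ch tlift_tlift; last by lin.
rewrite lin_of_tlift //; apply: eq_tlift => x m0.
by rewrite tlift_pure ?lin_of_scale //; lin.
Qed.

Lemma star_shift_coact M G (coM : M -> (A ⊗ M)%type) (h : A -> M -> G) m :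
  is_comodule hA coM -> bilin h ->
  \tsum_(x, m0 <- coM (star_shift coM m)) h x m0 =
  \tsum_(x, m0 <- coM m) \tsum_(x1, x2 <- hcop hA x) (v x1 *: h x2 m0).
Proof.
move=> cM bh; have lM := comod_linear cM.
rewrite (coassoc (f := fun x1 x2 m0 => v x1 *: h x2 m0) _ cM); last by lin.
rewrite /star_shift (lin_of_tlift (f := coM)) // tlift_tlift //.
apply: eq_tlift => x m0; rewrite (lin_of_scale lM).
by rewrite (lin_of_scale (f := tlift h)) ?scale_tlift //; lin.
Qed.

(** As [gamb (T y (x) T x)] is the conjugate of [gam (y^* (x) x^* )], this is the
    twist that conjugate-linear maps reversing the factors turn into [twist gam]. *)
Definition cotwist M N G (coM : M -> (A ⊗ M)%type) (coN : N -> (A ⊗ N)%type)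
    (f : M -> N -> G) (m : M) (n : N) : G :=
  \tsum_(x, m0 <- coM m) \tsum_(y, n0 <- coN n) (gamb (T y ⊗ T x) *: f m0 n0).

(** This is [star_twist_mul] applied to the coefficients of [m] and [n]. *)
Lemma star_shift_twist M N Q coM coN coQ (f : M -> N -> Q) m n :
  is_comodule hA coM -> is_comodule hA coN -> linear coQ -> bilin f ->
  colinear2 coM coN coQ f ->
  star_shift coQ (twist gam coM coN f m n) =
  cotwist coM coN f (star_shift coM m) (star_shift coN n).
Proof.
move=> cM cN lQ bf cf; have lM := comod_linear cM; have lN := comod_linear cN.
have lS := star_shift_lin lQ.
rewrite (linear_twist gam coM coN f (h := star_shift coQ)) //.
rewrite /cotwist (star_shift_coact (h := fun x m0 => \tsum_(y, n0 <- coN (star_shift coN n))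
  (gamb (T y ⊗ T x) *: f m0 n0))) //; last by lin.
transitivity (\tsum_(x, m0 <- coM m) \tsum_(y, n0 <- coN n) \tsum_(x1, x2 <- hcop hA x)
    \tsum_(y1, y2 <- hcop hA y) ((gam (x1 ⊗ y1) * v (x2 ** y2)) *: f m0 n0)).
  rewrite -(coassoc2 (F := fun x1 x2 y1 y2 m0 n0 => (gam (x1 ⊗ y1) * v (x2 ** y2)) *: f m0 n0)) //;
    [ | by lin | by lin ].
  apply: eq_tlift => x1 m'; apply: eq_tlift => y1 n'.
  rewrite /star_shift (colinear2_sum (h := fun u q => v u *: q) _ _ cf); last by lin.
  rewrite scale_tlift; apply: eq_tlift => x2 m0.
  by rewrite scale_tlift; apply: eq_tlift => y2 n0; rewrite scalerA.
apply: eq_tlift => x m0.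
transitivity (\tsum_(y, n0 <- coN n) 
  ((\tsum_(x1, x2 <- hcop hA x) \tsum_(y1, y2 <- hcop hA y)
    (gam (x1 ⊗ y1) * v (x2 ** y2) : C^o)) *: f m0 n0)).
  apply: eq_tlift => y n0; symmetry.
  rewrite (lin_of_tlift (f := fun c : C^o => c *: f m0 n0)); last by lin.
  apply: eq_tlift => x1 x2.
  by rewrite (lin_of_tlift (f := fun c : C^o => c *: f m0 n0)); last by lin.
under eq_tlift => y n0 do rewrite (star_twist_mul H HG HU).
under [RHS]eq_tlift => x1 x2.
  rewrite (star_shift_coact (h := fun y n0 => gamb (T y ⊗ T x2) *: f m0 n0)) //; last by lin.
  rewrite scale_tlift.
  under eq_tlift => y n0 do rewrite scale_tlift.
  over.
rewrite [RHS]tlift_exchange; apply: eq_tlift => y n0.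
rewrite (lin_of_tlift (f := fun c : C^o => c *: f m0 n0)); last by lin.
under eq_tlift => y1 y2 do
  [rewrite (lin_of_tlift (f := fun c : C^o => c *: f m0 n0)); last by lin].
rewrite tlift_exchange; apply: eq_tlift => x1 x2; apply: eq_tlift => y1 y2.
by rewrite !scalerA; congr (_ *: _); ring.
Qed.

Definition star_colinear M N (coM : M -> (A ⊗ M)%type) (coN : N -> (A ⊗ N)%type)
    (s : M -> N) : Prop :=
  forall m, coN (s m) = \tsum_(x, m0 <- coM m) (x^*h ⊗ s m0).

Lemma antilinear_cotwist M M' N N' Q G coM coM' coN coN'
    (sM : M -> M') (sN : N -> N') (f : M -> N -> Q) (f' : N' -> M' -> G)
    (h : Q -> G) m n :
  linear coM' -> star_colinear coM coM' sM -> star_colinear coN coN' sN ->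
  antilinear h -> bilin f' -> (forall m n, h (f m n) = f' (sN n) (sM m)) ->
  h (cotwist coM coN f m n) = twist gam coN' coM' f' (sN n) (sM m).
Proof.
move=> lM' hM hN ah bf' e; rewrite /cotwist /twist hN tlift_tlift; last by lin.
rewrite antilinear_tlift //; under eq_tlift => x m0 do rewrite antilinear_tlift //.
rewrite tlift_exchange; apply: eq_tlift => y n0.
rewrite tlift_pure; last by lin.
rewrite hM tlift_tlift; last by lin.
apply: eq_tlift => x m0; rewrite tlift_pure; last by lin.
by rewrite antilinear_scale // e -(conj_cocycle_star H HU) conjCK.
Qed.

(** A preimage is the shift of [m] by the convolution inverse of [star_twist]. *)
Lemma star_shift_surj M (coM : M -> (A ⊗ M)%type) m : is_comodule hA coM ->
  exists m', star_shift coM m' = m.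
Proof.
move=> cM; have lM := comod_linear cM; have lVb := coc_Vb_lin gamb H.
exists (\tsum_(x, m0 <- coM m) (coc_Vb hA gamb x *: m0)).
rewrite (lin_of_tlift _ _ (star_shift_lin lM)).
transitivity (\tsum_(x1, r <- coM m) \tsum_(x2, m0 <- coM r)
  ((coc_Vb hA gamb x1 * v x2) *: m0)).
  apply: eq_tlift => x m0; rewrite (lin_of_scale (star_shift_lin lM)).
  by rewrite scale_tlift; apply: eq_tlift => y n0; rewrite scalerA.
rewrite -(coassoc (f := fun x1 x2 m0 => (coc_Vb hA gamb x1 * v x2) *: m0) _ cM); last by lin.
rewrite -[RHS](comod_counit cM); apply: eq_tlift => x m0.
rewrite -(coc_Vb_star_twist H HG HU) (lin_of_tlift (f := fun c : C^o => c *: m0)) //; lin.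
Qed.

Lemma star_shift_involutive M (coM : M -> (A ⊗ M)%type) (s : M -> M) m :
  is_comodule hA coM -> antilinear s -> involutive s -> star_colinear coM coM s ->
  s (star_shift coM (s (star_shift coM m))) = m.
Proof.
move=> cM sa sK cs; have lM := comod_linear cM; have lVb := coc_Vb_lin gamb H.
have las : linear (fun m => s (star_shift coM (s m))).
  by move=> c x y; rewrite sa (star_shift_lin lM) sa conjCK.
rewrite {2}/star_shift (lin_of_tlift _ _ las).
transitivity (\tsum_(x1, r <- coM m) \tsum_(x2, m0 <- coM r)
  ((v x1 * coc_Vb hA gamb x2) *: m0)).
  apply: eq_tlift => x m0; rewrite (lin_of_scale las) /star_shift cs.
  rewrite tlift_tlift; last by lin.
  rewrite antilinear_tlift // scale_tlift; apply: eq_tlift => y n0.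
  rewrite tlift_pure; last by lin.
  by rewrite antilinear_scale // sK scalerA /v (hstarK H) conjCK.
rewrite -(coassoc (f := fun x1 x2 m0 => (v x1 * coc_Vb hA gamb x2) *: m0) _ cM); last by lin.
rewrite -[RHS](comod_counit cM); apply: eq_tlift => x m0.
rewrite -(star_twist_coc_Vb H HG HU) (lin_of_tlift (f := fun c : C^o => c *: m0)) //; lin.
Qed.
End Twist.

(** * Relative Hopf bimodules and their tensor products *)

Section BimoduleFacts.
Variables (C : numClosedFieldType) (A B : lmodType C) (hA : hopf_ops A).
Variable hB : comodalg_ops A B.

Lemma lact_linl M (mM : bimod_ops A B M) m :
  is_bimod hA hB mM -> linear ((lact mM)^~ m).
Proof. by move=> bM; apply: (lmod_linl (bimod_left bM)). Qed.

Lemma lact_linr M (mM : bimod_ops A B M) b :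
  is_bimod hA hB mM -> linear (lact mM b).
Proof. by move=> bM; apply: (lmod_linr (bimod_left bM)). Qed.

Lemma ract_linl M (mM : bimod_ops A B M) b :
  is_bimod hA hB mM -> linear ((ract mM)^~ b).
Proof. by move=> bM; apply: (rmod_linl (bimod_right bM)). Qed.

Lemma ract_linr M (mM : bimod_ops A B M) m :
  is_bimod hA hB mM -> linear (ract mM m).
Proof. by move=> bM; apply: (rmod_linr (bimod_right bM)). Qed.

Lemma coact_lin M (mM : bimod_ops A B M) :
  is_bimod hA hB mM -> linear (coact mM).
Proof. by move=> bM; apply: (comod_linear (bimod_comod bM)). Qed.

Lemma bmul_linl b : is_comodule_algebra hA hB -> linear ((bmul hB)^~ b).
Proof. by move=> ca; apply: (alg_linl (ca_alg ca)). Qed.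

Lemma bmul_linr b : is_comodule_algebra hA hB -> linear (bmul hB b).
Proof. by move=> ca; apply: (alg_linr (ca_alg ca)). Qed.

Lemma bcoact_lin : is_comodule_algebra hA hB -> linear (bcoact hB).
Proof. by move=> ca; apply: (comod_linear (ca_comod ca)). Qed.

End BimoduleFacts.

#[global] Hint Extern 1 (GRing.linear_for _ _) =>
  (first [ apply: lact_linl | apply: lact_linr | apply: ract_linl
         | apply: ract_linr | apply: coact_lin | apply: bmul_linl
         | apply: bmul_linr | apply: bcoact_lin ]; eassumption) : lin.

Section TensorOverB.
Variables (C : numClosedFieldType) (A B : lmodType C) (hA : hopf_ops A).
Variable hB : comodalg_ops A B.
Hypothesis H : is_hopf_star_algebra hA.
Hypothesis caB : is_comodule_algebra hA hB.
Local Notation "x ** y" := (hmul hA x y) (at level 40, left associativity).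
Local Notation coB := (bcoact hB).
Let cB := ca_comod caB.

Section OneModule.
Variables (M : lmodType C) (mM : bimod_ops A B M).
Hypothesis bM : is_bimod hA hB mM.

Lemma bilin_lact : bilin (lact mM).
Proof. by lin. Qed.

Lemma bilin_ract : bilin (ract mM).
Proof. by lin. Qed.

Lemma lact_colinear : colinear2 hA coB (coact mM) (coact mM) (lact mM).
Proof.
move=> b m; rewrite -[lact mM b m in LHS](rmod_1 (bimod_right bM)) (bimod_coact bM).
apply: eq_tlift => x b0; apply: eq_tlift => y m0.
rewrite (ca_coact1 caB) tlift_pure; last by lin.
by rewrite (alg_1r (hopf_alg H)) (rmod_1 (bimod_right bM)).
Qed.

Lemma ract_colinear : colinear2 hA (coact mM) coB (coact mM) (ract mM).
Proof.
move=> m b; rewrite -[m in LHS](lmod_1 (bimod_left bM)) (bimod_coact bM).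
rewrite (ca_coact1 caB) tlift_pure; last by lin.
apply: eq_tlift => y m0; apply: eq_tlift => z b0.
by rewrite (alg_1l (hopf_alg H)) (lmod_1 (bimod_left bM)).
Qed.

End OneModule.

Lemma bmul_bilin : bilin (bmul hB).
Proof. by lin. Qed.

Lemma bmul_colinear : colinear2 hA coB coB coB (bmul hB).
Proof. exact: (ca_coactM caB). Qed.

Section TwoModules.
Variables (M N : lmodType C) (mM : bimod_ops A B M) (mN : bimod_ops A B N).
Hypotheses (bM : is_bimod hA hB mM) (bN : is_bimod hA hB mN).
Local Notation coM := (coact mM).
Local Notation coN := (coact mN).
Local Notation MN := (tensB mM mN).
Let cM := bimod_comod bM.
Let cN := bimod_comod bN.

Let coact_pair (m : M) (n : N) : (A ⊗ MN)%type :=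
  \tsum_(x, m0 <- coM m) \tsum_(y, n0 <- coN n) ((x ** y) ⊗ (m0 ⊗ n0)).

Let coact_pair_balanced : balanced (ract mM) (lact mN) coact_pair.
Proof.
split; [by rewrite /coact_pair; lin | by rewrite /coact_pair; lin |].
move=> m b n; rewrite /coact_pair.
rewrite (colinear2_sum (h := fun x m0 => \tsum_(y, n0 <- coN n) ((x ** y) ⊗ (m0 ⊗ n0 : MN))) _ _ (ract_colinear bM)); last by lin.
apply: eq_tlift => x m0.
rewrite (colinear2_sum (h := fun y n0 => (x ** y) ⊗ (m0 ⊗ n0 : MN)) _ _ (lact_colinear bN)); last by lin.
apply: eq_tlift => z b0; apply: eq_tlift => y n0.
by rewrite tpure_bal (alg_assoc (hopf_alg H)).
Qed.

Lemma tensB_coact_lin : linear (coact (tensB_ops hA mM mN)).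
Proof. exact: (tliftP coact_pair_balanced). Qed.

Lemma tensB_colinear : colinear2 hA coM coN (coact (tensB_ops hA mM mN)) tpure.
Proof. by move=> m n; rewrite /= tlift_tpure //; apply: coact_pair_balanced. Qed.

Let lact_pair_balanced b :
  balanced (ract mM) (lact mN) (fun m n => lact mM b m ⊗ n : MN).
Proof.
split; [by lin | by lin |] => m k n.
by rewrite -(bimod_assoc bM) tpure_bal.
Qed.

Lemma tensB_lact_bilin : bilin (lact (tensB_ops hA mM mN)).
Proof.
split=> [t|b]; last exact: (tliftP (lact_pair_balanced b)).
by rewrite /=; lin.
Qed.

Lemma tensB_lact_pure b m n :
  lact (tensB_ops hA mM mN) b (m ⊗ n) = lact mM b m ⊗ n.
Proof. by rewrite /= tlift_tpure. Qed.

Variables gam gamb : {scalar (A ⊗ A)%type}.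
Hypothesis HG : is_cocycle hA gam gamb.
Local Notation gM := (deform_bimod gam hB mM).
Local Notation gN := (deform_bimod gam hB mN).
Local Notation MNg := (tensB gM gN).

(** The two sides are the twists of [(m b) (x) n = m (x) (b n)]. *)
Lemma phi_balanced : balanced (ract gM) (lact gN)
  (twist gam coM coN (tpure : M -> N -> MN)).
Proof.
have bt : bilin (tpure : M -> N -> MN) by lin.
have [bl br] := bilin_twist gam (comod_linear cM) (comod_linear cN) bt.
split=> // m b n.
apply: (twist_assoc H HG cM cB cN (comod_linear cM) (comod_linear cN)
  (bilin_ract bM) bt (bilin_lact bN) bt (ract_colinear bM) (lact_colinear bN)).
by move=> *; apply: tpure_bal.
Qed.

Lemma phi_lin : linear (phi gam hB mM mN).
Proof. exact: (tliftP phi_balanced). Qed.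

Lemma phi_pure m n : phi gam hB mM mN (m ⊗ n) = twist gam coM coN tpure m n.
Proof. by rewrite /phi tlift_tpure //; apply: phi_balanced. Qed.

Let psi (t : MN) : MNg := tlift (twist gamb coM coN tpure) t.

Let psi_balanced : balanced (ract mM) (lact mN)
  (twist gamb coM coN (tpure : M -> N -> MNg)).
Proof.
have bt : bilin (tpure : M -> N -> MNg) by lin.
have [bl br] := bilin_twist gamb (comod_linear cM) (comod_linear cN) bt.
split=> // m b n.
apply: (twist_assoc_inverse H HG cM cB cN
  (bilin_ract bM) bt (bilin_lact bN) bt (ract_colinear bM) (lact_colinear bN)).
by move=> *; apply: tpure_bal.
Qed.

Let psi_lin : linear psi.
Proof. exact: (tliftP psi_balanced). Qed.

Let phiK : cancel (phi gam hB mM mN) psi.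
Proof.
apply: tens_linear_ext => [||m n]; [ | exact: lin_id | ].
  by have := phi_lin; have := psi_lin; lin.
rewrite phi_pure (linear_twist gam coM coN _ _ _ psi_lin).
transitivity (twist gam coM coN (twist gamb coM coN (tpure : M -> N -> MNg)) m n).
  by apply: eq_twist => m' n'; rewrite /psi tlift_tpure //; apply: psi_balanced.
by rewrite (twistKV HG) //; lin.
Qed.

Let psiK : cancel psi (phi gam hB mM mN).
Proof.
apply: tens_linear_ext => [||m n]; [ | exact: lin_id | ].
  by have := phi_lin; have := psi_lin; lin.
rewrite /psi tlift_tpure; last exact: psi_balanced.
rewrite (linear_twist gamb coM coN _ _ _ phi_lin).
transitivity (twist gamb coM coN (twist gam coM coN (tpure : M -> N -> MN)) m n).
  by apply: eq_twist => m' n'; rewrite phi_pure.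
by rewrite (twistK HG) //; lin.
Qed.

Lemma phi_invK : cancel (phi_inv gam hB mM mN) (phi gam hB mM mN).
Proof.
move=> t; rewrite /phi_inv /inverse; case: xgetP => [x _ //|/(_ (psi t))].
by rewrite /= psiK.
Qed.

Lemma phiVK : cancel (phi gam hB mM mN) (phi_inv gam hB mM mN).
Proof. by move=> t; apply: (can_inj phiK); rewrite phi_invK. Qed.

Lemma phi_inv_lin : linear (phi_inv gam hB mM mN).
Proof. by move=> c x y; apply: (can_inj phiK); rewrite phi_lin !phi_invK. Qed.

(** Functions on pairs that factor through [phi] are automatically balanced for
    the deformed actions; all sums over deformed tensors are evaluated this way. *)
Lemma factor_phi_balanced (G : lmodType C) (F : M -> N -> G) (K : MN -> G) :
  linear K -> (forall m n, F m n = K (twist gam coM coN tpure m n)) ->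
  balanced (ract gM) (lact gN) F.
Proof.
move=> lK e; have [pl pr pb] := phi_balanced; split=> [n|m|m b n].
- by move=> c x y; rewrite !e pl lK.
- by move=> c x y; rewrite !e pr lK.
- by rewrite !e pb.
Qed.

Lemma tlift_factor_phi (G : lmodType C) (F : M -> N -> G) (K : MN -> G) (t : MNg) :
  linear K -> (forall m n, F m n = K (twist gam coM coN tpure m n)) ->
  tlift F t = K (phi gam hB mM mN t).
Proof.
move=> lK e; have bF := factor_phi_balanced lK e; have lphi := phi_lin.
apply: (tens_linear_ext (f := tlift F) (g := fun t => K (phi gam hB mM mN t))).
- exact: tliftP.
- exact: lin_comp.
- by move=> m n; rewrite tlift_tpure // e phi_pure.
Qed.

End TwoModules.
End TensorOverB.

(** * Graded calculi *)

Lemma colinear_comp (C : numClosedFieldType) (A U V W : lmodType C)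
    (coU : U -> (A ⊗ U)%type) (coV : V -> (A ⊗ V)%type) (coW : W -> (A ⊗ W)%type)
    (f : V -> W) (g : U -> V) :
  linear f -> colinear coV coW f -> colinear coU coV g ->
  colinear coU coW (fun u => f (g u)).
Proof.
move=> lf cf cg u; rewrite cf cg tlift_tlift; last by lin.
by apply: eq_tlift => x y; rewrite tlift_pure //; lin.
Qed.

Section Grading.
Variables (C : numClosedFieldType) (A B Om : lmodType C) (hA : hopf_ops A).
Variables (hB : comodalg_ops A B) (I : eqType) (F : I -> lmodType C).
Variables (G : grading A B Om F) (alg : comodalg_ops A Om) (base : B -> Om).
Hypothesis gG : is_grading hA hB G alg base.

Lemma decomposes_proj w f i : decomposes G w f -> proj G i w = f i.
Proof.
move=> df; rewrite /proj; case: xgetP => [x -> [f' df' ->]|/(_ (f i))].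
  have [g [_ gu]] := grad_direct gG w.
  by rewrite -(gu _ df) -(gu _ df').
by case; exists f.
Qed.

Lemma decomposes_ex w : exists f, decomposes G w f.
Proof. by have [f [df _]] := grad_direct gG w; exists f. Qed.

Lemma ginj0 i : ginj G (0 : F i) = 0.
Proof. exact: (lin_of_0 (grad_linear gG (i := i))). Qed.

Let sum_supp (f : forall i, F i) s u : uniq s -> uniq u -> {subset s <= u} ->
  (forall i, i \notin s -> f i = 0) ->
  \sum_(i <- s) ginj G (f i) = \sum_(i <- u) ginj G (f i).
Proof.
move=> us uu su f0; rewrite [RHS](bigID (mem s)) /= [X in _ + X]big1 ?addr0; last first.
  by move=> i /f0 ->; rewrite ginj0.
rewrite -[RHS]big_filter; apply: perm_big; apply: uniq_perm => //.
  exact: filter_uniq.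
by move=> i; rewrite mem_filter; case si: (i \in s) => //=; rewrite su.
Qed.

Lemma proj_linear i : linear (proj G i).
Proof.
move=> c w w'; have [f df] := decomposes_ex w; have [f' df'] := decomposes_ex w'.
rewrite (decomposes_proj i df) (decomposes_proj i df').
apply: (decomposes_proj (f := fun i => c *: f i + f' i)).
have [s [us f0 ->]] := df; have [s' [us' f0' ->]] := df'.
have ss : {subset s <= undup (s ++ s')}.
  by move=> j js; rewrite mem_undup mem_cat js.
have ss' : {subset s' <= undup (s ++ s')}.
  by move=> j js; rewrite mem_undup mem_cat js orbT.
exists (undup (s ++ s')); split; first exact: undup_uniq.
  move=> j; rewrite mem_undup mem_cat negb_or => /andP[js js'].
  by rewrite f0 // f0' // scaler0 addr0.
rewrite (sum_supp us (undup_uniq _) ss f0) (sum_supp us' (undup_uniq _) ss' f0').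
rewrite scaler_sumr -big_split; apply: eq_bigr => j _.
by rewrite (grad_linear gG).
Qed.

Let only i (x : F i) : forall j, F j := dfwith (fun j => 0 : F j) x.

Lemma ginj_decomposes i (x : F i) : decomposes G (ginj G x) (only x).
Proof.
exists [:: i]; split=> // [j|]; last by rewrite big_seq1 /only dfwith_in.
by rewrite inE => ij; rewrite /only dfwith_out // eq_sym.
Qed.

Lemma ginjK i : cancel (@ginj _ _ _ _ _ _ G i) (proj G i).
Proof. by move=> x; rewrite (decomposes_proj _ (ginj_decomposes x)) /only dfwith_in. Qed.

Lemma proj_ginj_neq i j (x : F j) : j != i -> proj G i (ginj G x) = 0.
Proof.
by move=> ji; rewrite (decomposes_proj _ (ginj_decomposes x)) /only dfwith_out.
Qed.

Lemma grading_ext (W : lmodType C) (f g : Om -> W) : linear f -> linear g ->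
  (forall i (x : F i), f (ginj G x) = g (ginj G x)) -> forall w, f w = g w.
Proof.
move=> lf lg fg w; have [h [s [_ _ ->]]] := decomposes_ex w.
by rewrite !lin_of_sum //; apply: eq_bigr => i _.
Qed.

(** It suffices to look at homogeneous elements, on which the inclusions of the
    components are colinear. *)
Lemma proj_colinear i : linear (bcoact alg) ->
  colinear (bcoact alg) (coact (gops G i)) (proj G i).
Proof.
move=> lco; have lp := proj_linear i.
have lci := coact_lin (grad_bimod gG i).
apply: grading_ext => [||j x]; [by lin | by lin |].
rewrite (grad_colinear gG) tlift_tlift; last by lin.
have [ji|ji] := eqVneq j i.
  subst j; rewrite ginjK -[LHS]tlift_id; apply: eq_tlift => a y.
  by rewrite tlift_pure ?ginjK //; lin.
rewrite proj_ginj_neq // (lin_of_0 lci); symmetry.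
transitivity (\tsum_(a, y <- coact (gops G j) x) (0 : (A ⊗ F i)%type)).
  apply: eq_tlift => a y; rewrite tlift_pure; last by lin.
  by rewrite proj_ginj_neq // (lin_of_0 (tpure_linr _ _ _)).
by rewrite /tlift big1.
Qed.

Lemma proj_ract i w b : bilin (bmul alg) ->
  proj G i (bmul alg w (base b)) = ract (gops G i) (proj G i w) b.
Proof.
move=> balg; have lp := proj_linear i; have bi := grad_bimod gG i.
apply: (grading_ext (f := fun w => proj G i (bmul alg w (base b)))
  (g := fun w => ract (gops G i) (proj G i w) b)) => [||j x];
  [by lin | by lin |].
rewrite -(grad_ract gG); have [ji|ji] := eqVneq j i.
  by subst j; rewrite !ginjK.
rewrite !proj_ginj_neq // (lin_of_0 (f := (ract (gops G i))^~ b)) //.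
exact: (ract_linl _ bi).
Qed.

End Grading.

Section StarColinear.
Variables (C : numClosedFieldType) (A : lmodType C) (hA : hopf_ops A).
Hypothesis H : is_hopf_star_algebra hA.
Implicit Types M N P G : lmodType C.

Lemma colinear_sum M N G (coM : M -> (A ⊗ M)%type) (coN : N -> (A ⊗ N)%type) (h : M -> N) (f : A -> N -> G) m :
  colinear coM coN h -> bilin f ->
  \tsum_(x, n0 <- coN (h m)) f x n0 = \tsum_(x, m0 <- coM m) f x (h m0).
Proof.
move=> ch bf; rewrite ch tlift_tlift //; apply: eq_tlift => x m0.
by rewrite tlift_pure.
Qed.

Lemma star_tensor_bilin M N (s : M -> N) : antilinear s ->
  bilin ((fun x m => hstar hA x ⊗ s m) : A -> M -> conj_space (A ⊗ N)%type).
Proof.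
move=> sa; split=> [m|x] c y z.
  by rewrite (star_antilinear (hopf_star H)) (tpure_linl _ _ (s m)).
by rewrite sa (tpure_linr _ _ (hstar hA x)).
Qed.

Lemma star_colinear_sum M N G (coM : M -> (A ⊗ M)%type)
    (coN : N -> (A ⊗ N)%type) (s : M -> N) (f : A -> N -> G) m :
  star_colinear hA coM coN s -> bilin f ->
  \tsum_(x, n0 <- coN (s m)) f x n0 = \tsum_(x, m0 <- coM m) f (hstar hA x) (s m0).
Proof.
move=> cs bf; rewrite cs tlift_tlift //; apply: eq_tlift => x m0.
by rewrite tlift_pure.
Qed.

Lemma star_colinear_compl M N P (coM : M -> (A ⊗ M)%type) (coN : N -> (A ⊗ N)%type)
    (coP : P -> (A ⊗ P)%type) (h : N -> P) (s : M -> N) :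
  linear h -> colinear coN coP h -> star_colinear hA coM coN s ->
  star_colinear hA coM coP (fun m => h (s m)).
Proof.
by move=> lh ch cs m; rewrite ch (star_colinear_sum _ cs) //; lin.
Qed.

Lemma star_colinear_compr M N P (coM : M -> (A ⊗ M)%type) (coN : N -> (A ⊗ N)%type)
    (coP : P -> (A ⊗ P)%type) (s : N -> P) (h : M -> N) :
  antilinear s -> star_colinear hA coN coP s -> colinear coM coN h ->
  star_colinear hA coM coP (fun m => s (h m)).
Proof.
move=> sa cs ch m; rewrite cs.
exact: (colinear_sum (G := conj_space (A ⊗ P)%type) m ch (star_tensor_bilin sa)).
Qed.

End StarColinear.

Section Calculus.
Variables (C : numClosedFieldType) (A B Om : lmodType C) (hA : hopf_ops A).
Variables (hB : comodalg_ops A B) (F : nat -> lmodType C).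
Variables (O : calculus_ops A B Om F).
Hypothesis H : is_hopf_star_algebra hA.
Hypothesis sB : is_comodule_star_algebra hA hB.
Hypothesis HO : is_star_calculus hA hB O.
Let caB := csa_ca sB.
Let caO := calc_alg HO.
Let gF := calc_grading HO.
Local Notation F1 := (F 1%N).
Local Notation mF1 := (gops (cgrad O) 1%N).
Local Notation inj1 := (@ginj _ _ _ _ _ _ (cgrad O) 1%N).

Lemma form1_bimod : is_bimod hA hB mF1.
Proof. exact: (grad_bimod gF). Qed.

Lemma d_fun_lin : linear (d_fun O).
Proof.
have lp := proj_linear gF 1%N; have ld := calc_d_linear HO.
by have lb := calc_base_linear HO; rewrite /d_fun; lin.
Qed.

Lemma d_fun_colinear : colinear (bcoact hB) (coact mF1) (d_fun O).
Proof.
have lp := proj_linear gF 1%N; have ld := calc_d_linear HO.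
have lb := calc_base_linear HO.
apply: (colinear_comp lp (proj_colinear gF 1%N (bcoact_lin caO))).
exact: (colinear_comp ld (calc_d_colinear HO) (calc_base_colinear HO)).
Qed.

Lemma ginj_star_form w : inj1 (star_form O w) = bstar (calg O) (inj1 w).
Proof.
by have [y e] := calc_star_deg HO w; rewrite /star_form e (ginjK gF).
Qed.

Let inj1_inj : injective inj1 := can_inj (ginjK gF (i := 1%N)).
Let inj1_lin : linear inj1 := grad_linear gF (i := 1%N).

Lemma star_form_antilinear : antilinear (star_form O).
Proof.
move=> c x y; apply: inj1_inj; rewrite ginj_star_form !inj1_lin.
by rewrite (calc_star_antilinear HO) !ginj_star_form.
Qed.

Lemma star_formK : involutive (star_form O).
Proof.
by move=> x; apply: inj1_inj; rewrite !ginj_star_form (calc_star_involutive HO).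
Qed.

Lemma star_form_colinear : star_colinear hA (coact mF1) (coact mF1) (star_form O).
Proof.
have lp := proj_linear gF 1%N; have sO := calc_star_antilinear HO.
apply: (star_colinear_compl lp (proj_colinear gF 1%N (bcoact_lin caO))).
exact: (star_colinear_compr H sO (calc_coact_star HO) (grad_colinear gF (i := 1%N))).
Qed.

Lemma star_form_ract w b :
  star_form O (ract mF1 w b) = lact mF1 (bstar hB b) (star_form O w).
Proof.
apply: inj1_inj; rewrite ginj_star_form (grad_ract gF) (grad_lact gF) ginj_star_form.
have [x _ ex] : range (@ginj _ _ _ _ _ _ (cgrad O) 0%N) (cbase O b).
  by rewrite -(calc_base_range HO); exists b.
by rewrite -ex (calc_star_mul HO) muln0 expr0 scale1r ex (calc_star_base HO).
Qed.

End Calculus.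

Lemma cbar_antilinear (C : numClosedFieldType) (E : lmodType C) :
  antilinear (@cbar C E).
Proof.
move=> c x y; congr (_ + _).
by rewrite /GRing.scale /= /conj_scale /cbar /uncbar conjCK.
Qed.

(** ** Deformed involutions *)

Section DeformedStar.
Variables (C : numClosedFieldType) (A B : lmodType C) (hA : hopf_ops A).
Variables gam gamb : {scalar (A ⊗ A)%type}.

Lemma deform_bstar (hB : comodalg_ops A B) b : antilinear (bstar hB) ->
  bstar (deform_comodalg hA gam gamb hB) b =
  bstar hB (star_shift hA gamb (bcoact hB) b).
Proof.
move=> sa; rewrite /star_shift antilinear_tlift //; apply: eq_tlift => x b0.
by rewrite antilinear_scale // conjCK.
Qed.

Lemma frakN_star_shift (E : lmodType C) (mE : bimod_ops A B E) e :
  frakN hA gamb mE e = cbar (star_shift hA gamb (coact mE) (uncbar e)).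
Proof.
rewrite /star_shift (antilinear_tlift (f := @cbar C E)); last exact: cbar_antilinear.
apply: eq_tlift => x e0.
by rewrite (antilinear_scale (f := @cbar C E) (@cbar_antilinear C E)) conjCK.
Qed.

End DeformedStar.

(** * Conjugate bimodules and Hermitian metrics *)

Section Conjugate.
Variables (C : numClosedFieldType) (A B : lmodType C) (hA : hopf_ops A).
Variable hB : comodalg_ops A B.
Hypothesis H : is_hopf_star_algebra hA.
Local Notation "x ** y" := (hmul hA x y) (at level 40, left associativity).

Lemma conj_coact_lin (M : lmodType C) (mM : bimod_ops A B M) :
  linear (coact mM) -> linear (coact (conj_ops hA hB mM)).
Proof.
move=> lM c x y; have lt := lin_tlift (star_tensor_bilin H (@cbar_antilinear C M)).
have e : uncbar (c *: x + y) = c^* *: uncbar x + uncbar y by [].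
rewrite /= e lM lt; congr (_ + _).
by rewrite /GRing.scale /= /conj_scale /cbar /uncbar conjCK.
Qed.

Lemma conj_coact_comodule (M : lmodType C) (mM : bimod_ops A B M) :
  is_comodule hA (coact mM) -> is_comodule hA (coact (conj_ops hA hB mM)).
Proof.
move=> cM; have lM := comod_linear cM; have lc := conj_coact_lin lM.
have sc : star_colinear hA (coact mM) (coact (conj_ops hA hB mM)) (@cbar C M) by [].
split=> // v.
- rewrite -[v]/(cbar (uncbar v)).
  rewrite (star_colinear_sum (f := fun x v0 => \tsum_(a1, a2 <- hcop hA x)
    (a1 ⊗ (a2 ⊗ v0) : (A ⊗ (A ⊗ conj_space M))%type)) _ sc); last by lin.
  rewrite (star_colinear_sum (f := fun a1 x => \tsum_(a2, v0 <- coact (conj_ops hA hB mM) x)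
    (a1 ⊗ (a2 ⊗ v0) : (A ⊗ (A ⊗ conj_space M))%type)) _ sc); last by lin.
  under eq_tlift => x v0.
    rewrite (star_cop H (f := fun a1 a2 => 
      (a1 ⊗ (a2 ⊗ cbar v0) : (A ⊗ (A ⊗ conj_space M))%type))); last by lin.
    over.
  under [RHS]eq_tlift => x v0.
    rewrite (star_colinear_sum (f := fun a2 v0 =>
      (hstar hA x ⊗ (a2 ⊗ v0) : (A ⊗ (A ⊗ conj_space M))%type)) _ sc); last by lin.
    over.
  apply: (coassoc (G := conj_space (A ⊗ (A ⊗ conj_space M))%type)
    (f := fun a1 a2 v0 => hstar hA a1 ⊗ (hstar hA a2 ⊗ cbar v0)) _ cM).
  have sa := star_antilinear (hopf_star H).
  split=> [a2 m c x y|a1 m c x y|a1 a2 c x y].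
  + by rewrite sa (tpure_linl _ _ (hstar hA a2 ⊗ cbar m)).
  + by rewrite sa (tpure_linl _ _ (cbar m)) (tpure_linr _ _ (hstar hA a1)).
  + by rewrite (@cbar_antilinear C M) (tpure_linr _ _ (hstar hA a2)) (tpure_linr _ _ (hstar hA a1)).
- rewrite -[v]/(cbar (uncbar v)).
  have lcou := hcou_lin H.
  rewrite (star_colinear_sum (f := fun x v0 => hcou hA x *: v0) _ sc); last by lin.
  rewrite -[in RHS](comod_counit cM (uncbar v)).
  rewrite (antilinear_tlift (f := @cbar C M)); last exact: cbar_antilinear.
  apply: eq_tlift => x m.
  by rewrite (star_cou H) (antilinear_scale (f := @cbar C M) (@cbar_antilinear C M)).
Qed.

(** For [f' = ract (conj_ops hA hB mM)] and for [f' xbar w = xbar (x) w^*], which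
    are the conjugates of a left action and of a tensor product. *)
Lemma star_colinear2 (M M' N N' Q Q' : lmodType C) coM coM' coN coN' coQ coQ'
    (sM : M -> M') (sN : N -> N') (h : Q -> Q') (f : M -> N -> Q) (f' : N' -> M' -> Q') m n :
  linear coM' -> 
  star_colinear hA coM coM' sM -> star_colinear hA coN coN' sN ->
  star_colinear hA coQ coQ' h -> antilinear h -> bilin f' ->
  (forall m n, h (f m n) = f' (sN n) (sM m)) ->
  colinear2 hA coM coN coQ f ->
  coQ' (f' (sN n) (sM m)) =
  \tsum_(y, n0 <- coN' (sN n)) \tsum_(x, m0 <- coM' (sM m)) ((y ** x) ⊗ f' n0 m0).
Proof.
move=> lM' hM hN hQ ah bf' e cf; rewrite -e hQ.
rewrite (colinear2_sum (G := conj_space (A ⊗ Q')%type) m n cf (star_tensor_bilin H ah)).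
rewrite (star_colinear_sum (f := fun y n0 => \tsum_(x, m0 <- coM' (sM m))
  ((y ** x) ⊗ f' n0 m0)) _ hN); last by lin.
rewrite tlift_exchange; apply: eq_tlift => y n0.
rewrite (star_colinear_sum (f := fun x m0 => (hstar hA y ** x) ⊗ f' (sN n0) m0) _ hM); last by lin.
by apply: eq_tlift => x m0; rewrite e (star_mul (hopf_star H)).
Qed.

End Conjugate.

Section Metric.
Variables (C : numClosedFieldType) (A B E : lmodType C) (hA : hopf_ops A).
Variables (gam gamb : {scalar (A ⊗ A)%type}).
Variables (hB : comodalg_ops A B) (mE : bimod_ops A B E).
Variable Hm : conj_space E -> E -> B.
Hypothesis H : is_hopf_star_algebra hA.
Hypothesis HG : is_cocycle hA gam gamb.
Hypothesis HU : is_unitary_cocycle hA gam gamb.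
Hypothesis sB : is_comodule_star_algebra hA hB.
Hypothesis bE : is_bimod hA hB mE.
Hypothesis HH : is_hermitian_metric hA hB mE Hm.
Let caB := csa_ca sB.
Let cB := ca_comod caB.
Let cE := bimod_comod bE.
Local Notation "x ** y" := (hmul hA x y) (at level 40, left associativity).
Local Notation coB := (bcoact hB).
Local Notation coE := (coact mE).
Local Notation Ebar := (conj_space E).
Local Notation mEbar := (conj_ops hA hB mE).
Local Notation coEbar := (coact mEbar).
Local Notation N := (frakN hA gamb mE).
Local Notation L := (star_shift hA gamb).

Definition pairing (e : E) (f : Ebar) : B := Hm f e.

Lemma conj_comodule : is_comodule hA coEbar.
Proof. exact: conj_coact_comodule. Qed.

Lemma metric_left_linear f : left_linear (lact mE) (bmul hB) (Hm f).
Proof. by have [h _ _] := metric_bij HH; apply: (h f). Qed.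

Lemma pairing_bilin : bilin pairing.
Proof.
split=> [f|e]; first by have [] := metric_left_linear f.
by move=> c x y; rewrite /pairing (metric_linear HH).
Qed.

Lemma pairing_lact b e f : pairing (lact mE b e) f = bmul hB b (pairing e f).
Proof. by have [_ h] := metric_left_linear f; apply: h. Qed.

Lemma pairing_ract e f b : pairing e (ract mEbar f b) = bmul hB (pairing e f) b.
Proof. by rewrite /pairing (metric_ract HH). Qed.

Let metric_coact (f : Ebar) e :
  \tsum_(a, f0 <- coEbar f) (a ⊗ Hm f0 e) =
  \tsum_(x, e0 <- coE e) \tsum_(y, b0 <- coB (Hm f e0))
    (hmul hA (hant hA x) y ⊗ b0) :> (A ⊗ B)%type.
Proof.
rewrite -(metric_colinear HH f e).
rewrite [RHS](tlift_tlift (f := fun a (g : E -> B) => a ⊗ g e)).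
  apply: eq_tlift => a f0; rewrite tlift_pure //.
  by split=> [g|a']; [lin | move=> c x y; rewrite -(tpure_linr _ _ a')].
by split=> [g|a']; [lin | move=> c x y; rewrite -(tpure_linr _ _ a')].
Qed.

(** The antipode in the coaction of [_B Hom(E, B)] is cancelled by multiplying
    with one more coefficient of [e]. *)
Lemma pairing_colinear : colinear2 hA coE coEbar coB pairing.
Proof.
move=> e f; have lE := comod_linear cE; have lB := comod_linear cB.
have bP := pairing_bilin; have [lP _] := bP.
have lHf g : linear (Hm g) by exact: lP.
transitivity (\tsum_(x, e0 <- coE e) \tsum_(x', e1 <- coE e0)
  \tsum_(y, b0 <- coB (Hm f e1)) ((x ** (hant hA x' ** y)) ⊗ b0 : (A ⊗ B)%type));
  last first.
  apply: eq_tlift => x e0; symmetry.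
  transitivity (tlift (fun a b => (x ** a) ⊗ b : (A ⊗ B)%type)
    (\tsum_(a, f0 <- coEbar f) (a ⊗ Hm f0 e0) : (A ⊗ B)%type)).
    rewrite [RHS]tlift_tlift; last by lin.
    by apply: eq_tlift => a f0; rewrite tlift_pure //; lin.
  rewrite metric_coact tlift_tlift; last by lin.
  apply: eq_tlift => x' e1; rewrite tlift_tlift; last by lin.
  by apply: eq_tlift => y b0; rewrite tlift_pure //; lin.
rewrite -(coassoc (f := fun x x' e1 => \tsum_(y, b0 <- coB (Hm f e1))
  ((x ** (hant hA x' ** y)) ⊗ b0 : (A ⊗ B)%type)) _ cE); last by lin.
rewrite -[LHS](counit (f := fun e => coB (pairing e f)) _ cE); last by lin.
apply: eq_tlift => x e0; rewrite tlift_exchange.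
rewrite -[X in hcou hA x *: X]tlift_id scale_tlift; apply: eq_tlift => y b0.
have lq : linear (fun z => (z ** y) ⊗ b0 : (A ⊗ B)%type) by lin.
have := congr1 (fun z => (z ** y) ⊗ b0 : (A ⊗ B)%type) (hopf_antr H x).
rewrite /= (lin_of_tlift _ _ lq) (lin_of_scale lq) (alg_1l (hopf_alg H)) => <-.
by apply: eq_tlift => x1 x2; rewrite (alg_assoc (hopf_alg H)).
Qed.

(** [metric_colinear] turns the argument [S v_(-1) (f v_0)_(-1)] of the cocycle in
    [frakS] into a coefficient of the second variable. *)
Lemma deform_metricE e f : deform_metric hA gam gamb hB mE Hm f e =
  twist gam coE coEbar pairing e (N f).
Proof.
have lB := bcoact_lin caB.
rewrite /deform_metric /= /frakS; apply: eq_tlift => x v.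
have bh : bilin (fun u b => gam (x ⊗ u) *: b : B) by lin.
have := congr1 (tlift (fun u b => gam (x ⊗ u) *: b) : (A ⊗ B)%type -> B)
  (metric_coact (N f) v).
rewrite [LHS]tlift_tlift // [RHS]tlift_tlift // => e1.
transitivity (\tsum_(m, n <- coEbar (N f)) \tsum_(u, b <- (m ⊗ Hm n v : (A ⊗ B)%type)) gam (x ⊗ u) *: b);
  last by apply: eq_tlift => a f0; rewrite tlift_pure.
rewrite e1; apply: eq_tlift => y v0; rewrite tlift_tlift //.
by apply: eq_tlift => z b0; rewrite tlift_pure.
Qed.

Let bstar_antilinear := star_antilinear (csa_star sB).
Let bstarK := star_involutive (csa_star sB).

Lemma conj_ract_bilin : bilin (ract mEbar).
Proof.
split=> [b|f] c x y.
  exact: (lact_linr (bstar hB b) bE).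
by rewrite /= bstar_antilinear (lact_linl _ bE) cbar_antilinear conjCK.
Qed.

Lemma conj_ract_colinear : colinear2 hA coEbar coB coEbar (ract mEbar).
Proof.
move=> f b; have lB := bcoact_lin caB.
rewrite -[f]/(cbar (uncbar f)) -[b in LHS]bstarK -[b in RHS]bstarK.
apply: (star_colinear2 H (coM := coB) (coN := coE) (coQ := coE) (h := @cbar C E)
  (f := lact mE)) => //.
- exact: (csa_coact_star sB).
- exact: cbar_antilinear.
- exact: conj_ract_bilin.
- by move=> m n; rewrite /= bstarK.
- exact: (lact_colinear H caB bE).
Qed.

(** The shift of a twisted action is a cotwist, and the bar turns it into the twist
    of the conjugate action. *)
Lemma frakN_lact b e :
  N (cbar (lact (deform_bimod gam hB mE) b e)) =
  twist gam coEbar coB (ract mEbar) (N (cbar e))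
    (bstar (deform_comodalg hA gam gamb hB) b).
Proof.
have lE := comod_linear cE.
rewrite deform_bstar // !frakN_star_shift.
have := star_shift_twist H HG HU b e cB cE lE (bilin_lact bE) (lact_colinear H caB bE).
rewrite -[twist _ _ _ _ _ _]/(lact (deform_bimod gam hB mE) b e) /= => ->.
apply: (antilinear_cotwist H HU (h := @cbar C E)) => //.
- exact: (bcoact_lin caB).
- exact: (csa_coact_star sB).
- exact: cbar_antilinear.
- exact: conj_ract_bilin.
- by move=> m n; rewrite /= bstarK.
Qed.

Lemma frakN_surj f : exists f', N f' = f.
Proof.
have [e' e] := star_shift_surj H HG HU (uncbar f) cE.
by exists (cbar e'); rewrite frakN_star_shift /= e.
Qed.

Lemma frakN_lin : linear N.
Proof.
move=> c x y; rewrite !frakN_star_shift.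
have e : uncbar (c *: x + y) = c^* *: uncbar x + uncbar y by [].
rewrite e (star_shift_lin H HU (gamb := gamb) (comod_linear cE)) cbar_antilinear.
by rewrite conjCK.
Qed.

(** The twist of [<e, f b> = <e, f> b]. *)
Lemma deform_metric_ract f b e :
  deform_metric hA gam gamb hB mE Hm
    (ract (conj_ops (deform_hopf hA gam gamb) (deform_comodalg hA gam gamb hB)
       (deform_bimod gam hB mE)) f b) e =
  bmul (deform_comodalg hA gam gamb hB) (deform_metric hA gam gamb hB mE Hm f e) b.
Proof.
have lB := bcoact_lin caB; have lE := comod_linear cE; have lEb := comod_linear conj_comodule.
have e' : bstar (deform_comodalg hA gam gamb hB)
    (bstar (deform_comodalg hA gam gamb hB) b) = b.
  rewrite (deform_bstar hA gam gamb _ bstar_antilinear).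
  rewrite (deform_bstar hA gam gamb _ bstar_antilinear).
  exact: (star_shift_involutive H HG HU b cB bstar_antilinear bstarK (csa_coact_star sB)).
rewrite !deform_metricE [ract _ f b]/= frakN_lact e'.
symmetry; apply: (twist_assoc H HG cE conj_comodule cB lB lEb pairing_bilin
  (bmul_bilin caB) conj_ract_bilin pairing_bilin pairing_colinear conj_ract_colinear).
by move=> m n p; rewrite pairing_ract.
Qed.

Lemma deform_metric_lin e : linear (fun f => deform_metric hA gam gamb hB mE Hm f e).
Proof.
have lN := frakN_lin; have bP := pairing_bilin.
have [_ bt] := bilin_twist gam (comod_linear cE) (comod_linear conj_comodule) bP.
by move=> c x y; rewrite !deform_metricE lN bt.
Qed.

End Metric.

(** * The tensor product of deformed bimodules *)

Section DeformedTensor.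
Variables (C : numClosedFieldType) (A B M N : lmodType C) (hA : hopf_ops A).
Variables (gam gamb : {scalar (A ⊗ A)%type}) (hB : comodalg_ops A B).
Variables (mM : bimod_ops A B M) (mN : bimod_ops A B N).
Hypothesis H : is_hopf_star_algebra hA.
Hypothesis HG : is_cocycle hA gam gamb.
Hypothesis caB : is_comodule_algebra hA hB.
Hypotheses (bM : is_bimod hA hB mM) (bN : is_bimod hA hB mN).
Let cB := ca_comod caB.
Let cM := bimod_comod bM.
Let cN := bimod_comod bN.
Local Notation "x ** y" := (hmul hA x y) (at level 40, left associativity).
Local Notation coB := (bcoact hB).
Local Notation coM := (coact mM).
Local Notation coN := (coact mN).
Local Notation MN := (tensB mM mN).
Local Notation gM := (deform_bimod gam hB mM).
Local Notation gN := (deform_bimod gam hB mN).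
Local Notation MNg := (tensB gM gN).
Local Notation coMN := (coact (tensB_ops hA mM mN)).
Local Notation phi_ := (phi gam hB mM mN).
Local Notation phiV := (phi_inv gam hB mM mN).

Let KV := phi_invK H caB bM bN HG.
Let VK := phiVK H caB bM bN HG.
Let pureE := phi_pure H caB bM bN HG.

(** The twist of [(b m) (x) n = b (m (x) n)]. *)
Lemma deform_tensB_lact b t :
  lact (tensB_ops (deform_hopf hA gam gamb) gM gN) b t =
  phiV (twist gam coB coMN (lact (tensB_ops hA mM mN)) b (phi_ t)).
Proof.
have lV := phi_inv_lin H caB bM bN HG.
have lco := tensB_coact_lin H caB bM bN.
have bl : bilin (lact (tensB_ops hA mM mN)) by apply: (tensB_lact_bilin mN bM).
have bt : bilin (tpure : M -> N -> MN) by lin.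
have [_ btl] := bilin_twist gam (comod_linear cB) lco bl.
apply: (tlift_factor_phi H caB bM bN HG
  (K := fun s => phiV (twist gam coB coMN (lact (tensB_ops hA mM mN)) b s))) => [|m n].
  by have lb := btl b; lin.
apply: (can_inj VK); rewrite KV pureE.
apply: (twist_assoc H HG cB cM cN (comod_linear cM) lco (bilin_lact bM) bt bt
  bl (lact_colinear H caB bM) (tensB_colinear H caB bM bN)).
by move=> *; apply: (esym (tensB_lact_pure mN bM _ _ _)).
Qed.

Let hmul_deform (x y : A) : hmul (deform_hopf hA gam gamb) x y =
  \tsum_(x1, s <- hcop hA x) \tsum_(y1, t <- hcop hA y)
  \tsum_(x2, x3 <- hcop hA s) \tsum_(y2, y3 <- hcop hA t)
    ((gam (x1 ⊗ y1) * gamb (x3 ⊗ y3)) *: (x2 ** y2)).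
Proof.
have cA := hopf_comodule H.
rewrite /=.
rewrite (coassoc (f := fun x1 x2 x3 => \tsum_(y0, k3 <- hcop hA y)
  \tsum_(k1, k2 <- hcop hA y0) (gam (x1 ⊗ k1) * gamb (x3 ⊗ k3)) *: (x2 ** k2)) x cA);
  last by lin.
apply: eq_tlift => x1 s.
under eq_tlift => x2 x3 do
  [rewrite (coassoc (f := fun y1 y2 y3 => (gam (x1 ⊗ y1) * gamb (x3 ⊗ y3)) *: (x2 ** y2)) y cA);
   last by lin].
by rewrite tlift_exchange.
Qed.

(** [phi] is colinear: the factor [gamb] in the product of the deformed Hopf algebra
    cancels against the [gam] of [phi]. *)
Lemma deform_tensB_coact t :
  coact (tensB_ops (deform_hopf hA gam gamb) gM gN) t =
  \tsum_(u, q <- coMN (phi_ t)) (u ⊗ phiV q).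
Proof.
have lV := phi_inv_lin H caB bM bN HG.
have lco := tensB_coact_lin H caB bM bN.
have lM := comod_linear cM; have lN := comod_linear cN.
pose K (s : MN) : (A ⊗ MNg)%type := \tsum_(u, q <- coMN s) (u ⊗ phiV q).
have lK : linear K by rewrite /K; lin.
apply: (tlift_factor_phi H caB bM bN HG (K := K)) => // m n.
rewrite (linear_twist gam coM coN _ _ _ lK).
have phiV_pure m' n' : phiV (m' ⊗ n') = twist gamb coM coN (tpure : M -> N -> MNg) m' n'.
  apply: (can_inj VK); rewrite KV.
  rewrite (linear_twist gamb coM coN _ _ _ (phi_lin H caB bM bN HG)).
  rewrite -[LHS](twistK HG (f := (tpure : M -> N -> MN)) m' n' cM cN); last by lin.
  by apply: eq_twist => m1 n1; rewrite pureE.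
(* The common value of both sides: each consumes three coefficients of [m] and of
   [n], the middle ones being multiplied in [A]. *)
pose W x1 x2 x3 y1 y2 y3 m0 n0 : (A ⊗ MNg)%type :=
  (gam (x1 ⊗ y1) * gamb (x3 ⊗ y3)) *: ((x2 ** y2) ⊗ (m0 ⊗ n0)).
transitivity (\tsum_(x1, m' <- coM m) \tsum_(y1, n' <- coN n)
  \tsum_(s, m0 <- coM m') \tsum_(t, n0 <- coN n')
  \tsum_(x2, x3 <- hcop hA s) \tsum_(y2, y3 <- hcop hA t) W x1 x2 x3 y1 y2 y3 m0 n0);
  last first.
  apply: eq_tlift => x1 m'; apply: eq_tlift => y1 n'.
  rewrite -(coassoc2 (F := fun x2 x3 y2 y3 m0 n0 => W x1 x2 x3 y1 y2 y3 m0 n0)) //;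
    [ | by rewrite /W; lin | by rewrite /W; lin ].
  rewrite /K (colinear2_sum (h := fun u q => u ⊗ phiV q) _ _ (tensB_colinear H caB bM bN)); last by lin.
  rewrite scale_tlift; apply: eq_tlift => x2 m''.
  rewrite scale_tlift; apply: eq_tlift => y2 n''.
  rewrite phiV_pure (linear_twist gamb coM coN _ (h := tpure (x2 ** y2))); last by lin.
  rewrite scale_tlift; apply: eq_tlift => x3 m0.
  by rewrite scale_tlift; apply: eq_tlift => y3 n0; rewrite scalerA.
rewrite (coassoc2 (F := fun x1 s y1 t m0 n0 => \tsum_(x2, x3 <- hcop hA s)
  \tsum_(y2, y3 <- hcop hA t) W x1 x2 x3 y1 y2 y3 m0 n0) m n cM cN);
  [ | by rewrite /W; lin | by rewrite /W; lin ].
apply: eq_tlift => x m0; apply: eq_tlift => y n0.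
have lt : linear (fun u => u ⊗ (m0 ⊗ n0) : (A ⊗ MNg)%type) by lin.
rewrite hmul_deform (lin_of_tlift _ _ lt); apply: eq_tlift => x1 s.
rewrite (lin_of_tlift _ _ lt); apply: eq_tlift => y1 t'.
rewrite (lin_of_tlift _ _ lt); apply: eq_tlift => x2 x3.
rewrite (lin_of_tlift _ _ lt); apply: eq_tlift => y2 y3.
by rewrite (lin_of_scale lt).
Qed.

Lemma deform_colinear (E : lmodType C) (coE : E -> (A ⊗ E)%type) (f : E -> MNg) :
  linear coE ->
  colinear coE (coact (tensB_ops (deform_hopf hA gam gamb) gM gN)) f <->
  colinear coE coMN (fun e => phi_ (f e)).
Proof.
move=> lE; have lV := phi_inv_lin H caB bM bN HG.
have lp := phi_lin H caB bM bN HG; have lco := tensB_coact_lin H caB bM bN.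
split=> cf e; last first.
  rewrite deform_tensB_coact cf tlift_tlift; last by lin.
  by apply: eq_tlift => x e0; rewrite tlift_pure ?VK //; lin.
pose g (s : (A ⊗ MNg)%type) : (A ⊗ MN)%type := tlift (fun u q => u ⊗ phi_ q) s.
have lg : linear g by rewrite /g; lin.
have <- : g (coact (tensB_ops (deform_hopf hA gam gamb) gM gN) (f e)) = coMN (phi_ (f e)).
  rewrite deform_tensB_coact (lin_of_tlift _ _ lg) -[RHS]tlift_id.
  by apply: eq_tlift => u q; rewrite /g tlift_pure ?KV //; lin.
rewrite cf (lin_of_tlift _ _ lg); apply: eq_tlift => x e0.
by rewrite /g tlift_pure //; lin.
Qed.

End DeformedTensor.

(** * Chern connections and deformation *)

Section Chern.
Variables (C : numClosedFieldType) (A B Om E : lmodType C) (hA : hopf_ops A).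
Variables (gam gamb : {scalar (A ⊗ A)%type}) (hB : comodalg_ops A B).
Variables (F : nat -> lmodType C) (O : calculus_ops A B Om F).
Variables (T : nat * nat -> lmodType C) (J : grading A B Om T).
Variables (mE : bimod_ops A B E) (Hm : conj_space E -> E -> B).
Hypothesis H : is_hopf_star_algebra hA.
Hypothesis HG : is_cocycle hA gam gamb.
Hypothesis HU : is_unitary_cocycle hA gam gamb.
Hypothesis sB : is_comodule_star_algebra hA hB.
Hypothesis HO : is_star_calculus hA hB O.
Hypothesis HJ : is_complex_structure hA hB O J.
Hypothesis bE : is_bimod hA hB mE.
Hypothesis HH : is_hermitian_metric hA hB mE Hm.
Let caB := csa_ca sB.
Let cB := ca_comod caB.
Let cE := bimod_comod bE.
Local Notation F1 := (F 1%N).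
Local Notation mF := (gops (cgrad O) 1%N).
Let bF := form1_bimod HO.
Let cF := bimod_comod bF.
Local Notation coB := (bcoact hB).
Local Notation coE := (coact mE).
Local Notation coF := (coact mF).
Local Notation Ebar := (conj_space E).
Local Notation mEbar := (conj_ops hA hB mE).
Local Notation coEbar := (coact mEbar).
Local Notation Q := (tensB mF mE).
Local Notation mQ := (tensB_ops hA mF mE).
Local Notation coQ := (coact mQ).
Local Notation mQbar := (conj_ops hA hB mQ).
Local Notation hA' := (deform_hopf hA gam gamb).
Local Notation hB' := (deform_comodalg hA gam gamb hB).
Local Notation O' := (deform_calculus hA gam gamb hB O).
Local Notation mE' := (deform_bimod gam hB mE).
Local Notation mF' := (deform_bimod gam hB mF).
Local Notation Q' := (tensB mF' mE').
Local Notation phi_ := (phi gam hB mF mE).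
Local Notation N := (frakN hA gamb mE).
Local Notation L := (star_shift hA gamb).
Local Notation H' := (deform_metric hA gam gamb hB mE Hm).
Local Notation P := (pairing Hm).

Let KV := phi_invK H caB bF bE HG.
Let VK := phiVK H caB bF bE HG.
Let phi_l := phi_lin H caB bF bE HG.
Let phi_inj := can_inj VK.
Let pureE := phi_pure H caB bF bE HG.
Let lQ := tensB_coact_lin H caB bF bE.
Let blQ : bilin (lact mQ) := tensB_lact_bilin mE bF.
Let lB := comod_linear cB.
Let lE := comod_linear cE.
Let lF := comod_linear cF.
Let bP := pairing_bilin HH.
Let ld := d_fun_lin HO.

(** ** The two halves of the metric condition *)

Definition contract_metric (f : Ebar) (t : Q) : F1 :=
  \tsum_(w, x <- t) ract mF w (P x f).
Local Notation ev := contract_metric.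

Let ev_balanced f : balanced (ract mF) (lact mE) (fun w x => ract mF w (P x f)).
Proof.
split; [by lin | by lin |] => w b x.
by rewrite (pairing_lact HH) (rmod_M (bimod_right bF)).
Qed.

Lemma contract_metric_bilin : bilin (fun t f => ev f t).
Proof.
by split=> [f|t]; [apply: (tliftP (ev_balanced f)) | rewrite /ev; lin].
Qed.

Definition contract_conj_metric (e : E) (q : conj_space Q) : F1 :=
  star_form O (ev (cbar e) (uncbar q)).
Local Notation evc := contract_conj_metric.

Let star_antilin := star_form_antilinear HO.
Let starK := star_formK HO.
Let bev := contract_metric_bilin.

Lemma contract_conj_metric_bilin : bilin evc.
Proof.
have [evl evr] := bev.
split=> [q|e] c x y; rewrite /evc.
  by rewrite (@cbar_antilinear C E) evr star_antilin conjCK.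
have -> : uncbar (c *: x + y) = c^* *: uncbar x + uncbar y by [].
by rewrite evl star_antilin conjCK.
Qed.

Lemma contract_conj_metricE e (t : Q) : evc e (cbar t) =
  \tsum_(w, x <- t) lact mF (P e (cbar x)) (star_form O w).
Proof.
rewrite /evc /uncbar /cbar /ev (antilinear_tlift _ _ star_antilin).
apply: eq_tlift => w x; rewrite (star_form_ract HO) /pairing.
by rewrite (metric_hermitian HH).
Qed.

Let evc_pure e w x : evc e (cbar (w ⊗ x)) = lact mF (P e (cbar x)) (star_form O w).
Proof.
rewrite /evc /uncbar /cbar /ev (tlift_tpure _ _ (ev_balanced _)).
by rewrite (star_form_ract HO) /pairing (metric_hermitian HH).
Qed.

(** In the metric condition the involution of the connection may be taken after
    the contraction, so that the condition reads
    [d <e, f> = ev f (nabla e) + (ev e (nabla f))^*]. *)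
Lemma conj_connection_sum (nabla : E -> Q) (f : Ebar) e :
  \tsum_(y, w <- conj_connection hA hB nabla f) lact mF (Hm y e) w =
  evc e (cbar (nabla (uncbar f))).
Proof.
have bal : balanced (ract mEbar) (lact mF) (fun y w => lact mF (Hm y e) w).
  have bP' : bilin (fun e f => Hm f e) by exact: bP.
  split=> [w|y|y b w].
  - have ly := proj2 bP e; move=> c y z.
    have -> : Hm (c *: y + z) e = c *: Hm y e + Hm z e by exact: ly.
    exact: (lact_linl _ bF).
  - exact: (lact_linr _ bF).
  - have -> : Hm (ract mEbar y b) e = bmul hB (Hm y e) b by exact: (pairing_ract HH).
    by rewrite (lmod_M (bimod_left bF)).
rewrite contract_conj_metricE /conj_connection (lin_of_tlift _ _ (tliftP bal)).
by apply: eq_tlift => w x; rewrite tlift_tpure.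
Qed.

Let lQbar : linear (coact mQbar).
Proof. exact: (conj_coact_lin hB H). Qed.

(* The coaction on the conjugate of [Omega^1 (x)_B E] makes the flip
   [xbar (x) w |-> bar (w^* (x) x)] colinear. *)
Let conj_pair (y : Ebar) (w : F1) : conj_space Q := cbar (star_form O w ⊗ uncbar y).

Let conj_pair_bilin : bilin conj_pair.
Proof.
split=> [w|y] c a b; rewrite /conj_pair.
  have -> : uncbar (c *: a + b) = c^* *: uncbar a + uncbar b by [].
  by rewrite (tpure_linr _ _ (star_form O w)) (@cbar_antilinear C Q) conjCK.
by rewrite star_antilin (tpure_linl _ _ (uncbar y)) (@cbar_antilinear C Q) conjCK.
Qed.

Let conj_pair_colinear : colinear2 hA coEbar coF (coact mQbar) conj_pair.
Proof.
move=> y w; rewrite -[y]/(cbar (uncbar y)) -[w in LHS]starK -[w in RHS]starK.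
apply: (star_colinear2 H (coM := coF) (coN := coE) (coQ := coQ) (h := @cbar C Q)
  (f := tpure)) => //.
- exact: (star_form_colinear H HO).
- exact: (@cbar_antilinear C Q).
- by move=> m x; rewrite /conj_pair starK.
- exact: (tensB_colinear H caB bF bE).
Qed.

Let deform_star_form w : star_form O' w = star_form O (L coF w).
Proof.
rewrite {2}/star_form.
rewrite -(star_shift_colinear H HU w (grad_linear (calc_grading HO) (i := 1%N))
  (grad_colinear (calc_grading HO) (i := 1%N))).
rewrite -(deform_bstar hA gam gamb _ (calc_star_antilinear HO)).
by [].
Qed.

Let deform_conj_pair w x :
  twist gam coEbar coF conj_pair (N (cbar x)) (star_form O' w) =
  cbar (L coQ (twist gam coF coE tpure w x)).
Proof.
rewrite (star_shift_twist H HG HU w x cF cE lQ _ (tensB_colinear H caB bF bE)); last by lin.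
rewrite deform_star_form frakN_star_shift; symmetry.
apply: (antilinear_cotwist H HU (h := @cbar C Q)) => //.
- exact: (star_form_colinear H HO).
- exact: (@cbar_antilinear C Q).
- by move=> m y; rewrite /conj_pair starK.
Qed.

Section Connection.
Variable n : E -> Q'.
Let nab (e : E) : Q := phi_ (n e).

Let nab_lin : linear n <-> linear nab.
Proof.
split=> ln; first by rewrite /nab; lin.
by move=> c x y; apply: phi_inj; rewrite phi_l; apply: ln.
Qed.

Let leibniz_defect (b : B) (e : E) : Q :=
  nab (lact mE b e) - (lact mQ b (nab e) + d_fun O b ⊗ e).

Let leibniz_defect_bilin : linear nab -> bilin leibniz_defect.
Proof. by move=> lnab; rewrite /leibniz_defect; lin. Qed.

Let deform_leibniz_defect b e : linear nab -> colinear coE coQ nab ->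
  phi_ (n (lact mE' b e) -
     (lact (tensB_ops hA' mF' mE') b (n e) + (d_fun O b ⊗ e : Q'))) =
  twist gam coB coE leibniz_defect b e.
Proof.
move=> lnab cnab.
rewrite (lin_of_sub phi_l) (lin_of_add phi_l) (deform_tensB_lact H HG caB bF bE) KV pureE.
rewrite /leibniz_defect twistD twistN twistD; congr (_ - (_ + _)).
- exact: (linear_twist gam coB coE (lact mE) b e lnab).
- exact: (twist_colinearr gam coB (h := nab) b e blQ cnab).
- apply: (twist_colinearl gam b e lE _ (d_fun_colinear HO)).
  by lin.
Qed.

Let connection_deform :
  is_covariant_left_connection hA' (O := O') (mE := mE') n <->
  is_covariant_left_connection hA nab.
Proof.
split=> [[ln lz /(deform_colinear H HG caB bF bE _ lE) cn]|[ln lz cn]].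
  have lnab := (nab_lin.1 ln); split=> // b e.
  apply/eqP; rewrite -subr_eq0; apply/eqP.
  apply: (twist_eq0 HG cB cE (leibniz_defect_bilin lnab)) => b' e'.
  rewrite -deform_leibniz_defect //.
  have -> : n (lact mE' b' e') = lact (tensB_ops hA' mF' mE') b' (n e') + d_fun O b' ⊗ e'.
    exact: lz.
  by rewrite subrr (lin_of_0 phi_l).
split.
- exact: (nab_lin.2 ln).
- move=> b e; apply/eqP; rewrite -subr_eq0; apply/eqP; apply: phi_inj.
  rewrite (lin_of_0 phi_l); apply: (etrans (deform_leibniz_defect b e ln cn)).
  rewrite -[RHS](twist0 gam Q coB coE b e); apply: eq_twist => b' e'.
  by rewrite /leibniz_defect lz subrr.
- by apply/(deform_colinear H HG caB bF bE _ lE).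
Qed.


Let metric_defect (e : E) (f : Ebar) : F1 :=
  d_fun O (P e f) - (ev f (nab e) + evc e (cbar (nab (uncbar f)))).

Let nab_bar (f : Ebar) : conj_space Q := cbar (nab (uncbar f)).

Let nab_bar_lin : linear nab -> linear nab_bar.
Proof.
move=> ln c x y; rewrite /nab_bar.
have -> : uncbar (c *: x + y) = c^* *: uncbar x + uncbar y by [].
by rewrite ln (@cbar_antilinear C Q) conjCK.
Qed.

Let nab_bar_colinear : linear nab -> colinear coE coQ nab ->
  colinear coEbar (coact mQbar) nab_bar.
Proof.
move=> ln cn f; rewrite -[f]/(cbar (uncbar f)).
have lnb := nab_bar_lin ln.
have sE : star_colinear hA coE coEbar (@cbar C E) by [].
have sQ : star_colinear hA coQ (coact mQbar) (@cbar C Q) by [].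
rewrite [RHS](star_colinear_sum (f := fun a v => a ⊗ nab_bar v) _ sE); last by lin.
exact: (star_colinear_compr H (@cbar_antilinear C Q) sQ cn).
Qed.

Let metric_defect_bilin : linear nab -> bilin metric_defect.
Proof.
move=> ln; have lnb := nab_bar_lin ln; have bevc := contract_conj_metric_bilin.
rewrite /metric_defect; split=> [f|e].
  have l1 := proj1 bev f; have l2 := proj1 bevc (nab_bar f).
  apply: lin_add; first by lin.
  apply: lin_opp; apply: lin_add; last exact: l2.
  exact: (lin_comp l1 ln).
have l1 := proj2 bev (nab e); have l2 := proj2 bevc e.
apply: lin_add; first by lin.
apply: lin_opp; apply: lin_add; first exact: l1.
exact: (lin_comp l2 lnb).
Qed.

Let lEbar : linear coEbar.
Proof. exact: (comod_linear (conj_comodule H bE)). Qed.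

(** The twist of [ev f (w (x) x) = w <x, f>]. *)
Let deform_first_term e f : linear nab -> colinear coE coQ nab ->
  \tsum_(w, x <- n e) ract mF' w (H' f x) =
  twist gam coE coEbar (fun e f => ev f (nab e)) e (N f).
Proof.
move=> ln cn.
have bt : bilin (tpure : F1 -> E -> Q) by lin.
have btev := bilin_twist gam lQ lEbar bev.
rewrite -(twist_colinearl gam (h := nab) e (N f) lEbar bev cn).
apply: (tlift_factor_phi H caB bF bE HG
  (K := fun t => twist gam coQ coEbar (fun t f => ev f t) t (N f))).
  by case: btev.
move=> w x; rewrite (deform_metricE gam gamb sB HH).
symmetry; apply: (twist_assoc H HG cF cE (conj_comodule H bE) lQ lB bt bev bP
  (bilin_ract bF) (tensB_colinear H caB bF bE) (pairing_colinear H sB bE HH)).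
by move=> w' x' f'; rewrite /ev (tlift_tpure _ _ (ev_balanced _)).
Qed.

(** The bar of the shift of [nab f] is [nab] applied to [frakN f], because [nab] is
    colinear; what remains is the twist of
    [evc e (xbar (x) w^* ) = <e, xbar> w^*]. *)
Let deform_second_term e f : linear nab -> colinear coE coQ nab ->
  \tsum_(y, w <- conj_connection hA' hB' (O := O') (mE := mE') n f)
     lact mF' (H' y e) w =
  twist gam coE coEbar (fun e f => evc e (nab_bar f)) e (N f).
Proof.
move=> ln cn; have cEb := conj_comodule H bE.
have bevc := contract_conj_metric_bilin.
have btb := bilin_twist gam lE lEbar bP.
have btl := bilin_twist gam lB lF (bilin_lact bF).
have btm := bilin_twist gam lB lB (bmul_bilin caB).
have [_ btc] := bilin_twist gam lE lQbar bevc.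
have lH := deform_metric_lin H HU sB bE HH (gamb := gamb) (gam := gam) e.
have bal : balanced (ract (conj_ops hA' hB' mE')) (lact mF')
    (fun y w => lact mF' (H' y e) w).
  split=> [w|y|y b w].
  - exact: (lin_comp (proj1 btl w) lH).
  - exact: (proj2 btl (H' y e)).
  - rewrite (deform_metric_ract H HG HU sB bE HH).
    apply: (twist_assoc H HG cB cB cF lB lF (bmul_bilin caB) (bilin_lact bF)
      (bilin_lact bF) (bilin_lact bF) (bmul_colinear caB) (lact_colinear H caB bF)).
    by move=> *; apply: (lmod_M (bimod_left bF)).
pose K (t : Q) : conj_space F1 := twist gam coE (coact mQbar) evc e (cbar (L coQ t)).
have lK : linear K.
  move=> c x y; rewrite /K (star_shift_lin H HU lQ) (@cbar_antilinear C Q) btc.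
  by [].
transitivity (\tsum_(w, x <- n (uncbar f)) lact mF' (H' (cbar x) e) (star_form O' w)).
  rewrite /conj_connection (lin_of_tlift _ _ (tliftP bal)).
  by apply: eq_tlift => w x; rewrite tlift_tpure.
transitivity (K (nab (uncbar f))).
  apply: (tlift_factor_phi (G := conj_space F1) H caB bF bE HG (K := K)) => // w x.
  rewrite /K -deform_conj_pair (deform_metricE gam gamb sB HH).
  apply: (twist_assoc H HG cE cEb cF lB lQbar bP (bilin_lact bF) conj_pair_bilin bevc
    (pairing_colinear H sB bE HH) conj_pair_colinear).
  move=> e' y w'; rewrite /conj_pair evc_pure starK.
  by [].
rewrite /K (star_shift_colinear H HU (uncbar f) ln cn).
rewrite -(twist_colinearr gam coE (h := nab_bar) e (N f) bevc (nab_bar_colinear ln cn)).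
by rewrite frakN_star_shift.
Qed.

Let deform_metric_defect e f : linear nab -> colinear coE coQ nab ->
  d_fun O (H' f e) -
  (\tsum_(w, x <- n e) ract mF' w (H' f x) +
   \tsum_(y, w <- conj_connection hA' hB' (O := O') (mE := mE') n f)
     lact mF' (H' y e) w) =
  twist gam coE coEbar metric_defect e (N f).
Proof.
move=> ln cn; rewrite deform_first_term // deform_second_term //.
rewrite (deform_metricE gam gamb sB HH) (linear_twist gam coE coEbar P _ _ ld).
by rewrite /metric_defect twistD twistN twistD.
Qed.

Let metric_deform : linear nab -> colinear coE coQ nab ->
  (forall e f, d_fun O' (H' f e) =
    \tsum_(w, x <- n e) ract mF' w (H' f x) +
    \tsum_(y, w <- conj_connection hA' hB' (O := O') (mE := mE') n f)
      lact mF' (H' y e) w) <->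
  (forall e f, d_fun O (Hm f e) =
    \tsum_(w, x <- nab e) ract mF w (Hm f x) +
    \tsum_(y, w <- conj_connection hA hB nab f) lact mF (Hm y e) w).
Proof.
move=> ln cn; split=> h e f.
  rewrite conj_connection_sum; apply/eqP; rewrite -subr_eq0; apply/eqP.
  apply: (twist_eq0 HG cE (conj_comodule H bE) (metric_defect_bilin ln)) => e' f'.
  have [f'' <-] := frakN_surj H HG HU bE f'.
  rewrite -deform_metric_defect //; apply/eqP; rewrite subr_eq0; apply/eqP.
  exact: h.
apply/eqP; rewrite -subr_eq0; apply/eqP.
apply: (etrans (deform_metric_defect e f ln cn)).
rewrite -[RHS](twist0 gam F1 coE coEbar e (N f)); apply: eq_twist => e' f'.
by rewrite /metric_defect /pairing h conj_connection_sum subrr.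
Qed.

(** ** The (0,1)-part *)

Local Notation T01 := (T (0, 1)%N).
Local Notation mT := (gops J (0, 1)%N).
Local Notation mT' := (deform_bimod gam hB mT).
Let gJ := cplx_grading HJ.
Let bT : is_bimod hA hB mT := grad_bimod gJ (0, 1)%N.

Let pi01_lin : linear (pi01 O J).
Proof.
exact: (lin_comp (proj_linear gJ (0, 1)%N) (grad_linear (calc_grading HO) (i := 1%N))).
Qed.

Lemma pi01_ract w b : pi01 O J (ract mF w b) = ract mT (pi01 O J w) b.
Proof.
rewrite /pi01 (grad_ract (calc_grading HO)).
by rewrite (proj_ract gJ) //; exact: (bmul_bilin (calc_alg HO)).
Qed.

Let pi01_colinear : colinear coF (coact mT) (pi01 O J).
Proof.
apply: (colinear_comp (proj_linear gJ _) (proj_colinear gJ _ (bcoact_lin (calc_alg HO)))).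
exact: (grad_colinear (calc_grading HO)).
Qed.

Lemma pi01_balanced : balanced (ract mF) (lact mE)
  (fun w x => pi01 O J w ⊗ x : tensB mT mE).
Proof.
have lp := pi01_lin; split; [by lin | by lin |] => w b x.
by rewrite pi01_ract tpure_bal.
Qed.

Let deform_pi01 e : \tsum_(w, x <- n e) (pi01 O J w ⊗ x : tensB mT' mE') =
  phi_inv gam hB mT mE (\tsum_(w, x <- nab e) (pi01 O J w ⊗ x)).
Proof.
have lp := tliftP pi01_balanced; have lV := phi_inv_lin H caB bT bE HG.
apply: (tlift_factor_phi H caB bF bE HG (K := fun t =>
  phi_inv gam hB mT mE (tlift (fun w x => pi01 O J w ⊗ x) t))).
  exact: (lin_comp lV lp).
move=> w x; apply: (can_inj (phiVK H caB bT bE HG)); rewrite (phi_invK H caB bT bE HG).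
rewrite (phi_pure H caB bT bE HG) (linear_twist gam coF coE _ _ _ lp).
rewrite (twist_colinearl gam (h := pi01 O J) w x lE _ pi01_colinear); last by lin.
by apply: eq_twist => w' x'; rewrite (tlift_tpure _ _ pi01_balanced).
Qed.

Variable dE : E -> tensB mT mE.

(** Each defect of [n] is the twist of the corresponding defect of [nab], and
    twisting is injective. *)
Lemma chern_deform :
  is_chern_connection hA' hB' (O := O') (J := deform_grading gam hB J) (mE := mE')
    (phi_inv gam hB mT mE \o dE) H' n <->
  is_chern_connection hA hB dE Hm nab.
Proof.
have V_inj := can_inj (phi_invK H caB bT bE HG).
split=> [[/connection_deform cc hm hd]|[cc hm hd]]; have [ln _ cn] := cc.
  split=> //; first exact/(metric_deform ln cn).
  by move=> e; apply: V_inj; rewrite -deform_pi01; apply: hd.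
split; first exact/connection_deform; first exact/(metric_deform ln cn).
by move=> e; rewrite /= -hd -deform_pi01.
Qed.

End Connection.
End Chern.

(** * Uniqueness of the Chern connection *)

(** A splitting of the map from the free module given by a finite set of
    generators has the coordinate functions [c i] as its components. *)
Lemma dual_basis (C : numClosedFieldType) (A B E : lmodType C) (hB : comodalg_ops A B)
    (act : B -> E -> E) :
  is_algebra (bmul hB) (bone hB) -> is_left_module hB act ->
  left_fin_gen act -> left_projective hB act ->
  exists n (g : 'I_n -> E) (c : 'I_n -> E -> B),
    (forall i, left_linear act (bmul hB) (c i)) /\
    (forall x, x = \sum_(i < n) act (c i x) (g i)).
Proof.
move=> aB mE [n [g gen]] proj; exists n, g.
pose actF (b : B) (f : 'I_n -> B) : 'I_n -> B := fun i => bmul hB b (f i).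
pose p (f : 'I_n -> B) : E := \sum_(i < n) act (f i) (g i).
have lF : is_left_module hB actF.
  split=> [f c a b|b c f f'|f|a b f]; apply/funext => i; rewrite /actF.
  - exact: (alg_linl aB).
  - exact: (alg_linr aB).
  - exact: (alg_1l aB).
  - by rewrite (alg_assoc aB).
have lp : left_linear actF act p.
  split=> [c f f'|b f].
    rewrite /p scaler_sumr -big_split; apply: eq_bigr => i _.
    exact: (lmod_linl mE (g i) c (f i) (f' i)).
  rewrite /p (lin_of_sum _ _ (lmod_linr mE b)); apply: eq_bigr => i _.
  by rewrite (lmod_M mE).
have lid : left_linear act act (fun x => x) by split.
have sp x : exists f, p f = x by have [b ->] := gen x; exists b.
have [h [lh hB_lin] ph] := proj _ _ _ _ p (fun x => x) lF mE lp sp lid.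
exists (fun i x => h x i); split=> [i|x].
  by split=> [c x y|b x]; [rewrite lh | rewrite hB_lin].
by rewrite -{1}(ph x).
Qed.

Section Uniqueness.
Variables (C : numClosedFieldType) (A B Om E : lmodType C) (hA : hopf_ops A).
Variable hB : comodalg_ops A B.
Variables (F : nat -> lmodType C) (O : calculus_ops A B Om F).
Variables (T : nat * nat -> lmodType C) (J : grading A B Om T).
Variables (mE : bimod_ops A B E) (Hm : conj_space E -> E -> B).
Variable dE : E -> tensB (gops J (0, 1)%N) mE.
Hypothesis H : is_hopf_star_algebra hA.
Hypothesis sB : is_comodule_star_algebra hA hB.
Hypothesis HO : is_star_calculus hA hB O.
Hypothesis HJ : is_complex_structure hA hB O J.
Hypothesis bE : is_bimod hA hB mE.
Hypothesis HH : is_hermitian_metric hA hB mE Hm.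
Hypothesis Efg : left_fin_gen (lact mE).
Hypothesis Eproj : left_projective hB (lact mE).
Local Notation mF := (gops (cgrad O) 1%N).
Local Notation Q := (tensB mF mE).
Local Notation mT := (gops J (0, 1)%N).
Local Notation inj1 := (@ginj _ _ _ _ _ _ (cgrad O) 1%N).
Local Notation ev := (contract_metric (O := O) (mE := mE) Hm).
Let gF := calc_grading HO.
Let gJ := cplx_grading HJ.
Let bT : is_bimod hA hB mT := grad_bimod gJ (0, 1)%N.
Let bF := form1_bimod HO.
Let bev := contract_metric_bilin HO HH.

Let lpi : linear (pi01 O J).
Proof.
exact: (lin_comp (proj_linear gJ (0, 1)%N) (grad_linear gF (i := 1%N))).
Qed.

(** Such a [w] has type (1,0), and the involution exchanges the types. *)
Lemma star_form_type01 w : pi01 O J w = 0 ->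
  exists y : T (0, 1)%N, inj1 (star_form O w) = ginj J y.
Proof.
move=> w0; have : range inj1 (inj1 w) by exists w.
rewrite (cplx_total HJ 1) => -[f /=]; rewrite !big_ord_recl big_ord0 addr0 /= => e.
have f0 : f 0%N = 0.
  move: w0; rewrite /pi01 e (lin_of_add (proj_linear gJ (0, 1)%N)) (ginjK gJ).
  by rewrite (proj_ginj_neq gJ) // addr0.
move: e; rewrite f0 (ginj0 gJ (0, 1)%N) add0r => e.
have : (bstar (calg O) @` range (@ginj _ _ _ _ _ _ J (1, 0)%N))%classic (bstar (calg O) (inj1 w)).
  by exists (inj1 w) => //; rewrite e; exists (f 1%N).
rewrite (cplx_star HJ) => -[y _ ey].
by exists y; rewrite (ginj_star_form HO).
Qed.

Let pi01_contract f (t : Q) :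
  pi01 O J (ev f t) =
  tlift (fun w x => ract mT w (pairing Hm x f)) (\tsum_(w, x <- t) (pi01 O J w ⊗ x : tensB mT mE)).
Proof.
have bP := pairing_bilin HH.
have bal : balanced (ract mT) (lact mE) (fun w x => ract mT w (pairing Hm x f)).
  split; [by lin | by lin |] => w b x.
  by rewrite (pairing_lact HH) (rmod_M (bimod_right bT)).
rewrite (lin_of_tlift _ _ (tliftP bal)) (lin_of_tlift _ _ lpi).
by apply: eq_tlift => w x; rewrite (tlift_tpure _ _ bal) (pi01_ract HO HJ).
Qed.

(** Every left linear form on [E] is a pairing, in particular those of a dual basis
    [(g i, c i)]; and [t] is the sum of the [(contraction of t with c i) (x) g i]. *)
Lemma contract_metric_eq0 (t : Q) : (forall f, ev f t = 0) -> t = 0.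
Proof.
move=> t0.
have [n [g [c [lc dual]]]] := dual_basis (ca_alg (csa_ca sB)) (bimod_left bE) Efg Eproj.
have fP i : exists f, Hm f = c i.
  have [_ _ surj] := metric_bij HH.
  by have [f _ <-] := surj (c i) (lc i); exists f.
have [f fE] := choice fP.
have lev i : linear (ev (f i)) by exact: (proj1 bev).
have lsum : linear (fun t : Q => \sum_(i < n) (ev (f i) t ⊗ g i : Q)).
  by apply: lin_sum => i; lin.
have -> : t = \sum_(i < n) (ev (f i) t ⊗ g i : Q).
  move: t {t0}; apply: tens_linear_ext => [||w x]; [exact: lin_id | exact: lsum |].
  rewrite [x in LHS]dual (lin_of_sum _ _ (tpure_linr _ _ w)).
  apply: eq_bigr => i _; rewrite -tpure_bal; congr (_ ⊗ _).
  rewrite /contract_metric tlift_tpure; first by rewrite /pairing fE.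
  have bP := pairing_bilin HH.
  split; [by lin | by lin |] => w' b x'.
  by rewrite (pairing_lact HH) (rmod_M (bimod_right bF)).
by rewrite big1 // => i _; rewrite t0 (lin_of_0 (tpure_linl _ _ (g i))).
Qed.

(** For the difference [D], the form [ev f (D e)] has no (0,1)-part, while by the
    metric condition it is minus the adjoint of such a form, hence of type (0,1). *)
Lemma chern_unique (nab nab' : E -> Q) :
  is_chern_connection hA hB dE Hm nab -> is_chern_connection hA hB dE Hm nab' ->
  nab = nab'.
Proof.
move=> [_ hm hd] [_ hm' hd']; pose D e := nab e - nab' e.
have lpt := tliftP (pi01_balanced mE HO HJ).
have D0 f e : pi01 O J (ev f (D e)) = 0.
  rewrite pi01_contract (lin_of_sub lpt).
  have -> : tlift (fun w x => pi01 O J w ⊗ x : tensB mT mE) (nab e) = dE e by exact: hd.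
  have -> : tlift (fun w x => pi01 O J w ⊗ x : tensB mT mE) (nab' e) = dE e by exact: hd'.
  rewrite subrr; have bP := pairing_bilin HH.
  apply: lin_of_0; apply: tliftP; split; [by lin | by lin |] => w b x.
  by rewrite (pairing_lact HH) (rmod_M (bimod_right bT)).
have Dm f e : ev f (D e) = - star_form O (ev (cbar e) (D (uncbar f))).
  have lev g : linear (ev g) by exact: (proj1 bev).
  have sf := antilinear_linear (star_form_antilinear HO).
  rewrite /D !(lin_of_sub (lev _)) [star_form O _](lin_of_sub sf).
  have := hm e f; rewrite (hm' e f).
  rewrite (conj_connection_sum HO HH nab) (conj_connection_sum HO HH nab').
  rewrite /contract_conj_metric => hh.
  rewrite opprB; apply/eqP; rewrite subr_eq addrAC eq_sym subr_eq addrC; apply/eqP.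
  exact: hh.
apply/funext => e; apply/eqP; rewrite -subr_eq0; apply/eqP.
apply: contract_metric_eq0 => f; rewrite -/(D e).
have [y hy] := star_form_type01 (D0 (cbar e) (uncbar f)).
have inj1_lin := grad_linear gF (i := 1%N).
have e1 : inj1 (ev f (D e)) = ginj J (- y).
  by rewrite Dm (lin_of_opp inj1_lin) hy (lin_of_opp (grad_linear gJ (i := (0, 1)%N))).
have y0 : - y = 0 by rewrite -[LHS](ginjK gJ) -e1; apply: D0.
apply: (can_inj (ginjK gF (i := 1%N))).
by rewrite e1 y0 (ginj0 gJ) (ginj0 gF).
Qed.

End Uniqueness.

Theorem theorem5p10 (R : realType)
  (* the Hopf *-algebra and the unitary cocycle with its convolution inverse *)
  (A : lmodType R[i]) (hA : hopf_ops A) (gam gamb : {scalar (A ⊗ A)%type})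
  (* the comodule *-algebra *)
  (B : lmodType R[i]) (hB : comodalg_ops A B)
  (* the *-calculus and its complex structure *)
  (Om : lmodType R[i]) (F : nat -> lmodType R[i]) (O : calculus_ops A B Om F)
  (T : nat * nat -> lmodType R[i]) (J : grading A B Om T)
  (* the holomorphic bimodule, its metric and its Chern connection *)
  (E : lmodType R[i]) (mE : bimod_ops A B E)
  (dE : E -> tensB (gops J (0, 1)%N) mE)
  (H : conj_space E -> E -> B)
  (nabla : E -> tensB (gops (cgrad O) 1%N) mE) :
  is_hopf_star_algebra hA ->
  is_cocycle hA gam gamb ->
  is_unitary_cocycle hA gam gamb ->
  is_comodule_star_algebra hA hB ->
  is_star_calculus hA hB O ->
  is_complex_structure hA hB O J ->
  is_holomorphic_bimodule hA hB O dE ->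
  left_fin_gen (lact mE) ->
  left_projective hB (lact mE) ->
  is_hermitian_metric hA hB mE H ->
  is_chern_connection hA hB dE H nabla ->
  unique
    (is_chern_connection
       (deform_hopf hA gam gamb) (deform_comodalg hA gam gamb hB)
       (O := deform_calculus hA gam gamb hB O)
       (J := deform_grading gam hB J)
       (mE := deform_bimod gam hB mE)
       (phi_inv gam hB (gops J (0, 1)%N) mE \o dE)
       (deform_metric hA gam gamb hB mE H))
    (phi_inv gam hB (gops (cgrad O) 1%N) mE \o nabla).
Proof.
move=> HA HG HU sB HO HJ [bE _ _ _ _] Efg Eproj HH Hnab.
have KV := phi_invK HA (csa_ca sB) (form1_bimod HO) bE HG.
have VK := phiVK HA (csa_ca sB) (form1_bimod HO) bE HG.
have deform := chern_deform HA HG HU sB HO HJ bE HH.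
split=> [|n' Hn'].
  apply/deform; suff -> : (fun e => phi gam hB (gops (cgrad O) 1%N) mE
    ((phi_inv gam hB (gops (cgrad O) 1%N) mE \o nabla) e)) = nabla by [].
  by apply/funext => e; apply: KV.
move/deform: Hn' => Hn'.
rewrite (chern_unique sB HO HJ bE HH Efg Eproj Hnab Hn').
by apply/funext => e; apply: VK.
Qed.
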